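(* Consider the Burgers equation $\partial_tu+\partial_x(u^2/2)=0$ on the half-line $[0,+\infty)$ with the random stationary boundary condition $u(t,0)=\phi(t,\omega)=\phi(\theta^t\omega)$. 1. There exists a stationary global solution $u_\omega$, satisfying $u_\omega(t,\cdot)=u_{\theta^t\omega}(\cdot)$. 2. The global solution $u$ of part 1 is unique in the following sense: if $\tilde u$ is a stationary global solution of the Burgers equation with this boundary condition such that, with probability $1$, $\tilde u(t,\cdot)\in\mathbb{U}_{-q}$ for all $t$, then, with probability $1$, $\tilde u$ coincides with $u$. 3. The solution $u$ of part 1 plays the role of a one-point random attractor on $\mathbb{U}_{-q}$: if $w\in\mathbb{U}_{-q}$, then with probability $1$ $$d(\Phi^{t,0}_\omega w,\,u_\omega)\to0\qquad\text{as }t\to-\infty .$$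
   Context: Random boundary condition: $(\Omega,\mathcal{F},\mathsf{P})$ is a probability space with an ergodic flow $(\theta^t)_{t\in\mathbb{R}}$ of $\mathsf{P}$-preserving measurable transformations, $\phi:\Omega\to\mathbb{R}$ is a random variable, and for all $\omega$ the process $\phi(t,\omega)=\phi(\theta^t\omega)$ is bounded on every finite time interval. With $\phi_+=\max(\phi,0)$, assume $q^2:=\mathsf{E}\phi_+^2<+\infty$, $q\ge0$. Function spaces: for $p\in\mathbb{R}\cup\{-\infty\}$, $\mathbb{U}_p=\{u\in L^1_{\mathrm{loc}}(\mathbb{R}_+):\ \liminf_{x\to+\infty}\frac1x\int_0^xu(y)\,dy>p\}$, where $\mathbb{R}_+=[0,+\infty)$, and $\mathbb{U}=\mathbb{U}_{-\infty}$. $\mathbb{D}$ is the set of c\`adl\`ag functions (of $x>0$). Solution operators: for $t_0<t_1$, $\Phi^{t_0,t_1}_\omega:\mathbb{U}\to\mathbb{U}\cap\mathbb{D}$ maps $u_0$ to the entropy solution at time $t_1$ of the Burgers equation with initial condition $u_0$ at time $t_0$ and boundary condition $\phi(\cdot,\omega)$, given as follows. Let $$U(t,x)=\inf_{\gamma:\gamma(t)=x}\Big\{U_0(\gamma(t_0))+\frac12\int_{t_0}^t\dot\gamma^2(s)\mathbf{1}_{\gamma(s)>0}\,ds-\frac12\int_{t_0}^t\phi_+^2(s,\omega)\mathbf{1}_{\gamma(s)=0}\,ds\Big\},\qquad U_0(y)=\int_0^yu_0(z)\,dz,$$ the infimum being over absolutely continuous $\gamma:[t_0,t]\to\mathbb{R}_+$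 with $\gamma(t)=x$. For each $t>t_0$, $\partial_xU(t,x)$ exists for all $x>0$ outside an at most countable set, and the solution is $u(t,x)=\partial_xU(t,x)$ there, extended to be right-continuous in $x$ at the exceptional points. Global solution: a $\mathbb{U}$-valued process $u_\omega(t,\cdot)$, $t\in\mathbb{R}$, such that for $\mathsf{P}$-a.e. $\omega$ and all $t_0<t_1$, $\Phi^{t_0,t_1}_\omega u_\omega(t_0,\cdot)=u_\omega(t_1,\cdot)$. It is stationary if $u_\omega(t,\cdot)=u_{\theta^t\omega}(\cdot)$, where $u_\omega(\cdot):=u_\omega(0,\cdot)$. Metric: for $h_1,h_2\in\mathbb{U}$, $d(h_1,h_2)=\exp(-r(h_1,h_2))$, where $r(h_1,h_2)\in[0,\infty]$ is the maximal $r>0$ such that $h_1$ and $h_2$ coincide on $[0,r]$; $d(h_1,h_2)=1$ if they coincide on no neighborhood of the origin, and $d(h_1,h_2)=0$ if $h_1\equiv h_2$.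
   Formalization: Part 3 is proved for q > 0 only: for q = 0 it is false (φ = 0, w = 1 gives x/|t| on (0,|t|), which never stabilizes near 0). Also φ(t,ω) = φ(θ^tω) is assumed jointly measurable in (t,ω), without which the claim can fail. *)

(* Defs.v *)
From HB Require Import structures.
From mathcomp Require Import all_boot all_order all_algebra.
From mathcomp Require Import all_classical all_reals all_analysis.
Set Implicit Arguments.
Unset Strict Implicit.
Unset Printing Implicit Defensive.
Import Order.TTheory GRing.Theory Num.Theory.
Import numFieldNormedType.Exports.

Local Open Scope classical_set_scope.
Local Open Scope ring_scope.

Section FunctionSpaces.
Context {R : realType}.
Local Notation mu := (@lebesgue_measure R).

Definition primitive (u : R -> R) (y : R) : R :=
  \int[mu]_(z in `[0, y]) u z.

(* Elements of L^1_loc([0, +oo)) are represented by functions R -> R whose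
   values off [0, +oo) are irrelevant; [eqU] is equality in L^1_loc. *)
Definition L1loc : set (R -> R) :=
  [set u | forall y, 0 <= y -> mu.-integrable `[0, y] (EFin \o u)].

Definition eqU (u v : R -> R) : Prop :=
  {ae mu, forall x, 0 <= x -> u x = v x}.

Definition UU (p : \bar R) : set (R -> R) :=
  [set u | L1loc u /\
    (p < limf_einf (fun x : R => (x^-1 * primitive u x)%:E) +oo%R)%E].

(* Since coincidence is meant almost everywhere, this supremum is attained;
   0 belongs to the set, so the supremum is 0 when h1 and h2 differ
   arbitrarily close to the origin. *)
Definition coincidence_radius (h1 h2 : R -> R) : \bar R :=
  ereal_sup [set r%:E | r in
    [set r : R | 0 <= r /\ {ae mu, forall x, 0 <= x <= r -> h1 x = h2 x}]].

Definition distU (h1 h2 : R -> R) : R :=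
  fine (expeR (- coincidence_radius h1 h2)%E).

End FunctionSpaces.

Section Burgers.
Context {R : realType}.
Local Notation mu := (@lebesgue_measure R).

Definition abs_continuous (a b : R) (f : R -> R) : Prop :=
  forall e : R, 0 < e -> exists2 delta : R, 0 < delta &
    forall (n : nat) (l r : 'I_n -> R),
      (forall i, [/\ a <= l i, l i <= r i & r i <= b]) ->
      trivIset setT (fun i => `]l i, r i[%classic) ->
      \sum_(i < n) (r i - l i) < delta ->
      \sum_(i < n) `|f (r i) - f (l i)| < e.

Definition paths (t0 t x : R) : set (R -> R) :=
  [set g | [/\ abs_continuous t0 t g,
               forall s, t0 <= s <= t -> 0 <= g s & g t = x]].

(* [b] is the boundary value t |-> phi(t, omega). The kinetic term may be
   +oo, hence the extended real value. *)
Definition action (b u0 : R -> R) (t0 t : R) (g : R -> R) : \bar R :=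
  ((primitive u0 (g t0))%:E
   + (2^-1)%:E * \int[mu]_(s in `[t0, t])
        (derive1 g s ^+ 2 * \1_[set y : R | 0 < y] (g s))%:E
   - (2^-1)%:E * \int[mu]_(s in `[t0, t])
        (Num.max (b s) 0 ^+ 2 * \1_[set 0 : R] (g s))%:E)%E.

Definition value (b u0 : R -> R) (t0 t x : R) : R :=
  fine (ereal_inf [set action b u0 t0 t g | g in paths t0 t x]).

(* The derivative of V where it exists; elsewhere the limit from the right of
   the derivative along the points where it exists. *)
Definition rc_derivative (V : R -> R) (x : R) : R :=
  if `[< derivable V x 1 >] then derive1 V x
  else lim (derive1 V y @[y --> within [set y | derivable V y 1] x^'+]).

Definition Phi (b : R -> R) (t0 t1 : R) (u0 : R -> R) : R -> R :=
  rc_derivative (value b u0 t0 t1).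

End Burgers.

Section RandomBoundary.
Context {R : realType} {d : measure_display} {Omega : measurableType d}.
Variable P : probability Omega R.

Definition ergodic_flow (theta : R -> Omega -> Omega) : Prop :=
  [/\ (forall w, theta 0 w = w) /\
      (forall s t w, theta (s + t) w = theta s (theta t w)),
      forall t, measurable_fun setT (theta t),
      forall t A, measurable A -> P (theta t @^-1` A) = P A
    & forall A, measurable A -> (forall t, theta t @^-1` A = A) ->
        P A = 0%E \/ P A = 1%E].

Definition boundary (theta : R -> Omega -> Omega) (phi : Omega -> R)
  (w : Omega) (t : R) : R := phi (theta t w).

(* Joint measurability in (t, omega) holds for any measurable flow. *)
Definition measurable_boundary (theta : R -> Omega -> Omega)
    (phi : Omega -> R) : Prop :=
  measurable_fun [set: measurableTypeR R * Omega]
    (fun tw => boundary theta phi tw.2 tw.1).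

Definition locally_bounded_boundary (theta : R -> Omega -> Omega)
    (phi : Omega -> R) : Prop :=
  forall w a b, exists M : R, forall t, a <= t <= b ->
    `|boundary theta phi w t| <= M.

(* The primitives at the points of [0, +oo) generate the Borel sigma-algebra
   of L^1_loc([0, +oo)), so the second condition says that u(t) is a random
   element of L^1_loc. *)
Definition U_process (u : Omega -> R -> R -> R) : Prop :=
  (forall w t, UU -oo%E (u w t)) /\
  (forall t y, 0 <= y -> measurable_fun setT (fun w => primitive (u w t) y)).

Definition global_solution (theta : R -> Omega -> Omega) (phi : Omega -> R)
    (u : Omega -> R -> R -> R) : Prop :=
  U_process u /\
  {ae P, forall w, forall t0 t1, t0 < t1 ->
     eqU (Phi (boundary theta phi w) t0 t1 (u w t0)) (u w t1)}.

Definition stationary (theta : R -> Omega -> Omega)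
    (u : Omega -> R -> R -> R) : Prop :=
  forall w t, eqU (u w t) (u (theta t w) 0).

End RandomBoundary.

(* Main.v *)
Require Import Defs.
From HB Require Import structures.
From mathcomp Require Import all_boot all_order all_algebra.
From mathcomp Require Import all_classical all_reals all_analysis.
From mathcomp Require Import measurable_realfun lra.
Import Order.TTheory GRing.Theory Num.Theory.
Import numFieldNormedType.Exports.
Local Open Scope classical_set_scope.
Local Open Scope ring_scope.

(** The proof rests on a Hopf-Lax description of the solution operator and on
    one explicit function, the stationary potential.

    Write [gain b t] for the integral of (b_+)^2 / 2 from 0 to t.  A path from
    (t0, y) to (t, x) either stays positive, and then costs at least the
    straight line, or it has a first zero s1 and a last zero s2.  In the second
    case it pays at least y^2 / (2 (s1 - t0)) to reach the boundary and
    x^2 / (2 (t - s2)) to leave it, and in between it wins at most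
    gain s2 - gain s1, which a path resting at 0 achieves.  Hence the value
    function is the infimum of an explicit set of real numbers ([path_costs],
    [value_eq]).  The lower bounds need the fundamental theorem of calculus for
    absolutely continuous paths ([abs_continuous_FTC]) and the Cauchy-Schwarz
    inequality.

    Sending t0 to -oo and letting the path start on the boundary suggests the
    potential W_t(x) = inf_{s < t} (gain t - gain s + x^2 / (2 (t - s))).  For
    every boundary value, evolving W_{t0} until t1 gives W_{t1} up to an
    additive constant ([value_potential]), so the derivative of W_t in x is a
    global solution, and it is stationary because W is built from the past of
    the boundary value alone ([stationary_solution]).

    Attraction is a comparison of rates.  By ergodicity gain s is equivalent to
    q^2 s / 2 as s tends to -oo ([mean_gain_ae]).  If the initial primitive is
    at least - a y - C with a < q, then avoiding the boundary for a time T wins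
    at most a^2 T / 2 + C, less than the q^2 T / 2 available on the boundary.
    Therefore, when t0 is far in the past, near-optimal paths ending in [0, r]
    at time 0 touch the boundary early, and their last departure from it is
    governed by W_0 alone: on [0, r] the value function is W_0 plus a constant
    ([attraction]), and the solutions coincide there.

    For uniqueness with q > 0, a stationary solution in UU (- q) satisfies a
    lower bound - a y - C with a < q and C depending on the sample; by
    recurrence the same a and C are valid at infinitely many times - k
    ([ae_recurrence]), and attraction from these times identifies the solution
    at time 0 ([unique_at_zero]).  If q = 0 the boundary is inert in the past
    and the free evolution flattens every solution: its primitive at time 0
    becomes nonpositive, which UU 0 excludes.  So there is no competitor at all
    ([unique_at_zero_without_gain]).  Stationarity and the evolution carry the
    equality from time 0 to all times ([uniqueness]). *)

Set Implicit Arguments.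
Unset Strict Implicit.
Unset Printing Implicit Defensive.

(** * The fundamental theorem of calculus for absolutely continuous functions *)

Section AbsoluteContinuity.
Context {R : realType}.
Local Notation mu := (@lebesgue_measure R).
Implicit Types (a b : R) (g : R -> R).

(** Subdividing several intervals at once produces families indexed by pairs;
    arbitrary finite index types spare their explicit numbering. *)
Lemma abs_continuous_fam a b g : abs_continuous a b g ->
  forall e : R, 0 < e -> exists2 delta : R, 0 < delta &
    forall (I : finType) (l r : I -> R),
      (forall i, [/\ a <= l i, l i <= r i & r i <= b]) ->
      trivIset setT (fun i => `]l i, r i[%classic) ->
      \sum_i (r i - l i) < delta ->
      \sum_i `|g (r i) - g (l i)| < e.
Proof.
move=> ac e e0; have [d d0 acd] := ac e e0; exists d => // I l r lr tI sd.
have sumE (F : I -> R) : \sum_i F i = \sum_(k < #|I|) F (enum_val k).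
  by rewrite (reindex _ (onW_bij _ (@enum_val_bij I))).
rewrite sumE.
apply: (acd #|I| (l \o enum_val) (r \o enum_val)) => //=.
- apply/trivIsetP => i j _ _ ij; move/trivIsetP : tI; apply => //.
  by apply: contra ij => /eqP/enum_val_inj ->.
- by rewrite -(sumE (fun i => r i - l i)).
Qed.

Section PartitionPoints.
Variables (l r : R) (s : seq R).
Hypothesis sP : itv_partition l r s.
Let p (j : nat) : R := nth r (l :: s) j.

Lemma partition_point_last j : (size s <= j)%N -> p j = r.
Proof.
rewrite leq_eqVlt => /predU1P[<-|sj]; last by rewrite /p nth_default.
by rewrite /p nth_last /=; case: sP => _ /eqP.
Qed.

Lemma partition_point_homo : {homo p : i j / (i <= j)%N >-> i <= j}.
Proof.
apply: homo_leq => [x//|y x z|j]; first exact: le_trans.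
have [sj|js] := leqP (size s) j.
  by rewrite !partition_point_last// (leq_trans sj).
by case: sP => /(pathP r) /(_ j js) /ltW.
Qed.

Lemma partition_point_bounds j : l <= p j <= r.
Proof.
have -> : l = p 0 by [].
rewrite (partition_point_homo (leq0n j))/=.
have [sj|/ltnW js] := leqP (size s) j; first by rewrite partition_point_last.
by rewrite -[X in _ <= X](partition_point_last (leqnn _)) partition_point_homo.
Qed.

Lemma variation_partition_points g m : (size s <= m)%N ->
  variation l r g s <= \sum_(j < m) `|g (p j.+1) - g (p j)|.
Proof.
move=> sm; rewrite /variation -[leRHS](big_mkord xpredT (fun j => `|g (p j.+1) - g (p j)|)).
by rewrite [leRHS](@big_cat_nat _ _ _ (size s)) //= lerDl sumr_ge0.
Qed.

End PartitionPoints.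

(** The total variation inherits absolute continuity: the subintervals of
    partitions of all the [l i, r i] together still have total length below
    delta, so the variations along them add up to less than e whichever
    partitions are chosen. *)
Lemma total_variation_fam a b g : abs_continuous a b g ->
  forall e : R, 0 < e -> exists2 delta : R, 0 < delta &
    forall (I : finType) (l r : I -> R),
      (forall i, [/\ a <= l i, l i <= r i & r i <= b]) ->
      trivIset setT (fun i => `]l i, r i[%classic) ->
      \sum_i (r i - l i) < delta ->
      (forall i, total_variation (l i) (r i) g \is a fin_num) /\
      \sum_i fine (total_variation (l i) (r i) g) <= e.
Proof.
move=> /abs_continuous_fam ac e e0; have [d d0 acd] := ac e e0.
exists d => // I l r lr tI sd.
(* all the intervals of all the partitions form one admissible family *)
have key (S : I -> seq R) : (forall i, itv_partition (l i) (r i) (S i)) ->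
    \sum_i variation (l i) (r i) g (S i) < e.
  move=> PS; pose m := \max_i size (S i).
  pose p i j := nth (r i) (l i :: S i) j.
  have Sm i : (size (S i) <= m)%N by exact: leq_bigmax.
  have pb i j := partition_point_bounds (PS i) j.
  apply: (@le_lt_trans _ _ (\sum_(k : I * 'I_m)
      `|g (p k.1 k.2.+1) - g (p k.1 k.2)|)).
    rewrite -(pair_bigA _ (fun i (j : 'I_m) => `|g (p i j.+1) - g (p i j)|))/=.
    by apply: ler_sum => i _; exact: variation_partition_points.
  apply: (acd (I * 'I_m)%type (fun k => p k.1 k.2) (fun k => p k.1 k.2.+1)).
  - move=> [i j]/=; have [al lri rb] := lr i.
    have /andP[lp _] := pb i j; have /andP[_ pr] := pb i j.+1.
    split; [exact: le_trans lp|exact: partition_point_homo|exact: le_trans rb].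
  - apply/trivIsetP => -[i j] [i' j'] _ _ /= ij.
    have [ii'|ii'] := eqVneq i i'; last first.
      move/trivIsetP : tI => /(_ i i' Logic.I Logic.I ii').
      apply: subsetI_eq0 => x /=; rewrite !in_itv/= => /andP[];
      [have /andP[] := pb i j; have /andP[_] := pb i j.+1
      |have /andP[] := pb i' j'; have /andP[_] := pb i' j'.+1];
      by move=> h1 h2 _ h3 h4; rewrite (le_lt_trans h2 h3) (lt_le_trans h4 h1).
    subst i'; have {}ij : j != j' by apply: contra ij => /eqP ->.
    have disj (k k' : 'I_m) : (k < k')%N ->
        `]p i k, p i k.+1[ `&` `]p i k', p i k'.+1[ = set0.
      move=> kk'; rewrite -subset0 => x [] /=; rewrite !in_itv/= => /andP[_ h1] /andP[h2 _].
      have := lt_trans h2 h1; rewrite ltNge => /negP; apply.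
      exact: (partition_point_homo (PS i)).
    case: (ltngtP j j') => [|j'j|/val_inj jj']; first exact: disj.
      by rewrite setIC disj.
    by rewrite jj' eqxx in ij.
  - apply: le_lt_trans sd.
    rewrite -(pair_bigA _ (fun i (j : 'I_m) => p i j.+1 - p i j))/=.
    apply: ler_sum => i _.
    rewrite -(big_mkord xpredT (fun j => p i j.+1 - p i j)) telescope_sumr//.
    by rewrite /p (partition_point_last (PS i) (Sm i)).
have /choice[S0 S0P] : forall i, exists s, itv_partition (l i) (r i) s.
  move=> i.
  have [_ + _] := lr i; rewrite le_eqVlt => /predU1P[->|lri].
    by exists [::]; split => //=.
  by exists [:: r i]; exact: itv_partition1.
have var_ge0 i s : 0 <= variation (l i) (r i) g s by exact: sumr_ge0.
have fin i : total_variation (l i) (r i) g \is a fin_num.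
  have [_ lri _] := lr i.
  rewrite ge0_fin_numE ?total_variation_ge0//.
  apply: (@le_lt_trans _ _ e%:E); last exact: ltry.
  apply: ge_ereal_sup => _ /= [_ [s sP <-] <-]; rewrite lee_fin.
  have := key (fun j => if j == i then s else S0 j).
  rewrite (bigD1 i)//= eqxx => h; apply/ltW; apply: le_lt_trans (h _).
    by rewrite lerDl sumr_ge0.
  by move=> j; case: eqP => [->|_].
split => //; apply/ler_addgt0Pr => eta eta0.
have n0 : 0 < #|I|.+1%:R :> R by [].
have /choice[S SP] : forall i, exists s, itv_partition (l i) (r i) s /\
    fine (total_variation (l i) (r i) g) - eta / #|I|.+1%:R
      <= variation (l i) (r i) g s.
  move=> i.
  have /ub_ereal_sup_adherent := fin i.
  move=> /(_ (eta / #|I|.+1%:R)); rewrite divr_gt0// => /(_ isT)[_ [_ [s sP <-] <-] h].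
  by exists s; split => //; rewrite -lee_fin EFinB fineK//; exact: ltW.
have := key S (fun i => (SP i).1).
move=> /ltW ke; apply: le_trans (lerD ke (lexx eta)).
have : \sum_i (fine (total_variation (l i) (r i) g) - eta / #|I|.+1%:R)
       <= \sum_i variation (l i) (r i) g (S i).
  by apply: ler_sum => i _; case: (SP i).
rewrite sumrB lerBlDr => h; apply: (le_trans h); rewrite lerD2l.
rewrite sumr_const -[X in X <= _]mulr_natr mulrAC ler_pdivrMr// ler_pM2l//.
by rewrite ler_nat.
Qed.

(** Puts the components of an open set of finite measure in the concrete form
    to which absolute continuity and interval formulas for measures apply. *)
Lemma bounded_open_interval (I : set R) : open I -> is_interval I ->
  (mu I < +oo)%E -> exists c d : R, c <= d /\ I = `]c, d[%classic.
Proof.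
move=> oI /is_intervalP II.
have [->|] := eqVneq I set0.
  by move=> _; exists 0, 0; rewrite set_itv_ge ?bnd_simp ?ltxx.
move=> /set0P[z]; move: (oI); rewrite {1}II => /interior_id.
rewrite -II; case: (Rhull I) II => [[u x|u] [v y|v]] ->.
- rewrite interior_itv => <- /= /andP[/ltW xz /ltW zy] _.
  by exists x, y; split => //; exact: le_trans zy.
- case: v => /= _; first by rewrite in_itv/= andbF.
  by move=> _; rewrite lebesgue_measure_itv/= ltry.
- case: u => /= _; last by rewrite in_itv.
  by move=> _; rewrite lebesgue_measure_itv/= ltNyr.
- case: u => /= _; last by rewrite in_itv.
  case: v => /=; first by rewrite in_itv.
  by move=> _; rewrite lebesgue_measure_itv.
Qed.

(** The projection of the line onto [a, b]; composing with it extends a function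
    on [a, b] by its values at the endpoints. *)
Definition clip a b (x : R) : R := Num.min (Num.max x a) b.

Lemma clip_in a b x : a <= b -> a <= clip a b x <= b.
Proof.
move=> ab; rewrite /clip; case: (leP x a) => ?; [case: (leP a b)|case: (leP x b)] => ?; apply/andP; split; lra.
Qed.

Lemma clip_id a b x : a <= x <= b -> clip a b x = x.
Proof.
move=> /andP[? ?]; rewrite /clip; case: (leP x a) => ?; [case: (leP a b)|case: (leP x b)] => ?; lra.
Qed.

Lemma clip_incr a b c d : a <= b -> c <= d ->
  [/\ clip a b c <= clip a b d, clip a b d - clip a b c <= d - c &
      clip a b c < clip a b d -> c <= clip a b c /\ clip a b d <= d].
Proof.
move=> ab cd; rewrite /clip; case: (leP c a) => ?; case: (leP d a) => ?;
  case: (leP a b) => ?; case: (leP c b) => ?; case: (leP d b) => ?;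
  split=> *; try split; lra.
Qed.

(** Absolute continuity without absolute values on the increments, which is the
    same notion for nondecreasing functions and is stable under sums. *)
Definition increments_ac a b (F : R -> R) :=
  forall e : R, 0 < e -> exists2 delta : R, 0 < delta &
    forall (I : finType) (l r : I -> R),
      (forall i, [/\ a <= l i, l i <= r i & r i <= b]) ->
      trivIset setT (fun i => `]l i, r i[%classic) ->
      \sum_i (r i - l i) < delta ->
      \sum_i (F (r i) - F (l i)) <= e.

Lemma increments_ac_clip a b F : a <= b -> increments_ac a b F ->
  forall e : R, 0 < e -> exists2 delta : R, 0 < delta &
    forall (I : finType) (l r : I -> R),
      (forall i, l i <= r i) ->
      trivIset setT (fun i => `]l i, r i[%classic) ->
      \sum_i (r i - l i) < delta ->
      \sum_i (F (clip a b (r i)) - F (clip a b (l i))) <= e.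
Proof.
move=> ab ac e e0; have [d d0 acd] := ac e e0; exists d => // I l r lr tI sd.
apply: acd.
- move=> i; have [h _ _] := clip_incr ab (lr i).
  by have /andP[? ?] := clip_in (l i) ab; have /andP[? ?] := clip_in (r i) ab.
- apply/trivIsetP => i j _ _ ij; move/trivIsetP : tI => /(_ i j Logic.I Logic.I ij).
  apply: subsetI_eq0 => x /=; rewrite !in_itv/= => /andP[h1 h2].
    have [_ _ /(_ (lt_trans h1 h2))[h3 h4]] := clip_incr ab (lr i).
    by rewrite (le_lt_trans h3 h1) (lt_le_trans h2 h4).
  have [_ _ /(_ (lt_trans h1 h2))[h3 h4]] := clip_incr ab (lr j).
  by rewrite (le_lt_trans h3 h1) (lt_le_trans h2 h4).
- by apply: le_lt_trans sd; apply: ler_sum => i _; have [] := clip_incr ab (lr i).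
Qed.

Section MonotoneDensity.
Variables (a b : R) (F : R -> R).
Hypothesis ab : a < b.
Hypothesis F_nd : {in `[a, b] &, nondecreasing_fun F}.
Hypothesis F_ac : increments_ac a b F.
Hypotheses (Fa : F a = 0) (Fb : F b = 1).

Let V x := F (clip a b x).

Let V_nd : nondecreasing V.
Proof.
move=> x y xy; have [h _ _] := clip_incr (ltW ab) xy.
by apply: F_nd => //; rewrite in_itv/= clip_in// ltW.
Qed.

Let V_cont : continuous V.
Proof.
move=> x; apply/cvgrPdist_le => e e0.
have [d d0 Vd] := increments_ac_clip (ltW ab) F_ac e0.
have close u v : u <= v -> v - u < d -> V v - V u <= e.
  move=> uv uvd; have := Vd unit (fun=> u) (fun=> v) (fun=> uv).
  by rewrite !big_const card_unit/= !addr0; apply => //; apply/trivIsetP => -[] [].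
near=> y; have xyd : `|x - y| < d.
  by near: y; exact: (@cvgr_dist_lt _ _ _ (nbhs x) _ id x cvg_id).
have [xy|/ltW yx] := leP x y.
  by rewrite distrC ger0_norm ?subr_ge0 ?V_nd// close//; rewrite distrC ger0_norm ?subr_ge0 in xyd.
by rewrite ger0_norm ?subr_ge0 ?V_nd// close//; rewrite ger0_norm ?subr_ge0 in xyd.
Unshelve. all: by end_near. Qed.

Let V_rc : right_continuous V.
Proof. by apply: right_continuousW; exact: V_cont. Qed.

Let V_Ny : V @ -oo --> (0 : R).
Proof.
apply: cvg_near_cst; near=> x; rewrite /V /clip.
have xa : x <= a by [].
by rewrite (max_idPr xa) (min_idPl (ltW ab)).
Unshelve. all: by end_near. Qed.

Let V_y : V @ +oo --> (1 : R).
Proof.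
apply: cvg_near_cst; near=> x; rewrite /V /clip.
have bx : b <= x by [].
by rewrite (max_idPl (le_trans (ltW ab) bx)) (min_idPr bx).
Unshelve. all: by end_near. Qed.

Let W : cumulativeBounded (0 : R) (1 : R) :=
  HB.pack V (isCumulative.Build _ _ _ V V_nd V_rc)
    (isCumulativeBounded.Build _ 0 1 V V_Ny V_y).

Let nu : probability (measurableTypeR R) R := lebesgue_stieltjes_measure W.

Let nu_itv c d : c <= d -> nu `]c, d]%classic = (V d - V c)%:E.
Proof.
move=> cd; rewrite /nu/= /lebesgue_stieltjes_measure /measure_extension.
rewrite measurable_mu_extE/=; last exact: is_ocitv.
by rewrite wlength_itv_bnd.
Qed.

Let nu_dom : nu `<< mu.
Proof.
move=> N N0 A mA AN; have muA0 : mu A = 0 by exact: N0.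
apply/eqP; rewrite eq_le measure_ge0 andbT; apply/lee_addgt0Pr => e e0.
rewrite add0e.
have [d d0 Vd] := increments_ac_clip (ltW ab) F_ac e0.
have d20 : 0 < d / 2 by rewrite divr_gt0.
have [U [oU AU Ud]] := @lebesgue_regularity_outer _ A (d / 2) mA
  (eq_ind_r (fun z => (z < +oo)%E) (ltry 0) muA0) d20.
have mU : measurable U by exact: open_measurable.
have muU : (mu U < d%:E)%E.
  rewrite -(setDUK AU) (@le_lt_trans _ _ (mu A + mu (U `\` A))%E)//.
    by rewrite measureU2//; exact: measurableD.
  rewrite muA0 add0e; apply: (lt_trans Ud); rewrite lte_fin; lra.
pose J := open_disjoint_itv oU.
have mJ i : measurable (J i) by apply: open_measurable; exact: open_disjoint_itv_open.
have tJ : trivIset setT J by exact: open_disjoint_itv_trivIset.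
have UJ : U = \bigcup_i J i by exact: open_disjoint_itv_bigcup.
have Jfin i : (mu (J i) < +oo)%E.
  apply: (@le_lt_trans _ _ (mu U)); last by rewrite (lt_trans muU)// ltry.
  apply: le_measure; rewrite ?inE; [exact: mJ|exact: mU|].
  by move=> x Jx; rewrite UJ; exists i.
have /choice[c /choice[c' cP]] : forall i, exists c, exists c', c <= c' /\ J i = `]c, c'[%classic.
  move=> i; apply: bounded_open_interval => //; first exact: open_disjoint_itv_open.
  exact: open_disjoint_itv_is_interval.
apply: (@le_trans _ _ (nu U)); first by apply: le_measure; rewrite ?inE.
have sumJ (m : {measure set (measurableTypeR R) -> \bar R}) :
    m U = (\sum_(i <oo) m (J i))%E.
  rewrite UJ measure_bigcup//; last by move=> i _; exact: mJ.
  by apply: eq_eseriesl => i; rewrite in_setT.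
rewrite sumJ; apply: lime_le; first exact: is_cvg_nneseries.
near=> n; rewrite big_mkord.
apply: (@le_trans _ _ (\sum_(i < n) (V (c' i) - V (c i)))%:E)%E.
  rewrite -sumEFin; apply: lee_sum => i _; have [cc JE] := cP i.
  rewrite -nu_itv// JE; apply: le_measure; rewrite ?inE//.
  by apply: subset_itvl; rewrite bnd_simp.
rewrite lee_fin; apply: (Vd 'I_n (fun i => c i) (fun i => c' i)).
- by move=> i; case: (cP i).
- apply/trivIsetP => i j _ _ ij; rewrite -(cP i).2 -(cP j).2.
  by move/trivIsetP : tJ; apply.
- rewrite -lte_fin; apply: le_lt_trans muU.
  rewrite (sumJ mu) -sumEFin.
  rewrite (eq_bigr (fun i : 'I_n => mu (J i))).
    rewrite -(big_mkord xpredT (mu \o J)).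
    exact: nneseries_lim_ge.
  move=> i _; have [cc ->] := cP i.
  by rewrite lebesgue_measure_itv/= lte_fin; case: ltgtP cc => // ->; rewrite subrr.
Unshelve. all: by end_near. Qed.

(** The Stieltjes measure of a nondecreasing absolutely continuous function does
    not charge Lebesgue-null sets, since these are contained in open sets whose
    components have arbitrarily small total length.  Its Radon-Nikodym density is
    the required f.  The normalisation F a = 0, F b = 1 makes it a probability
    measure. *)
Lemma monotone_density : exists f : R -> R,
  [/\ forall x, 0 <= f x, mu.-integrable setT (EFin \o f) &
      forall x, a <= x <= b -> F x = \int[mu]_(t in `[a, x]) f t].
Proof.
have [f [f0 ffin fint fE]] := radon_nikodym_sigma_finite nu_dom.
pose h : R -> R := fun x => fine (f x).
have hint : mu.-integrable setT (EFin \o h).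
  by apply: eq_integrable fint => // x _; rewrite /= fineK.
exists h; split => //; first by move=> x; rewrite fine_ge0.
move=> x /andP[ax xb].
have -> : F x = fine (nu `]a, x]%classic).
  by rewrite nu_itv//= /V clip_id ?ax// clip_id ?lexx ?ltW// Fa subr0.
rewrite fE// -Rintegral_itv_obnd_cbnd; last exact: integrableS hint.
by congr fine; apply: eq_integral => y _; rewrite /= fineK.
Qed.

End MonotoneDensity.

Lemma increments_acD a b F G : increments_ac a b F -> increments_ac a b G ->
  increments_ac a b (fun x => F x + G x).
Proof.
move=> Fac Gac e e0; have e20 : 0 < e / 2 by rewrite divr_gt0.
have [d d0 Fd] := Fac _ e20; have [d' d'0 Gd] := Gac _ e20.
exists (Num.min d d'); first by rewrite lt_min d0.
move=> I l r lr tI; rewrite lt_min => /andP[sd sd'].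
under eq_bigr do rewrite opprD addrACA.
by rewrite big_split/= [leRHS]splitr lerD// ?Fd ?Gd.
Qed.

Lemma abs_continuous_increments a b g : abs_continuous a b g -> increments_ac a b g.
Proof.
move=> /abs_continuous_fam ac e e0; have [d d0 gd] := ac e e0; exists d => // I l r lr tI sd.
apply: (le_trans _ (ltW (gd I l r lr tI sd))); apply: ler_sum => i _; exact: ler_norm.
Qed.

(** On pieces shorter than the delta given by e = 1 the variation is finite, and
    finitely many such pieces cover [a, b]. *)
Lemma total_variation_fin a b g : a <= b -> abs_continuous a b g ->
  total_variation a b g \is a fin_num.
Proof.
move=> ab /total_variation_fam /(_ _ ltr01)[d d0 gd].
(* [a, b] is cut into n pieces of length h < d *)
pose n := (Num.truncn ((b - a) / d)).+1.
pose h := (b - a) / n%:R.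
have h0 : 0 <= h by rewrite divr_ge0// subr_ge0.
have hd : h < d.
  rewrite /h ltr_pdivrMr ?ltr0n// mulrC -ltr_pdivrMr//.
  exact: Num.Theory.truncnS_gt.
have hn : a + n%:R * h = b by rewrite /h mulrC divfK ?pnatr_eq0// addrC subrK.
rewrite -hn; have : (n <= n)%N by [].
elim: {-2}n => [|k ih] kn; first by rewrite mul0r addr0 total_variationxx.
have kh : a + k%:R * h <= a + k.+1%:R * h by rewrite lerD2l ler_wpM2r// ler_nat.
have ak : a <= a + k%:R * h by rewrite lerDl mulr_ge0.
rewrite (total_variationD _ ak kh) fin_numD ih ?(ltnW kn)//=.
have [|||+ _] := gd unit (fun=> a + k%:R * h) (fun=> a + k.+1%:R * h).
- by move=> _; split => //; rewrite -[leRHS]hn lerD2l ler_wpM2r// ler_nat.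
- by apply/trivIsetP => -[] [].
- rewrite big_const card_unit/= addr0 opprD addrACA subrr add0r -mulrBl.
  by rewrite -natrB// subSnn mul1r.
by apply.
Qed.

Lemma monotone_increments_density a b F : a < b ->
  {in `[a, b] &, nondecreasing_fun F} -> increments_ac a b F -> F a < F b ->
  exists f : R -> R, mu.-integrable setT (EFin \o f) /\
      forall x, a <= x <= b -> F x - F a = \int[mu]_(t in `[a, x]) f t.
Proof.
move=> ab Fnd Fac Fab; pose c := F b - F a.
have c0 : 0 < c by rewrite subr_gt0.
pose G x := c^-1 * (F x - F a).
have [||||f [f0 fint fE]] := @monotone_density a b G ab.
- by move=> x y xab yab xy; rewrite /G ler_pM2l ?invr_gt0// lerD2r Fnd.
- move=> e e0; have [d d0 Fd] := Fac _ (mulr_gt0 c0 e0); exists d => // I l r lr tI sd.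
  have -> : \sum_i (G (r i) - G (l i)) = c^-1 * \sum_i (F (r i) - F (l i)).
    by rewrite mulr_sumr; apply: eq_bigr => i _; rewrite /G -mulrBr; congr (_ * _); lra.
  by rewrite ler_pdivrMl// Fd.
- by rewrite /G subrr mulr0.
- by rewrite /G mulVf// gt_eqF.
exists (fun x => c * f x); split.
  by apply: eq_integrable (integrableZl measurableT c fint) => // x _.
move=> x xab; rewrite RintegralZl//; last exact: integrableS fint.
by rewrite -fE// /G mulrA mulfV ?gt_eqF// mul1r.
Qed.

(** With v the total variation function, g is the difference of v + id + g and
    v + id, both nondecreasing and absolutely continuous, hence both primitives
    (the identity makes them strictly increasing, so that they can be
    normalised).  Almost everywhere differentiability is then Lebesgue's theorem
    for the difference of the two densities. *)
Theorem abs_continuous_FTC a b g : a < b -> abs_continuous a b g ->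
  exists f : R -> R, [/\ mu.-integrable setT (EFin \o f),
    forall x, a <= x <= b -> g x - g a = \int[mu]_(t in `[a, x]) f t &
    {ae mu, forall x, a < x < b -> derivable g x 1 /\ derive1 g x = f x}].
Proof.
move=> ab ac; pose v x := fine (total_variation a x g).
have TVfin x y : a <= x -> x <= y -> y <= b -> total_variation x y g \is a fin_num.
  move=> ax xy yb; have := total_variation_fin (ltW ab) ac.
  rewrite (total_variationD _ (le_trans ax xy) yb) fin_numD => /andP[+ _].
  by rewrite (total_variationD _ ax xy) fin_numD => /andP[_ +].
have vB x y : a <= x -> x <= y -> y <= b -> v y - v x = fine (total_variation x y g).
  move=> ax xy yb; rewrite /v (total_variationD _ ax xy) fineD ?TVfin// ?(le_trans xy)//.
  by rewrite addrAC subrr add0r.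
have vac : increments_ac a b v.
  move=> e e0; have [d d0 gd] := total_variation_fam ac e0.
  exists d => // I l r lr tI sd; have [_ gde] := gd I l r lr tI sd.
  apply: le_trans gde; apply: ler_sum => i _; have [al lri rb] := lr i.
  by rewrite vB.
have idac : increments_ac a b id.
  by move=> e e0; exists e => // I l r _ _ /ltW.
have gac := abs_continuous_increments ac.
have gv x y : a <= x -> x <= y -> y <= b -> `|g y - g x| <= v y - v x.
  move=> ax xy yb; rewrite vB// -lee_fin fineK ?TVfin//.
  exact: total_variation_ge.
have [|||f1 [i1 f1E]] := @monotone_increments_density a b (fun x => v x + id x) ab.
- move=> x y; rewrite !in_itv/= => /andP[ax xb] /andP[ay yb] xy.
  have := le_trans (normr_ge0 _) (gv x y ax xy yb) ; lra.
- exact: increments_acD.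
- have := le_trans (normr_ge0 _) (gv a b (lexx _) (ltW ab) (lexx _)); rewrite /=; lra.
have [|||f2 [i2 f2E]] := @monotone_increments_density a b (fun x => v x + id x + g x) ab.
- move=> x y; rewrite !in_itv/= => /andP[ax xb] /andP[ay yb] xy.
  have := gv x y ax xy yb; rewrite ler_norml => /andP[h _]; lra.
- by apply: increments_acD => //; exact: increments_acD.
- have := gv a b (lexx _) (ltW ab) (lexx _); rewrite ler_norml => /andP[h _].
  by rewrite /=; lra.
pose f x := f2 x - f1 x.
have fint : mu.-integrable setT (EFin \o f).
  by apply: eq_integrable (integrableB measurableT i2 i1) => // x _.
have gE x : a <= x <= b -> g x - g a = \int[mu]_(t in `[a, x]) f t.
  move=> xab; rewrite RintegralB//; [|exact: integrableS i2|exact: integrableS i1].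
  by rewrite -f1E// -f2E//; lra.
exists f; split => //.
have fi y : mu.-integrable [set` Interval (BLeft a) (BRight y)] (EFin \o f).
  exact: integrableS fint.
have := FTC1 fi (open_integrable_locally openT fint).
apply: filterS; first exact: (ae_filter_ringOfSetsType mu).
move=> x /= + /andP[ax xb].
rewrite lte_fin => /(_ ax)[df f'].
pose F y := \int[mu]_(t in `[a, y]) f t.
have nearE : \forall y \near x, g a + F y = g y.
  near=> y.
  have yab : y \in `]a, b[.
    by near: y; apply: near_in_itvoo; rewrite in_itv/= ax.
  have {}yab : a <= y <= b.
    by move: yab; rewrite in_itv/= => /andP[/ltW -> /ltW ->].
  by rewrite [F y](esym (gE y yab)) addrC subrK.
have isF : is_derive x 1 F (f x) by split; [exact: df|rewrite -derive1E; exact: f'].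
have isd : is_derive x 1 (cst (g a) + F) (0 + f x) by apply: is_deriveD.
rewrite add0r in isd.
have isg : is_derive x 1 g (f x) by apply: near_eq_is_derive isd.
by split; [case: isg|rewrite derive1E; case: isg].
Unshelve. all: by end_near. Qed.

End AbsoluteContinuity.

(** * Integral inequalities for the action *)

Section Integrals.
Context {R : realType}.
Local Notation mu := (@lebesgue_measure R).
Local Open Scope ereal_scope.

(** No measurability is assumed: the derivative of a path is an arbitrary
    function off a null set, and the integral of a nonnegative function is a
    supremum over simple minorants, which is monotone for all functions. *)
Lemma ge0_le_integral_restrict (D D' : set R) (f f' : R -> \bar R) :
  (forall x, D x -> 0 <= f x) -> (forall x, D' x -> 0 <= f' x) ->
  (forall x, D x -> f x = 0 \/ (D' x /\ f x <= f' x)) ->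
  \int[mu]_(x in D) f x <= \int[mu]_(x in D') f' x.
Proof.
move=> f0 f'0 ff'; rewrite ge0_integralE// [leRHS]ge0_integralE//.
apply: le_ereal_sup => _ [h hf <-]; exists h => // x.
apply: le_trans (hf x) _; rewrite /patch.
have [xD|xD] := boolP (x \in D); last first.
  by case: ifPn => // /set_mem /f'0.
have [->|[D'x ff'x]] := ff' x (set_mem xD); first by case: ifPn => // /set_mem /f'0.
by rewrite mem_set.
Qed.

(** With c the mean of f, integrate 2 c f <= f^2 + c^2. *)
Lemma cauchy_schwarz_itv (f : R -> R) (x y : R) : (x <= y)%R ->
  mu.-integrable setT (EFin \o f) ->
  ((\int[mu]_(s in `[x, y]) f s)%R ^+ 2 / (y - x))%:E
    <= \int[mu]_(s in `]x, y[) (f s ^+ 2)%:E.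
Proof.
rewrite le_eqVlt => /predU1P[<- _|xy fint].
  by rewrite subrr invr0 mulr0 integral_ge0// => ? _; rewrite lee_fin sqr_ge0.
pose D : set R := `]x, y[%classic.
have mD : measurable D by exact: measurable_itv.
have fD : mu.-integrable D (EFin \o f) by exact: integrableS fint.
have mf : measurable_fun D f by apply/measurable_EFinP; case/integrableP: fD.
pose I := (\int[mu]_(s in `[x, y]) f s)%R.
have IE : \int[mu]_(s in D) (f s)%:E = I%:E.
  rewrite /I -Rintegral_itv_obnd_cbnd; last exact: integrableS fint.
  rewrite -Rintegral_itv_bndo_bndc; last exact: integrableS fint.
  by rewrite /Rintegral fineK//; apply: integrable_fin_num.
(* the mean value of f, for which the inequality below is optimal *)
pose c := (I / (y - x))%R.
have yx0 : (0 < y - x)%R by rewrite subr_gt0.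
have muD : mu D = (y - x)%:E by rewrite /D lebesgue_measure_itv/= lte_fin xy.
have key : (2 * c * I)%:E <= \int[mu]_(s in D) (f s ^+ 2)%:E + (c ^+ 2 * (y - x))%:E.
  have -> : (c ^+ 2 * (y - x))%:E = \int[mu]_(s in D) (c ^+ 2)%:E.
    by rewrite integral_cst//= muD -EFinM.
  rewrite -ge0_integralD//; last 3 first.
  - by move=> s _; rewrite lee_fin sqr_ge0.
  - by apply/measurable_EFinP; exact: measurable_funX.
  - by move=> s _; rewrite lee_fin sqr_ge0.
  - have -> : (2 * c * I)%:E = \int[mu]_(s in D) (2 * c * f s)%:E.
      rewrite EFinM -IE -integralZl//.
    rewrite (le_trans (lee_abs _))// (le_trans (le_abse_integral _ _ _))//.
      by apply/measurable_EFinP; exact: measurable_funM.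
    apply: ge0_le_integral => //.
    + by apply/measurable_EFinP; apply: measurableT_comp => //; exact: measurable_funM.
    + by apply/measurable_EFinP; apply: measurable_funD => //; exact: measurable_funX.
    + move=> s _; rewrite abse_EFin -EFinD lee_fin ler_norml; apply/andP; split.
        have := sqr_ge0 (f s + c); lra.
      have := sqr_ge0 (f s - c); lra.
have cE : (c * (y - x) = I)%R by rewrite /c divfK// gt_eqF.
have -> : (I ^+ 2 / (y - x) = 2 * c * I - c ^+ 2 * (y - x))%R.
  by rewrite expr2 -mulrA -/c [(c ^+ 2)%R]expr2 -(mulrA c c) cE; lra.
by rewrite EFinB leeBlDr.
Qed.

End Integrals.

(** * Gain on the boundary and lower bounds for the action of a path *)

Section Gain.
Context {R : realType}.
Local Notation mu := (@lebesgue_measure R).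
Implicit Types (b : R -> R) (s t : R).

Definition regular_boundary b := measurable_fun setT b /\
  forall s t, exists M : R, forall r, s <= r <= t -> `|b r| <= M.

Definition pos_sq b t : R := Num.max (b t) 0 ^+ 2.

(** The signed integral of (b_+)^2 / 2 from 0 to t; for each t one of the two
    integrals ranges over an empty interval or a point. *)
Definition gain b t : R :=
  2^-1 * (\int[mu]_(r in `[0, t]) pos_sq b r - \int[mu]_(r in `[t, 0]) pos_sq b r).

Variable b : R -> R.
Hypothesis bP : regular_boundary b.

Lemma pos_sq_ge0 t : 0 <= pos_sq b t. Proof. exact: sqr_ge0. Qed.

Lemma measurable_pos_sq : measurable_fun setT (pos_sq b).
Proof.
by apply: measurable_funX; apply: measurable_maxr => //; case: bP.
Qed.

Lemma pos_sq_bound s t : exists M : R, 0 <= M /\ forall r, s <= r <= t -> pos_sq b r <= M.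
Proof.
have [M Mb] := bP.2 s t; exists (M ^+ 2); split; first exact: sqr_ge0.
move=> r rst; have bM := Mb r rst; rewrite /pos_sq ler_pXn2r//; last 2 first.
- by rewrite nnegrE le_max lexx orbT.
- by rewrite nnegrE (le_trans _ bM).
by rewrite ge_max (le_trans (ler_norm _) bM) (le_trans (normr_ge0 _) bM).
Qed.

Lemma pos_sq_integrable s t : mu.-integrable `[s, t] (EFin \o pos_sq b).
Proof.
apply: measurable_bounded_integrable => //.
- by rewrite /= lebesgue_measure_itv/=; case: ifP => _; rewrite -?EFinB ltry.
- exact: measurable_funTS measurable_pos_sq.
- have [M [M0 Mb]] := pos_sq_bound s t.
  exists M; split; first exact: num_real.
  move=> x Mx r /=; rewrite in_itv/= => rst.
  by rewrite ger0_norm ?pos_sq_ge0// (le_trans (Mb r rst))// ltW.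
Qed.

Lemma pos_sq_chasles s m t : s <= m -> m <= t ->
  \int[mu]_(r in `[s, t]) pos_sq b r =
  \int[mu]_(r in `[s, m]) pos_sq b r + \int[mu]_(r in `[m, t]) pos_sq b r.
Proof.
move=> sm mt.
have := @Rintegral_itvB R (pos_sq b) (BLeft s) (BRight t) m (pos_sq_integrable s t).
rewrite !bnd_simp => /(_ sm mt) h.
rewrite Rintegral_itv_obnd_cbnd in h.
  by rewrite -h addrC subrK.
by apply: integrableS (pos_sq_integrable m t) => //; apply: subset_itvr; rewrite bnd_simp.
Qed.

Lemma int_pos_sq_trivial s t : t <= s -> \int[mu]_(r in `[s, t]) pos_sq b r = 0.
Proof.
rewrite le_eqVlt => /predU1P[->|ts]; first by rewrite set_itv1 Rintegral_set1.
by rewrite set_itv_ge ?Rintegral_set0// bnd_simp -ltNge.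
Qed.

Lemma gainB s t : s <= t ->
  \int[mu]_(r in `[s, t]) pos_sq b r = 2 * (gain b t - gain b s).
Proof.
move=> st; rewrite /gain -mulrBr mulrA mulfV ?pnatr_eq0// mul1r.
have [s0|/ltW s0] := leP 0 s.
  have t0 := le_trans s0 st.
  rewrite (int_pos_sq_trivial s0) (int_pos_sq_trivial t0) !subr0.
  by rewrite (pos_sq_chasles s0 st); lra.
rewrite (int_pos_sq_trivial s0).
have [t0|/ltW t0] := leP 0 t.
  by rewrite (int_pos_sq_trivial t0) (pos_sq_chasles s0 t0); lra.
by rewrite (int_pos_sq_trivial t0) (pos_sq_chasles st t0); lra.
Qed.

Lemma gain_nd s t : s <= t -> gain b s <= gain b t.
Proof.
move=> st; have := @Rintegral_ge0 _ _ _ mu `[s, t]%classic (pos_sq b) (fun r _ => pos_sq_ge0 r).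
rewrite gainB//; lra.
Qed.

Lemma gain_lipschitz (x y : R) : exists L : R, 0 <= L /\
  forall s t, x <= s -> s <= t -> t <= y -> gain b t - gain b s <= L * (t - s).
Proof.
have [M [M0 Mb]] := pos_sq_bound x y; exists M; split => // s t xs st ty.
have : \int[mu]_(r in `[s, t]) pos_sq b r <= \int[mu]_(r in `[s, t]) M.
  apply: le_Rintegral => //; first exact: pos_sq_integrable.
    apply: measurable_bounded_integrable => //.
      by rewrite /= lebesgue_measure_itv/=; case: ifP => _; rewrite -?EFinB ltry.
    by exists M; split => [|z Mz r _ /=]; rewrite ?num_real// ger0_norm// ltW.
  move=> r /=; rewrite in_itv/= => /andP[sr rt]; apply: Mb.
  by rewrite (le_trans xs sr) (le_trans rt ty).
rewrite gainB// Rintegral_cst//= lebesgue_measure_itv/= lte_fin.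
have := gain_nd st.
move: st; rewrite le_eqVlt => /predU1P[->|st]; first by rewrite ltxx/= subrr mulr0; lra.
rewrite st/=; nra.
Qed.

Lemma gain0 : gain b 0 = 0.
Proof. by rewrite /gain int_pos_sq_trivial// subrr mulr0. Qed.

End Gain.

Section Action.
Context {R : realType}.
Local Notation mu := (@lebesgue_measure R).
Variable b : R -> R.
Hypothesis bP : regular_boundary b.
Variable u0 : R -> R.
Local Notation U := (primitive u0).

Lemma abs_continuous_near t0 t (g : R -> R) e : abs_continuous t0 t g -> 0 < e ->
  exists2 delta, 0 < delta & forall r s, t0 <= r -> r <= s -> s <= t -> s - r < delta ->
    `|g s - g r| < e.
Proof.
move=> ac e0; have [d d0 gd] := ac e e0; exists d => // r s t0r rs st srd.
have := gd 1%N (fun=> r) (fun=> s); rewrite !big_ord1; apply => //.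
by apply/trivIsetP => i j _ _; rewrite (ord1 i) (ord1 j) eqxx.
Qed.

Lemma lipschitz_abs_continuous t0 t (g : R -> R) (K : R) : 0 <= K ->
  (forall r s, t0 <= r -> r <= s -> s <= t -> `|g s - g r| <= K * (s - r)) ->
  abs_continuous t0 t g.
Proof.
move=> K0 gK e e0; exists (e / (K + 1)); first by rewrite divr_gt0// ltr_wpDl.
move=> n l r lr _; rewrite ltr_pdivlMr ?ltr_wpDl// => sd.
apply: (@le_lt_trans _ _ (\sum_(i < n) K * (r i - l i))).
  by apply: ler_sum => i _; apply: gK; case: (lr i).
rewrite -mulr_sumr.
have : 0 <= \sum_(i < n) (r i - l i).
  by apply: sumr_ge0 => i _; rewrite subr_ge0; case: (lr i).
nra.
Qed.

(** On the two intervals where the path is positive its kinetic energy is at least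
    that of a straight line, by Cauchy-Schwarz; the rest is dropped.  A quotient
    by zero is zero, which is the correct value for an empty interval. *)
Lemma kinetic_ge t0 t (g : R -> R) (s1 s2 : R) : t0 < t ->
  abs_continuous t0 t g -> t0 <= s1 -> s1 <= s2 -> s2 <= t ->
  (forall s, t0 <= s < s1 -> 0 < g s) -> (forall s, s2 < s <= t -> 0 < g s) ->
  (((g s1 - g t0) ^+ 2 / (s1 - t0) + (g t - g s2) ^+ 2 / (t - s2))%:E <=
   \int[mu]_(s in `[t0, t]) (derive1 g s ^+ 2 * \1_[set y : R | 0 < y] (g s))%:E)%E.
Proof.
move=> t0t ac ts1 s12 s2t g1 g2.
have [f [fint gE gf]] := abs_continuous_FTC t0t ac.
have [N [mN N0 fN]] := gf.
pose A : set R := `]t0, s1[%classic; pose B : set R := `]s2, t[%classic.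
have mA : measurable A by exact: measurable_itv.
have mB : measurable B by exact: measurable_itv.
have mAB : measurable (A `|` B) by exact: measurableU.
have mf2 : measurable_fun setT (fun s => (f s ^+ 2)%:E).
  apply/measurable_EFinP; apply: measurable_funX.
  by apply/measurable_EFinP; case/integrableP: fint.
have f20 s : (0 <= (f s ^+ 2)%:E)%E by rewrite lee_fin sqr_ge0.
(* off the null set N the derivative of g is the measurable density f *)
apply: (@le_trans _ _ (\int[mu]_(s in (A `|` B) `\` N) (f s ^+ 2)%:E)%E); last first.
  apply: ge0_le_integral_restrict => //.
    by move=> x _; rewrite lee_fin mulr_ge0 ?sqr_ge0.
  move=> x [ABx Nx]; right.
  have [tx gx] : t0 < x < t /\ 0 < g x.
    case: ABx; rewrite /A /B/= in_itv/= => /andP[h1 h2].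
      by rewrite h1 (lt_le_trans h2 (le_trans s12 s2t)) g1// (ltW h1).
    by rewrite (le_lt_trans (le_trans ts1 s12) h1) h2 g2// h1 (ltW h2).
  split; first by rewrite /= in_itv/=; case/andP: tx => /ltW -> /ltW ->.
  have [_ ->] : derivable g x 1 /\ derive1 g x = f x.
    by apply: contrapT => h; apply: Nx; apply: fN => /(_ tx).
  by rewrite indicE mem_set// mulr1.
rewrite -ge0_negligible_integral//; last first.
  exact: measurable_funTS mf2.
rewrite ge0_integral_setU//; last 2 first.
- exact: measurable_funTS mf2.
- rewrite disj_set2E; apply/eqP; rewrite -subset0 => x []; rewrite /A /B/= !in_itv/=.
  move=> /andP[_ h1] /andP[h2 _].
  by have := lt_trans (lt_le_trans h1 s12) h2; rewrite ltxx.
rewrite EFinD; apply: leeD.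
  by rewrite gE ?ts1 ?(le_trans s12)//; exact: cauchy_schwarz_itv.
have -> : g t - g s2 = \int[mu]_(s in `[s2, t]) f s.
  rewrite -(Rintegral_itv_obnd_cbnd (r := s2)); last exact: integrableS fint.
  rewrite -(@Rintegral_itvB R f (BLeft t0) (BRight t) s2) ?bnd_simp ?(le_trans ts1)//.
    rewrite -!gE ?(ltW t0t) ?lexx ?(le_trans ts1)//; lra.
  exact: integrableS fint.
exact: cauchy_schwarz_itv.
Qed.

(** The zeros of the path lie between s1 and s2, so it wins at most the gain
    accumulated there. *)
Lemma action_ge t0 t x (g : R -> R) s1 s2 : t0 < t -> paths t0 t x g ->
  t0 <= s1 -> s1 <= s2 -> s2 <= t ->
  (forall s, t0 <= s < s1 -> 0 < g s) -> (forall s, s2 < s <= t -> 0 < g s) ->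
  ((U (g t0) + (g s1 - g t0) ^+ 2 / (2 * (s1 - t0)) + (g t - g s2) ^+ 2 / (2 * (t - s2))
    - (gain b s2 - gain b s1))%:E <= action b u0 t0 t g)%E.
Proof.
move=> t0t [ac g0 gt] ts1 s12 s2t g1 g2.
have hK := kinetic_ge t0t ac ts1 s12 s2t g1 g2.
have hG : (\int[mu]_(s in `[t0, t]) (Num.max (b s) 0 ^+ 2 * \1_[set 0 : R] (g s))%:E
    <= (2 * (gain b s2 - gain b s1))%:E)%E.
  rewrite -gainB// /Rintegral fineK; last first.
    by apply: integrable_fin_num => //; exact: pos_sq_integrable.
  apply: ge0_le_integral_restrict.
  - by move=> s _; rewrite lee_fin mulr_ge0 ?sqr_ge0.
  - by move=> s _; rewrite lee_fin sqr_ge0.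
  move=> s /=; rewrite in_itv/= => /andP[ts st].
  have [gs0|gs0] := eqVneq (g s) 0; last first.
    by left; rewrite indicE memNset ?mulr0// => /=; apply/eqP.
  right; split; last by rewrite indicE mem_set// mulr1.
  rewrite in_itv/=; apply/andP; split; rewrite leNgt; apply/negP => h.
    by have := g1 s; rewrite gs0 ts h ltxx => /(_ isT).
  by have := g2 s; rewrite gs0 st h ltxx => /(_ isT).
rewrite /action !invfM.
set k1 := _ / (s1 - t0) in hK; set k2 := _ / (t - s2) in hK.
have -> : U (g t0) + (g s1 - g t0) ^+ 2 * (2^-1 / (s1 - t0)) +
    (g t - g s2) ^+ 2 * (2^-1 / (t - s2)) - (gain b s2 - gain b s1) =
    U (g t0) + 2^-1 * (k1 + k2) - 2^-1 * (2 * (gain b s2 - gain b s1)).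
  by rewrite /k1 /k2; lra.
rewrite EFinB EFinD; apply: leeB; first apply: leeD => //.
  by rewrite EFinM; apply: lee_wpmul2l => //; rewrite lee_fin invr_ge0.
by rewrite EFinM; apply: lee_wpmul2l => //; rewrite lee_fin invr_ge0.
Qed.

(** In the second alternative s1 and s2 are the first and the last zero of the
    path. *)
Lemma path_lower_bound t0 t x (g : R -> R) : t0 < t -> paths t0 t x g ->
  ((U (g t0) + (x - g t0) ^+ 2 / (2 * (t - t0)))%:E <= action b u0 t0 t g)%E \/
  exists s1 s2, [/\ t0 <= s1 <= s2, s2 <= t, (s1 = t0 -> g t0 = 0), (s2 = t -> x = 0)
    & ((U (g t0) + g t0 ^+ 2 / (2 * (s1 - t0)) + x ^+ 2 / (2 * (t - s2))
    - (gain b s2 - gain b s1))%:E <= action b u0 t0 t g)%E].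
Proof.
move=> t0t gP; have [ac g0 gt] := gP.
pose Z := [set s | t0 <= s <= t /\ g s = 0].
have [[z0 z0Z]|/forallNP noZ] := pselect (exists z, Z z); last first.
  left; have := @action_ge t0 t x g t t t0t gP (ltW t0t) (lexx _) (lexx _).
  rewrite !subrr expr0n/= mul0r addr0 subr0 gt; apply.
    move=> s /andP[ts /ltW st]; rewrite lt_def g0 ?ts// andbT.
    by apply/eqP => gs0; apply: (noZ s); rewrite /Z/= ts st.
  by move=> s /andP[h1 h2]; have := lt_le_trans h1 h2; rewrite ltxx.
right.
have Z0 : Z !=set0 by exists z0.
have lZ : has_lbound Z by exists t0 => s [/andP[]].
have uZ : has_ubound Z by exists t => s [/andP[]].
have infZ : has_inf Z by split.
have supZ : has_sup Z by split.
pose s1 := inf Z; pose s2 := sup Z.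
have ts1 : t0 <= s1 by apply: lb_le_inf => // s [/andP[]].
have s2t : s2 <= t by apply: ge_sup => // s [/andP[]].
have s1z : s1 <= z0 by exact: ge_inf.
have zs2 : z0 <= s2 by exact: ub_le_sup.
have s12 : s1 <= s2 := le_trans s1z zs2.
(* the zeros of g form a closed set, so the extreme ones are attained *)
have gs1 : g s1 = 0.
  apply/eqP/negPn/negP => gs; have gs0 : 0 < `|g s1| by rewrite normr_gt0.
  have [d d0 gd] := abs_continuous_near ac gs0.
  have [z [/andP[tz zt] gz] zs1] := inf_adherent d0 infZ.
  have s1z' : s1 <= z by apply: ge_inf => //; split; rewrite ?tz.
  have := gd s1 z ts1 s1z' zt; rewrite gz sub0r normrN ltxx => h.
  have /h : z - s1 < d by rewrite -/s1 in zs1; lra.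
  by [].
have gs2 : g s2 = 0.
  apply/eqP/negPn/negP => gs; have gs0 : 0 < `|g s2| by rewrite normr_gt0.
  have [d d0 gd] := abs_continuous_near ac gs0.
  have [z [/andP[tz zt] gz] zs2'] := sup_adherent d0 supZ.
  have s2z' : z <= s2 by apply: ub_le_sup => //; split; rewrite ?tz.
  have := gd z s2 tz s2z' s2t; rewrite gz subr0 ltxx => h.
  have /h : s2 - z < d by rewrite -/s2 in zs2'; lra.
  by [].
exists s1, s2; split => //; first by rewrite ts1.
  by move=> <-.
  by move=> s2E; rewrite -gt -s2E.
have := @action_ge t0 t x g s1 s2 t0t gP ts1 s12 s2t.
rewrite gs1 gs2 gt sub0r sqrrN subr0; apply.
- move=> s /andP[ts ss1]; rewrite lt_def g0 ?andbT; last first.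
    by rewrite ts (le_trans (ltW ss1))// (le_trans s12).
  apply/eqP => gs; have : s1 <= s; last by rewrite leNgt ss1.
  by apply: ge_inf => //; split; rewrite // ts (le_trans (ltW ss1))// (le_trans s12).
- move=> s /andP[ss2 st]; rewrite lt_def g0 ?andbT; last first.
    by rewrite st andbT (le_trans _ (ltW ss2))// (le_trans ts1).
  apply/eqP => gs; have : s <= s2; last by rewrite leNgt ss2.
  by apply: ub_le_sup => //; split; rewrite // st andbT (le_trans _ (ltW ss2))// (le_trans ts1).
Qed.

End Action.

(** * The Hopf-Lax formula *)

Section HopfLax.
Context {R : realType}.
Local Notation mu := (@lebesgue_measure R).
Variable b : R -> R.
Hypothesis bP : regular_boundary b.
Variable u0 : R -> R.
Local Notation U := (primitive u0).

Definition free_cost (t0 t x y : R) : R := U y + (x - y) ^+ 2 / (2 * (t - t0)).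

Definition boundary_cost (t0 t x y s1 s2 : R) : R :=
  U y + y ^+ 2 / (2 * (s1 - t0)) + x ^+ 2 / (2 * (t - s2)) - (gain b s2 - gain b s1).

(** The two implications exclude infinite speed: a path that is at 0 from the
    initial time on has y = 0, and dually at the final time.  They also make the
    convention 1 / 0 = 0 harmless in [boundary_cost]. *)
Definition admissible_times (t0 t x y s1 s2 : R) : Prop :=
  [/\ t0 <= s1 <= s2, s2 <= t, (s1 = t0 -> y = 0) & (s2 = t -> x = 0)].

Definition path_costs (t0 t x : R) : set R :=
  [set c | (exists2 y, 0 <= y & c = free_cost t0 t x y) \/
    exists y s1 s2, [/\ 0 <= y, admissible_times t0 t x y s1 s2
                      & c = boundary_cost t0 t x y s1 s2]].

Lemma path_costs_lower (t0 t x : R) (g : R -> R) : t0 < t -> paths t0 t x g ->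
  exists2 c, path_costs t0 t x c & (c%:E <= action b u0 t0 t g)%E.
Proof.
move=> t0t gP; have [ac g0 gt] := gP.
have gt0 : 0 <= g t0 by rewrite g0// lexx ltW.
have [h|[s1 [s2 [s12 s2t e1 e2 h]]]] := path_lower_bound bP u0 t0t gP.
  by exists (free_cost t0 t x (g t0)) => //; left; exists (g t0).
exists (boundary_cost t0 t x (g t0) s1 s2) => //; right.
by exists (g t0), s1, s2.
Qed.

Lemma derive1_near_affine (g : R -> R) (c k s : R) :
  (\forall r \near s, c * r + k = g r) -> derive1 g s = c.
Proof.
move=> gE.
have d : is_derive s 1 (fun r : R => c * r + k) c.
  have -> : (fun r : R => c * r + k) = (c \*: @id R) + cst k by [].
  have : is_derive s 1 (c \*: @id R + cst k) (c *: 1 + 0) by apply: is_deriveD.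
  by rewrite addr0 [c *: 1]mulr1.
have : is_derive s 1 g c by exact: near_eq_is_derive d.
by move=> dg; rewrite derive1E; case: dg.
Qed.

(** The straight line from (t0, y) to (t, x); its possible gain at 0 only lowers
    the action. *)
Lemma free_cost_path (t0 t x y : R) : t0 < t -> 0 <= x -> 0 <= y ->
  exists2 g, paths t0 t x g & (action b u0 t0 t g <= (free_cost t0 t x y)%:E)%E.
Proof.
move=> t0t x0 y0; have tt0 : 0 < t - t0 by rewrite subr_gt0.
pose c := (x - y) / (t - t0); have ct : c * (t - t0) = x - y by rewrite /c divfK// gt_eqF.
pose g r := c * r + (y - c * t0).
have gt0 : g t0 = y by rewrite /g; lra.
have gt : g t = x by rewrite /g; lra.
exists g.
  split => //.
    apply: (@lipschitz_abs_continuous _ _ _ _ `|c|) => // r s _ rs _.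
    have -> : g s - g r = c * (s - r) by rewrite /g; lra.
    by rewrite normrM (@ger0_norm _ (s - r)) ?subr_ge0.
  move=> s /andP[ts st]; rewrite -(pmulr_rge0 _ tt0).
  have -> : (t - t0) * g s = y * (t - s) + x * (s - t0) by rewrite /g; nra.
  by rewrite addr_ge0// mulr_ge0// subr_ge0.
rewrite /action gt0 /free_cost.
have K : (\int[mu]_(s in `[t0, t]) (derive1 g s ^+ 2 * \1_[set y : R | 0 < y] (g s))%:E
    <= (c ^+ 2 * (t - t0))%:E)%E.
  apply: (@le_trans _ _ (\int[mu]_(s in `[t0, t]) (c ^+ 2)%:E)%E); last first.
    by rewrite integral_cst//= lebesgue_measure_itv/= lte_fin t0t -EFinB -EFinM.
  apply: ge0_le_integral_restrict => s st.
  - by rewrite lee_fin mulr_ge0 ?sqr_ge0.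
  - by rewrite lee_fin sqr_ge0.
  have -> : derive1 g s = c.
    by apply: (@derive1_near_affine _ _ (y - c * t0)); near=> r.
  right; split => //.
  by rewrite lee_fin ler_piMr ?sqr_ge0// indicE lern1 leq_b1.
have -> : U y + (x - y) ^+ 2 / (2 * (t - t0)) = U y + 2^-1 * (c ^+ 2 * (t - t0)) - 0.
  rewrite subr0; congr (_ + _); rewrite invfM expr2 [c ^+ 2]expr2 -(mulrA c c) ct /c; lra.
rewrite EFinB; apply: leeB; last first.
  apply: mule_ge0; first by rewrite lee_fin invr_ge0.
  by apply: integral_ge0 => s _; rewrite lee_fin mulr_ge0 ?sqr_ge0.
rewrite EFinD; apply: leeD => //; rewrite EFinM; apply: lee_wpmul2l => //; rewrite lee_fin invr_ge0.
Unshelve. all: by end_near. Qed.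

(** The path goes straight from (t0, y) to (s1, 0), rests at 0 until s2 and goes
    straight to (t, x). *)
Lemma boundary_cost_path (t0 t x y s1 s2 : R) : t0 < t -> 0 <= x -> 0 <= y ->
  admissible_times t0 t x y s1 s2 ->
  exists2 g, paths t0 t x g & (action b u0 t0 t g <= (boundary_cost t0 t x y s1 s2)%:E)%E.
Proof.
move=> t0t x0 y0 [/andP[ts1 s12] s2t e1 e2].
pose c1 := y / (s1 - t0); pose c2 := x / (t - s2).
have c10 : 0 <= c1 by rewrite divr_ge0// subr_ge0.
have c20 : 0 <= c2 by rewrite divr_ge0// subr_ge0.
have c1E : c1 * (s1 - t0) = y.
  have [h|h] := eqVneq s1 t0; first by rewrite h subrr mulr0 e1.
  by rewrite /c1 divfK// subr_eq0.
have c2E : c2 * (t - s2) = x.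
  have [h|h] := eqVneq s2 t; first by rewrite h subrr mulr0 e2.
  by rewrite /c2 divfK// subr_eq0 eq_sym.
pose g r := if r <= s1 then c1 * (s1 - r) else if s2 <= r then c2 * (r - s2) else 0.
have g1 r : r <= s1 -> g r = c1 * (s1 - r) by rewrite /g => ->.
have g2 r : s2 <= r -> g r = c2 * (r - s2).
  rewrite /g => h; rewrite h; case: ifPn => // h1.
  have -> : r = s1 by lra.
  have -> : s2 = s1 by lra.
  by rewrite !subrr !mulr0.
have g12 r : s1 <= r -> r <= s2 -> g r = 0.
  rewrite /g => h1 h2; case: ifPn => h3; first by have -> : r = s1; [lra|rewrite subrr mulr0].
  by case: ifPn => // h4; have -> : r = s2; [lra|rewrite subrr mulr0].
have gt0 : g t0 = y by rewrite g1.
have gt : g t = x by rewrite g2.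
have g_ge0 r : 0 <= g r.
  rewrite /g; case: ifPn => [|_]; first by move=> h; rewrite mulr_ge0// subr_ge0.
  by case: ifPn => // h; rewrite mulr_ge0// subr_ge0.
exists g.
  split => //.
  apply: (@lipschitz_abs_continuous _ _ _ _ (c1 + c2)); first exact: addr_ge0.
  move=> r s _ rs _; rewrite ler_norml.
  have [rs1|s1r] := leP r s1.
    rewrite (g1 r)//; have [ss1|s1s] := leP s s1.
      by rewrite g1//; apply/andP; split; nra.
    have [ss2|s2s] := leP s s2.
      by rewrite (g12 _ (ltW s1s) ss2); apply/andP; split; nra.
    by rewrite (g2 _ (ltW s2s)); apply/andP; split; nra.
  have [ss2|s2s] := leP s s2.
    rewrite (g12 _ (ltW s1r) (le_trans rs ss2)).
    rewrite (g12 _ (ltW (lt_le_trans s1r rs)) ss2).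
    by apply/andP; split; nra.
  rewrite (g2 s (ltW s2s)); have [rs2|s2r] := leP r s2.
    by rewrite (g12 _ (ltW s1r) rs2); apply/andP; split; nra.
  by rewrite (g2 _ (ltW s2r)); apply/andP; split; nra.
have K : (\int[mu]_(s in `[t0, t]) (derive1 g s ^+ 2 * \1_[set y : R | 0 < y] (g s))%:E
    <= (c1 ^+ 2 * (s1 - t0) + c2 ^+ 2 * (t - s2))%:E)%E.
  (* naming the squares keeps the terms small for the arithmetic below *)
  have [a1 [a10 a1E]] : exists a1 : R, 0 <= a1 /\ c1 ^+ 2 = a1 by exists (c1 ^+ 2); rewrite sqr_ge0.
  have [a2 [a20 a2E]] : exists a2 : R, 0 <= a2 /\ c2 ^+ 2 = a2 by exists (c2 ^+ 2); rewrite sqr_ge0.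
  rewrite a1E a2E.
  pose h s : R := a1 * \1_(`[t0, s1]%classic : set R) s
                + a2 * \1_(`[s2, t]%classic : set R) s.
  apply: (@le_trans _ _ (\int[mu]_(s in `[t0, t]) (h s)%:E)%E); last first.
    have lenE p r : p <= r -> mu (`[p, r]%classic : set R) = (r - p)%:E.
      rewrite le_eqVlt => /predU1P[->|pr]; rewrite lebesgue_measure_itv/= lte_fin.
        by rewrite ltxx subrr.
      by rewrite pr.
    have pos (k : R) (D : set R) s : 0 <= k -> (0 <= k%:E * (\1_D s)%:E)%E.
      by move=> k0; rewrite -EFinM lee_fin mulr_ge0.
    have mea (D : set R) : measurable D ->
        measurable_fun (`[t0, t]%classic : set R) (fun s => (\1_D s : R)%:E).
      by move=> mD; apply/measurable_EFinP; exact: measurable_indic.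
    have int_le (k p r : R) : 0 <= k -> p <= r ->
        (\int[mu]_(s in `[t0, t]) (k%:E * (\1_(`[p, r]%classic : set R) s)%:E)
          <= (k * (r - p))%:E)%E.
      move=> k0 pr; rewrite ge0_integralZl//; try exact: mea.
      rewrite integral_indic// EFinM; apply: lee_wpmul2l => //.
      by rewrite -lenE//; apply: le_measure; rewrite ?inE//; apply: measurableI.
    rewrite /h; under eq_integral do rewrite EFinD 2!EFinM.
    rewrite ge0_integralD//; try (by move=> s _; exact: pos);
      try (by apply: emeasurable_funM => //; exact: mea).
    by rewrite EFinD; apply: leeD; exact: int_le.
  have in1 (D : set R) s : D s -> \1_D s = 1 :> R by move=> Ds; rewrite indicE mem_set.
  apply: ge0_le_integral_restrict => s st.
  - by rewrite lee_fin mulr_ge0 ?sqr_ge0.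
  - by rewrite lee_fin addr_ge0// mulr_ge0.
  have [gs|gs] := eqVneq (g s) 0.
    by left; rewrite gs indicE memNset ?mulr0//= ltxx.
  right; split => //; rewrite lee_fin.
  move: st; rewrite /= in_itv/= => /andP[ts st].
  have ind1 : (\1_[set y : R | 0 < y] (g s) : R) <= 1 by rewrite indicE lern1 leq_b1.
  have [ss1|s1s] := ltP s s1.
    have -> : derive1 g s = - c1.
      apply: (@derive1_near_affine _ _ (c1 * s1)); near=> r; rewrite g1; first by lra.
      by apply/ltW; near: r; exact: lt_nbhsl.
    rewrite sqrrN a1E /h (in1 `[t0, s1]%classic) ?mulr1; last by rewrite /= in_itv/= ts ltW.
    by rewrite -[leLHS]addr0 lerD ?ler_piMr// mulr_ge0.
  have [ss2|s2s] := leP s s2; first by rewrite g12 ?eqxx in gs.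
  have -> : derive1 g s = c2.
    apply: (@derive1_near_affine _ _ (- (c2 * s2))); near=> r; rewrite g2; first by lra.
    by apply/ltW; near: r; exact: lt_nbhsr.
  rewrite a2E /h (in1 `[s2, t]%classic) ?mulr1; last by rewrite /= in_itv/= st ltW.
  by rewrite -[leLHS]add0r lerD ?ler_piMr// mulr_ge0.
have G : ((2 * (gain b s2 - gain b s1))%:E <=
    \int[mu]_(s in `[t0, t]) (Num.max (b s) 0 ^+ 2 * \1_[set 0 : R] (g s))%:E)%E.
  rewrite -gainB// /Rintegral fineK; last first.
    by apply: integrable_fin_num => //; exact: pos_sq_integrable.
  apply: ge0_le_integral_restrict => s.
  - by move=> _; rewrite lee_fin sqr_ge0.
  - by move=> _; rewrite lee_fin mulr_ge0 ?sqr_ge0.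
  rewrite /= in_itv/= => /andP[h1 h2]; right; split.
    by rewrite in_itv/= (le_trans ts1)//= (le_trans h2).
  by rewrite g12// indicE mem_set// mulr1.
rewrite /action gt0 /boundary_cost.
have -> : U y + y ^+ 2 / (2 * (s1 - t0)) + x ^+ 2 / (2 * (t - s2)) - (gain b s2 - gain b s1)
    = U y + 2^-1 * (c1 ^+ 2 * (s1 - t0) + c2 ^+ 2 * (t - s2))
      - 2^-1 * (2 * (gain b s2 - gain b s1)).
  have -> : y ^+ 2 / (2 * (s1 - t0)) = 2^-1 * (c1 * y).
    by rewrite invfM /c1; move: (s1 - t0)^-1 => i; lra.
  have -> : x ^+ 2 / (2 * (t - s2)) = 2^-1 * (c2 * x).
    by rewrite invfM /c2; move: (t - s2)^-1 => i; lra.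
  have -> : c1 ^+ 2 * (s1 - t0) = c1 * y by rewrite expr2 -mulrA c1E.
  have -> : c2 ^+ 2 * (t - s2) = c2 * x by rewrite expr2 -mulrA c2E.
  by lra.
rewrite EFinB; apply: leeB; last first.
  by rewrite EFinM; apply: lee_wpmul2l => //; rewrite lee_fin invr_ge0.
rewrite EFinD; apply: leeD => //; rewrite EFinM; apply: lee_wpmul2l => //; rewrite lee_fin invr_ge0.
Unshelve. all: by end_near. Qed.

(** The Hopf-Lax formula, as a criterion: the value is the infimum of the explicit
    costs. *)
Theorem value_eq (t0 t x v : R) : t0 < t -> 0 <= x ->
  (forall c, path_costs t0 t x c -> v <= c) ->
  (forall e, 0 < e -> exists2 c, path_costs t0 t x c & c <= v + e) ->
  value b u0 t0 t x = v.
Proof.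
move=> t0t x0 vlow vup; rewrite /value.
suff -> : ereal_inf [set action b u0 t0 t g | g in paths t0 t x] = v%:E by [].
apply/eqP; rewrite eq_le; apply/andP; split.
  apply/lee_addgt0Pr => e e0; have [c cP cv] := vup e e0.
  have [g gP gc] : exists2 g, paths t0 t x g & (action b u0 t0 t g <= c%:E)%E.
    case: cP => [[y y0 ->]|[y [s1 [s2 [y0 adm ->]]]]]; first exact: free_cost_path.
    exact: boundary_cost_path.
  apply: (@le_trans _ _ (action b u0 t0 t g)); first by apply: ereal_inf_lbound; exists g.
  by apply: (le_trans gc); rewrite lee_fin.
apply: le_ereal_inf_tmp => _ [g gP <-].
have [c cP cg] := path_costs_lower t0t gP.
by apply: le_trans cg; rewrite lee_fin vlow.
Qed.

End HopfLax.

(** * The stationary potential *)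

Section StationaryPotential.
Context {R : realType}.
Local Notation mu := (@lebesgue_measure R).
Variable b : R -> R.
Hypothesis bP : regular_boundary b.

(** The cost of reaching (t, x) after having left the boundary at time s; the gain
    from time s to time t is the one renounced by leaving. *)
Definition past_cost (t x s : R) : R := gain b t - gain b s + x ^+ 2 / (2 * (t - s)).

Definition potential (t x : R) : R := inf [set past_cost t x s | s in `]-oo, t[].

Lemma past_cost_ge0 t x s : s < t -> 0 <= past_cost t x s.
Proof.
move=> st; rewrite /past_cost addr_ge0 ?subr_ge0 ?gain_nd ?(ltW st)//.
by rewrite divr_ge0 ?sqr_ge0// mulr_ge0// subr_ge0 ltW.
Qed.

Lemma potential_has_inf t x : has_inf [set past_cost t x s | s in `]-oo, t[].
Proof.
split; first by exists (past_cost t x (t - 1)); exists (t - 1) => //=; rewrite ?in_itv/=; lra.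
by exists 0 => _ [s + <-] /=; rewrite ?in_itv/= => st; exact: past_cost_ge0.
Qed.

Lemma potential_le t x s : s < t -> potential t x <= past_cost t x s.
Proof.
move=> st; apply: ge_inf; first by case: (potential_has_inf t x).
by exists s => //=; rewrite ?in_itv.
Qed.

Lemma le_potential t x c : (forall s, s < t -> c <= past_cost t x s) -> c <= potential t x.
Proof.
move=> h; apply: lb_le_inf; first by case: (potential_has_inf t x).
by move=> _ [s + <-] /=; rewrite ?in_itv/=; exact: h.
Qed.

Lemma potential_adherent t x e : 0 < e -> exists2 s, s < t & past_cost t x s <= potential t x + e.
Proof.
move=> e0; have [_ [s + <-] h] := inf_adherent e0 (potential_has_inf t x).
by rewrite /= ?in_itv/= => st; exists s => //; exact: ltW.
Qed.

Lemma potential_ge0 t x : 0 <= potential t x.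
Proof. by apply: le_potential => s; exact: past_cost_ge0. Qed.

Lemma potential_nd t x y : 0 <= x -> x <= y -> potential t x <= potential t y.
Proof.
move=> x0 xy; apply: le_potential => s st; apply: le_trans (potential_le x st) _.
rewrite /past_cost lerD2l ler_wpM2r ?invr_ge0 ?mulr_ge0// ?subr_ge0 ?(ltW st)//.
by rewrite ler_pXn2r// nnegrE (le_trans x0).
Qed.

(** Leaving the boundary at time t - x, that is with speed 1, costs O(x). *)
Lemma potential_near0 t : exists L : R, 0 <= L /\
  forall x, 0 < x <= 1 -> potential t x <= L * x.
Proof.
have [L [L0 lip]] := gain_lipschitz bP (t - 1) t; exists (L + 2^-1); split; first lra.
move=> x /andP[x0 x1]; have tx : t - x < t by lra.
apply: (le_trans (potential_le x tx)); rewrite /past_cost.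
have -> : x ^+ 2 / (2 * (t - (t - x))) = 2^-1 * x.
  have -> : t - (t - x) = x by lra.
  rewrite invfM mulrCA expr2; congr (_ * _).
  by rewrite -mulrA mulfV ?gt_eqF// mulr1.
have := lip (t - x) t; lra.
Qed.

(** Leaving at the last moment costs nothing; with [potential_near0] this is
    the continuity of the potential at the boundary. *)
Lemma potential0 t : potential t 0 = 0.
Proof.
apply/eqP; rewrite eq_le potential_ge0 andbT; apply/ler_addgt0Pr => e e0; rewrite add0r.
have [L [L0 LP]] := potential_near0 t.
pose x := Num.min 1 (e / (L + 1)).
have x0 : 0 < x by rewrite lt_min ltr01 divr_gt0// ltr_wpDl.
have x1 : x <= 1 by rewrite ge_min lexx.
have := LP x; rewrite x0 x1 => /(_ isT) h.
apply: (le_trans (potential_nd t (lexx 0) (ltW x0))); apply: (le_trans h).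
have : x <= e / (L + 1) by rewrite ge_min lexx orbT.
rewrite ler_pdivlMr ?ltr_wpDl//; nra.
Qed.

(** Convexity of (x, p) |-> x^2 / p: among the paths joining two points, the
    straight one is cheapest. *)
Lemma sqr_div_sum (x y p r : R) : 0 < p -> 0 < r ->
  (x + y) ^+ 2 / (2 * (p + r)) <= x ^+ 2 / (2 * p) + y ^+ 2 / (2 * r).
Proof.
move=> p0 r0.
have pr0 : 0 < p + r by exact: addr_gt0.
rewrite ler_pdivrMr ?mulr_gt0// !invfM.
have pi : p * p^-1 = 1 by rewrite mulfV// gt_eqF.
have ri : r * r^-1 = 1 by rewrite mulfV// gt_eqF.
have [pi0 ri0] : 0 < p^-1 /\ 0 < r^-1 by rewrite !invr_gt0.
move: (p^-1) (r^-1) pi ri pi0 ri0 => P Q pP rQ P0 Q0.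
have h : 0 <= P * Q * (x * r - y * p) ^+ 2 by rewrite mulr_ge0 ?sqr_ge0// mulr_ge0// ltW.
have e1 : P * Q * (x * r - y * p) ^+ 2
  = x ^+ 2 * P * r * (r * Q) - 2 * x * y * (p * P) * (r * Q) + y ^+ 2 * Q * p * (p * P) by lra.
have e2 : (x ^+ 2 * (2^-1 * P) + y ^+ 2 * (2^-1 * Q)) * (2 * (p + r))
  = x ^+ 2 * (p * P) + x ^+ 2 * P * r + y ^+ 2 * Q * p + y ^+ 2 * (r * Q) by lra.
rewrite e2 pP rQ; rewrite e1 pP rQ in h; lra.
Qed.

(** A cost from time t0 composed with a cost of the past is at least the cost
    of the direct path, by [sqr_div_sum].  Conversely a straight line that left
    the boundary at time s is cut where it crosses time t0, or, if t0 <= s, is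
    prolonged by resting at 0 from t0 to s.  The gain is counted from t0 on the
    left and through the whole past on the right, whence the constant. *)
Theorem value_potential (u0 : R -> R) t0 t x : t0 < t -> 0 <= x ->
  (forall y, 0 <= y -> primitive u0 y = potential t0 y) ->
  value b u0 t0 t x = potential t x - (gain b t - gain b t0).
Proof.
move=> t0t x0 UE; apply: (value_eq bP) => //.
- move=> c [[y y0 ->]|[y [s1 [s2 [y0 [/andP[ts1 s12] s2t e1 e2] ->]]]]].
    rewrite /free_cost UE//; set d := _ / _.
    suff : potential t x - (gain b t - gain b t0) - d <= potential t0 y by lra.
    apply: le_potential => s st0; have st := lt_trans st0 t0t.
    have := potential_le x st; rewrite /past_cost.
    have := @sqr_div_sum y (x - y) (t0 - s) (t - t0).
    rewrite !subr_gt0 => /(_ st0 t0t).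
    have -> : y + (x - y) = x by lra.
    have -> : t0 - s + (t - t0) = t - s by lra.
    rewrite /d; lra.
  rewrite /boundary_cost UE//; have py := potential_ge0 t0 y.
  have y2 : 0 <= y ^+ 2 / (2 * (s1 - t0)).
    by rewrite divr_ge0 ?sqr_ge0// mulr_ge0// subr_ge0.
  have g1 := gain_nd bP ts1.
  have [s2lt|s2ge] := ltP s2 t.
    have := potential_le x s2lt; rewrite /past_cost; lra.
  have s2E : s2 = t by apply/eqP; rewrite eq_le s2t.
  by rewrite s2E (e2 s2E) potential0 expr0n/= mul0r; lra.
- move=> e e0; have [s st h] := potential_adherent t x e0.
  have [ts|st0] := leP t0 s.
    exists (boundary_cost b u0 t0 t x 0 t0 s).
      right; exists 0, t0, s; split => //; split=> //; first by rewrite lexx ts.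
        exact: ltW.
      by move=> sE; rewrite sE ltxx in st.
    rewrite /boundary_cost UE// potential0 expr0n/= mul0r.
    move: h; rewrite /past_cost; lra.
  (* the position at time t0 of the line from (s, 0) to (t, x) *)
  pose y := x * (t0 - s) / (t - s).
  have ts0 : 0 < t - s by rewrite subr_gt0.
  have y0 : 0 <= y by rewrite divr_ge0 ?(ltW ts0)// mulr_ge0// subr_ge0 ltW.
  exists (free_cost u0 t0 t x y); first by left; exists y.
  rewrite /free_cost UE//; have := potential_le y st0; move: h; rewrite /past_cost.
  suff : y ^+ 2 / (2 * (t0 - s)) + (x - y) ^+ 2 / (2 * (t - t0)) = x ^+ 2 / (2 * (t - s)) by lra.
  have a0 : t0 - s != 0 by rewrite subr_eq0 gt_eqF.
  have c0 : t - t0 != 0 by rewrite subr_eq0 gt_eqF.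
  (* both pieces of the line have the speed v *)
  pose v := x / (t - s); have vE : v * (t - s) = x by rewrite divfK// gt_eqF.
  have yE : y = v * (t0 - s) by rewrite /y /v mulrAC.
  have xyE : x - y = v * (t - t0) by rewrite yE -vE; lra.
  have aux z : z != 0 -> (v * z) ^+ 2 / (2 * z) = 2^-1 * v ^+ 2 * z.
    move=> z0; have := mulfV z0; rewrite invfM; move: (z^-1) => Z zZ.
    have -> : (v * z) ^+ 2 * (2^-1 * Z) = 2^-1 * v ^+ 2 * z * (z * Z) by lra.
    by rewrite zZ mulr1.
  by rewrite xyE yE -[in RHS]vE !aux ?gt_eqF//; lra.
Qed.

End StationaryPotential.

(** * Locality of the right-continuous derivative *)

Section RcDerivative.
Context {R : realType}.
Implicit Types (V W : R -> R).

Lemma near_derive_shift V W c (x : R) : (\forall y \near x, V y = W y + c) ->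
  (derivable V x 1 <-> derivable W x 1) /\ (derivable V x 1 -> derive1 V x = derive1 W x).
Proof.
move=> VW.
have VW' : \forall y \near x, (W + cst c) y = V y.
  by apply: filterS VW => y ->.
have WV' : \forall y \near x, (V + cst (- c)) y = W y.
  by apply: filterS VW => y; rewrite /= => /= h; rewrite /GRing.add/= h addrK.
have shift (f g : R -> R) (k : R) : (\forall y \near x, (f + cst k) y = g y) ->
    derivable f x 1 -> is_derive x 1 g (derive1 f x).
  move=> fg df; have d1 : is_derive x 1 f ('D_1 f x) by exact/derivableP.
  have : is_derive x 1 (f + cst k) ('D_1 f x + 0) by apply: is_deriveD.
  by rewrite addr0 derive1E; exact: near_eq_is_derive.
split; first split.
- by move=> /(shift _ _ _ WV')[].
- by move=> /(shift _ _ _ VW')[].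
- by move=> /(shift _ _ _ WV')[_]; rewrite -[in X in X -> _]derive1E.
Qed.

(** The right-continuous derivative at x depends only on the germ of the
    function at x, up to a constant. *)
Lemma rc_derivative_shift V W c (x : R) : (\forall y \near x, V y = W y + c) ->
  rc_derivative V x = rc_derivative W x.
Proof.
move=> VW; have [dVW dE] := near_derive_shift VW.
rewrite /rc_derivative.
have -> : `[< derivable V x 1 >] = `[< derivable W x 1 >] by apply/asbool_equiv_eq.
case: asboolP => [dW|_]; first by apply: dE; apply/dVW.
have nVW : \forall y \near x, (derivable V y 1 <-> derivable W y 1) /\
    (derivable V y 1 -> derive1 V y = derive1 W y).
  by move/nbhs_interior: VW; apply: filterS => y /near_derive_shift.
have sub (f g : R -> R) : (\forall y \near x, (derivable f y 1 <-> derivable g y 1) /\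
    (derivable f y 1 -> derive1 f y = derive1 g y)) ->
    (derive1 f y @[y --> within [set y | derivable f y 1] x^'+]) `<=`
    (derive1 g y @[y --> within [set y | derivable g y 1] x^'+]).
  move=> fg A Af.
  change (\forall y \near x, x < y -> derivable g y 1 -> A (derive1 g y)).
  have {}Af : \forall y \near x, x < y -> derivable f y 1 -> A (derive1 f y) by exact: Af.
  near=> y => xy dg.
  have [dfg efg] : (derivable f y 1 <-> derivable g y 1) /\
    (derivable f y 1 -> derive1 f y = derive1 g y) by near: y.
  have df : derivable f y 1 by apply/dfg.
  by rewrite -efg//; move: xy df; near: y.
have e : (derive1 V y @[y --> within [set y | derivable V y 1] x^'+]) =
    (derive1 W y @[y --> within [set y | derivable W y 1] x^'+]).
  apply/seteqP; split; first exact: sub nVW.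
  apply: sub.
  apply: filterS nVW => y [h1 h2]; split; first by apply: iff_sym.
  by move=> dg; apply/esym/h2/h1.
by rewrite e.
Unshelve. all: by end_near. Qed.

Lemma rc_derivative_derivable V (x : R) : derivable V x 1 -> rc_derivative V x = derive1 V x.
Proof. by rewrite /rc_derivative; case: asboolP. Qed.

End RcDerivative.

(** * Attraction by the boundary *)

Section Attraction.
Context {R : realType}.
Variable b : R -> R.
Hypothesis bP : regular_boundary b.

(** The minimum over y of y^2 / (2 p) - a y is - a^2 p / 2: the best that a path
    of duration p can extract from an initial slope - a. *)
Lemma half_square_ge (a y p : R) : 0 < p -> - (a ^+ 2 * p / 2) <= y ^+ 2 / (2 * p) - a * y.
Proof.
move=> p0; have := mulfV (lt0r_neq0 p0); rewrite invfM.
have : 0 < p^-1 by rewrite invr_gt0.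
move: (p^-1) => P P0 pP; have := mulr_ge0 (ltW P0) (sqr_ge0 (y - a * p)).
have -> : P * (y - a * p) ^+ 2 = P * y ^+ 2 - 2 * a * y * (p * P) + a ^+ 2 * p * (p * P) by lra.
rewrite pP; lra.
Qed.

(** The equivalence of gain s and q^2 s / 2 as s tends to -oo, in the affine form
    that is convenient for estimates valid at all negative times. *)
Definition mean_gain (q : R) := forall delta : R, 0 < delta ->
  exists K : R, 0 <= K /\ forall s, s <= 0 -> `|gain b s - q ^+ 2 / 2 * s| <= delta * - s + K.

(** The implication from s1 = t0 to y = 0 covers the paths that start on the
    boundary, for which the quotient is 0 / 0. *)
Lemma initial_cost_ge (u0 : R -> R) (a C t0 y s1 : R) : 0 <= C ->
  (forall z, 0 <= z -> - a * z - C <= primitive u0 z) ->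
  0 <= y -> t0 <= s1 -> (s1 = t0 -> y = 0) ->
  - (a ^+ 2 * (s1 - t0) / 2) - C <= primitive u0 y + y ^+ 2 / (2 * (s1 - t0)).
Proof.
move=> C0 UC y0; rewrite le_eqVlt => /predU1P[<- /(_ erefl) ->|ts1 _].
  by rewrite subrr expr0n/= !mulr0 !mul0r; have := UC 0 (lexx _); lra.
have := UC y y0; have := @half_square_ge a y (s1 - t0).
rewrite subr_gt0 => /(_ ts1); lra.
Qed.

(** The constant m is the infimum of the part of the cost that precedes the first
    zero, gain included.  A path that avoids the boundary loses, because its cost
    is above - a^2 |t0| / 2 up to a constant while resting at 0 brings about
    - q^2 |t0| / 2.  For the converse, near-optimal first zeros s1 stay within
    |t0| / 2 + D of t0 and near-optimal departure times s for W_0(x) stay within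
    S of 0, uniformly for x in [0, r]; hence s1 <= s once |t0| is large and the
    two parts fit together into one path. *)
Theorem attraction (q a C r : R) : mean_gain q -> 0 <= a -> a < q -> 0 <= C -> 0 <= r ->
  exists T : R, 0 < T /\ forall t0 u0, t0 < - T ->
    (forall y, 0 <= y -> - a * y - C <= primitive u0 y) ->
    exists m, forall x, 0 <= x <= r -> value b u0 t0 0 x = potential b 0 x + m.
Proof.
move=> mg a0 aq C0 r0; have q0 : 0 < q by exact: le_lt_trans aq.
(* the advantage per unit of time of the boundary over the initial slope *)
pose eta := (q ^+ 2 - a ^+ 2) / 2.
have eta0 : 0 < eta by rewrite /eta; nra.
have etaq : eta <= q ^+ 2 / 2 by rewrite /eta; nra.
have d0 : 0 < eta / 4 by lra.
have [K [K0 gK]] := mg _ d0.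
have g0 : gain b 0 = 0 by exact: gain0.
have gl s : s <= 0 -> gain b s <= (q ^+ 2 / 2 - eta / 4) * s + K.
  by move=> /gK; rewrite ler_norml => /andP[_]; lra.
have gu s : s <= 0 -> (q ^+ 2 / 2 + eta / 4) * s - K <= gain b s.
  by move=> /gK; rewrite ler_norml => /andP[+ _]; lra.
(* leaving the boundary at time -1 bounds the potential on [0, r] *)
pose Kr := - gain b (-1) + r ^+ 2 / 2.
have Kr0 : 0 <= Kr.
  have := @gain_nd R b bP (-1) 0; rewrite g0 /Kr; have := sqr_ge0 r; lra.
have WKr x : 0 <= x <= r -> potential b 0 x <= Kr.
  move=> /andP[x0 xr]; have m10 : -1 < 0 :> R by lra.
  apply: (le_trans (potential_le bP x m10)); rewrite /past_cost g0 /Kr.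
  have -> : 2 * (0 - -1) = 2 :> R by lra.
  have : x ^+ 2 <= r ^+ 2 by rewrite ler_pXn2r// nnegrE.
  lra.
(* S bounds the duration since the last zero, D the excess over |t0| / 2 of the
   duration until the first zero, and beyond N avoiding the boundary loses *)
pose S := (Kr + 1 + K) / (eta / 4).
have S0 : 0 <= S by apply: divr_ge0; lra.
pose D := (2 * K + C + 1) / eta.
have D0 : 0 <= D by apply: divr_ge0; lra.
pose N := (a * r + C + K + Kr) / (eta / 2).
have N0 : 0 <= N by have := mulr_ge0 a0 r0 => ar0; apply: divr_ge0; lra.
exists (2 * (S + D) + N + 1); split; first lra.
move=> t0 u0 t0T UC.
have t00 : t0 < 0 by lra.
(* the costs of all ways to reach the boundary for the first time *)
pose E := [set e | exists y s1, [/\ 0 <= y, t0 <= s1 <= 0, (s1 = t0 -> y = 0) &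
   e = primitive u0 y + y ^+ 2 / (2 * (s1 - t0)) + gain b s1]].
have Ege e : E e -> exists s1, [/\ t0 <= s1, s1 <= 0 &
    - (a ^+ 2 * (s1 - t0) / 2) - C + gain b s1 <= e].
  move=> [y [s1 [y0 /andP[ts1 s10] e1 ->]]]; exists s1; split => //.
  by rewrite lerD2r; exact: initial_cost_ge.
have Et0 : E (gain b t0).
  exists 0, t0; split => //; first by rewrite lexx ltW.
  by rewrite /primitive set_itv1 Rintegral_set1 expr0n/= mul0r !add0r.
have infE : has_inf E.
  split; first by exists (gain b t0).
  exists (- (a ^+ 2 * (- t0) / 2) - C + gain b t0) => e /Ege[s1 [ts1 s10 he]].
  have := gain_nd bP ts1; have := sqr_ge0 a; nra.
pose m := inf E.
have mt0 : m <= gain b t0 by apply: ge_inf => //; case: infE.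
exists m => x x_r; have /andP[x0 xr] := x_r.
have Wx := WKr x x_r.
apply: (value_eq bP) => //.
- move=> c [[y y0 ->]|[y [s1 [s2 [y0 [/andP[ts1 s12] s2t e1 e2] ->]]]]].
    rewrite /free_cost sub0r.
    have := UC y y0; have mt00 : 0 < - t0 by lra.
    have := half_square_ge a (y - x) mt00.
    have -> : (y - x) ^+ 2 = (x - y) ^+ 2 by rewrite -sqrrN opprB.
    have := gl t0 (ltW t00).
    have h : N < - t0 by lra.
    have : a * r + C + K + Kr < - t0 * (eta / 2) by rewrite -ltr_pdivrMr// divr_gt0.
    have : a * x <= a * r by rewrite ler_wpM2l.
    rewrite /eta; nra.
  have mE : m <= primitive u0 y + y ^+ 2 / (2 * (s1 - t0)) + gain b s1.
    apply: ge_inf; first by case: infE.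
    by exists y, s1; split => //; rewrite ts1 (le_trans s12).
  rewrite /boundary_cost; have [s20|s20] := ltP s2 0.
    have := potential_le bP x s20; rewrite /past_cost g0; lra.
  have s2E : s2 = 0 by apply/eqP; rewrite eq_le s2t.
  by rewrite s2E (e2 s2E) potential0// expr0n/= mul0r g0; lra.
- move=> e e0; pose e' := Num.min 1 e / 2.
  have e'0 : 0 < e' by rewrite divr_gt0// lt_min ltr01.
  have [e'1 e'e] : e' <= 1 /\ 2 * e' <= e.
    have h1 : Num.min 1 e <= 1 by rewrite ge_min lexx.
    have h2 : Num.min 1 e <= e by rewrite ge_min lexx orbT.
    by rewrite /e'; split; lra.
  have [s s0 hs] := potential_adherent bP 0 x e'0.
  have [_ [y [s1 [y0 /andP[ts1 s10] e1 ->]]] hE] := inf_adherent e'0 infE.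
  have sS : - s <= S.
    rewrite /S ler_pdivlMr//; move: hs; rewrite /past_cost g0 !sub0r.
    have : 0 <= (q ^+ 2 / 2 - eta) * - s by rewrite mulr_ge0 ?subr_ge0 ?oppr_ge0 ?(ltW s0).
    have : 0 <= x ^+ 2 / (2 * - s).
      by rewrite divr_ge0 ?sqr_ge0// mulr_ge0// oppr_ge0 ltW.
    have := gl s (ltW s0).
    move: (x ^+ 2 / _) Wx => z; nra.
  have s1D : s1 - t0 <= - t0 / 2 + D.
    have DE : D * eta = 2 * K + C + 1 by rewrite /D divfK// gt_eqF.
    rewrite -(ler_pM2r eta0).
    have -> : (- t0 / 2 + D) * eta = - t0 / 2 * eta + (2 * K + C + 1) by rewrite -DE; lra.
    have := initial_cost_ge C0 UC y0 ts1 e1.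
    have := gl t0 (ltW t00); have := gu s1 s10.
    have : 0 <= eta * (s1 - t0) by rewrite mulr_ge0 ?(ltW eta0)// subr_ge0.
    move: hE; rewrite -/m; move: (primitive u0 y + _) => z; rewrite /eta; lra.
  have s1s : s1 <= s by lra.
  exists (boundary_cost b u0 t0 0 x y s1 s).
    right; exists y, s1, s; split => //; split => //; first by rewrite ts1.
      exact: ltW.
    by move=> sE; rewrite sE ltxx in s0.
  rewrite /boundary_cost; move: hs hE; rewrite -/m /past_cost g0; lra.
Qed.

End Attraction.

(** * Free evolution without gain *)

Section VanishingGain.
Context {R : realType}.
Variable b : R -> R.
Hypothesis bP : regular_boundary b.

(** The inf-convolution that solves the problem in which the boundary yields no
    gain. *)
Definition free_value (u0 : R -> R) (t0 t x : R) : R :=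
  inf [set free_cost u0 t0 t x y | y in `[0, +oo[].

Section Fixed.
Variables (u0 : R -> R) (t0 t C : R).
Hypothesis t0t : t0 < t.
Hypothesis UC : forall y, 0 <= y -> - C <= primitive u0 y.

Lemma free_value_has_inf x : has_inf [set free_cost u0 t0 t x y | y in `[0, +oo[].
Proof.
split; first by exists (free_cost u0 t0 t x 0); exists 0 => //=; rewrite ?in_itv/= lexx.
exists (- C) => _ [y + <-]; rewrite /= in_itv/= andbT => y0.
rewrite /free_cost; have := UC y0.
suff : 0 <= (x - y) ^+ 2 / (2 * (t - t0)) by lra.
by rewrite divr_ge0 ?sqr_ge0// mulr_ge0// subr_ge0 ltW.
Qed.

Lemma free_value_le x y : 0 <= y -> free_value u0 t0 t x <= free_cost u0 t0 t x y.
Proof.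
move=> y0; apply: ge_inf; first by case: (free_value_has_inf x).
by exists y => //=; rewrite in_itv/= y0.
Qed.

Lemma free_value_adherent x e : 0 < e ->
  exists2 y, 0 <= y & free_cost u0 t0 t x y <= free_value u0 t0 t x + e.
Proof.
move=> e0; have [_ [y + <-] h] := inf_adherent e0 (free_value_has_inf x).
by rewrite /= in_itv/= andbT => y0; exists y => //; exact: ltW.
Qed.

(** Without gain the boundary only reflects: a path that touches it costs at
    least ((x + y)^2) / (2 (t - t0)) besides the initial primitive, and the
    straight line is no dearer. *)
Lemma value_free x : (forall s, s <= t -> gain b s = 0) -> 0 <= x ->
  value b u0 t0 t x = free_value u0 t0 t x.
Proof.
move=> gain_vanishes x0; apply: (value_eq bP) => //.
- move=> c [[y y0 ->]|[y [s1 [s2 [y0 [/andP[ts1 s12] s2t e1 e2] ->]]]]].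
    exact: free_value_le.
  apply: (le_trans (free_value_le x y0)); rewrite /free_cost /boundary_cost.
  rewrite !gain_vanishes ?(le_trans s12)// subrr subr0 -addrA lerD2l.
  have h1 : (x - y) ^+ 2 <= (x + y) ^+ 2 by nra.
  have [s1t|s1t] := eqVneq s1 t0.
    rewrite (e1 s1t) expr0n/= mul0r add0r subr0.
    have [s2E|s2E] := eqVneq s2 t; first by rewrite (e2 s2E) expr0n/= !mul0r.
    have ts2 : 0 < t - s2 by rewrite subr_gt0 lt_neqAle s2E.
    rewrite ler_wpM2l ?sqr_ge0// lef_pV2 ?posrE ?mulr_gt0 ?subr_gt0//; lra.
  have ts1' : 0 < s1 - t0 by rewrite subr_gt0 lt_neqAle eq_sym s1t.
  have [s2E|s2E] := eqVneq s2 t.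
    rewrite (e2 s2E) expr0n/= mul0r addr0 sub0r sqrrN.
    rewrite ler_wpM2l ?sqr_ge0// lef_pV2 ?posrE ?mulr_gt0 ?subr_gt0//; lra.
  have ts2 : 0 < t - s2 by rewrite subr_gt0 lt_neqAle s2E.
  apply: le_trans (sqr_div_sum y x ts1' ts2); rewrite (addrC y x).
  apply: (@le_trans _ _ ((x + y) ^+ 2 / (2 * (t - t0)))).
    by rewrite ler_wpM2r// invr_ge0 mulr_ge0// subr_ge0 ltW.
  have d1 : 0 < 2 * (s1 - t0 + (t - s2)) by lra.
  have d2 : 0 < 2 * (t - t0) by lra.
  by rewrite ler_wpM2l ?sqr_ge0// lef_pV2 ?posrE//; lra.
- move=> e e0; have [y y0 h] := free_value_adherent x e0.
  by exists (free_cost u0 t0 t x y) => //; left; exists y.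
Qed.

(** A near-minimiser y for the point 0 is also a candidate for x, and
    (x - y)^2 <= x^2 + y^2 on the half-line.  The bound does not depend on the
    initial condition, which is what forces long free evolutions to be flat. *)
Lemma free_value_increment x : 0 <= x ->
  free_value u0 t0 t x - free_value u0 t0 t 0 <= x ^+ 2 / (2 * (t - t0)).
Proof.
move=> x0; rewrite lerBlDr; apply/ler_addgt0Pr => e e0.
have [y y0] := free_value_adherent 0 e0; have := free_value_le x y0.
rewrite /free_cost sub0r sqrrN => h1 h2.
suff : (x - y) ^+ 2 / (2 * (t - t0)) <= x ^+ 2 / (2 * (t - t0)) + y ^+ 2 / (2 * (t - t0)) by lra.
by rewrite -mulrDl ler_wpM2r ?invr_ge0 ?mulr_ge0 ?subr_ge0 ?(ltW t0t)//; nra.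
Qed.

(** Near-optimal starting points stay at a bounded distance from [0, r], because
    the initial primitive is bounded below. *)
Lemma free_value_lipschitz r : 0 <= r -> exists K : R, 0 <= K /\
  forall x y, 0 <= x <= r -> 0 <= y <= r ->
   `|free_value u0 t0 t x - free_value u0 t0 t y| <= K * `|x - y|.
Proof.
move=> r0.
have tt0 : 0 < t - t0 by rewrite subr_gt0.
pose M := 1 + primitive u0 0 + r ^+ 2 / (2 * (t - t0)) + C.
pose Y := 1 + M * (2 * (t - t0)).
pose K := (2 * Y + r) / (2 * (t - t0)).
have tt2 : 0 < 2 * (t - t0) by rewrite mulr_gt0.
have M0 : 0 <= M.
  rewrite /M; have := UC (lexx 0); have : 0 <= r ^+ 2 / (2 * (t - t0)).
    by rewrite divr_ge0 ?sqr_ge0// ltW.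
  lra.
have Y0 : 0 <= Y by rewrite addr_ge0// mulr_ge0// ltW.
have half x y : 0 <= x <= r -> 0 <= y <= r ->
   free_value u0 t0 t x - free_value u0 t0 t y <= K * `|x - y|.
  move=> /andP[x0 xr] /andP[y0 yr].
  rewrite lerBlDr; apply/ler_addgt0Pr => e e0.
  pose e' := Num.min 1 e.
  have e'0 : 0 < e' by rewrite lt_min ltr01.
  have [e'1 e'e] : e' <= 1 /\ e' <= e by rewrite !ge_min !lexx orbT.
  have [z z0 hz] := free_value_adherent y e'0.
  have hx := free_value_le x z0.
  have zY : `|y - z| <= Y.
    have : (y - z) ^+ 2 <= M * (2 * (t - t0)).
      rewrite -ler_pdivrMr//; move: hz; rewrite /free_cost.
      have := free_value_le y (lexx 0); rewrite /free_cost subr0.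
      have : y ^+ 2 / (2 * (t - t0)) <= r ^+ 2 / (2 * (t - t0)).
        by rewrite ler_wpM2r ?invr_ge0 ?(ltW tt2)// ler_pXn2r// nnegrE.
      have := UC z0; rewrite /M; lra.
    have := real_normK (num_real (y - z)); have := normr_ge0 (y - z).
    rewrite /Y; move: (`|y - z|) => w w0 <-; nra.
  have num : (x - z) ^+ 2 - (y - z) ^+ 2 <= (2 * Y + r) * `|x - y|.
    have -> : (x - z) ^+ 2 - (y - z) ^+ 2 = (x - y) * ((x - y) + 2 * (y - z)) by lra.
    have h1 : `|x - y| <= r by rewrite ler_norml; apply/andP; split; lra.
    apply: (le_trans (ler_norm _)); rewrite normrM mulrC ler_wpM2r//.
    apply: (le_trans (ler_normD _ _)); rewrite normrM (ger0_norm (ler0n _ 2)); lra.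
  have : ((x - z) ^+ 2 - (y - z) ^+ 2) / (2 * (t - t0)) <= K * `|x - y|.
    rewrite /K ler_pdivrMr//; apply: (le_trans num).
    by rewrite mulrAC divfK// gt_eqF.
  move: hz hx; rewrite /free_cost; lra.
exists K; split; first by rewrite divr_ge0 ?(ltW tt2)// addr_ge0// mulr_ge0.
move=> x y xr yr; rewrite ler_norml half// andbT.
by rewrite lerNl opprB distrC half.
Qed.

End Fixed.
End VanishingGain.

(** * Velocity of the stationary potential *)

Section LipschitzFTC.
Context {R : realType}.
Local Notation mu := (@lebesgue_measure R).

Lemma ae_lebesgue_neq (c : R) : {ae mu, forall x, x != c}.
Proof.
exists [set c]; split => //; first exact: lebesgue_measure_set1.
by move=> x /= /negP; rewrite negbK => /eqP.
Qed.

Lemma ae_filter2 (P Q S : R -> Prop) : {ae mu, forall x, P x} -> {ae mu, forall x, Q x} ->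
  (forall x, P x -> Q x -> S x) -> {ae mu, forall x, S x}.
Proof.
move=> hP hQ PQS; have F := ae_filter_ringOfSetsType mu.
by apply: filterS2 hP hQ.
Qed.

Lemma ae_imply1 (P S : R -> Prop) : {ae mu, forall x, P x} ->
  (forall x, P x -> S x) -> {ae mu, forall x, S x}.
Proof.
by move=> hP PS; have F := ae_filter_ringOfSetsType mu; apply: filterS hP.
Qed.

(** Lipschitz functions are absolutely continuous, so their derivative is
    integrated by [abs_continuous_FTC]; u only has to agree with it almost
    everywhere. *)
Lemma integral_ae_derivative (F : R -> R) (a c K : R) (u : R -> R) : a < c -> 0 <= K ->
  (forall x y, a <= x -> x <= y -> y <= c -> `|F y - F x| <= K * (y - x)) ->
  measurable_fun `[a, c] u ->
  {ae mu, forall x, a < x < c -> derivable F x 1 -> u x = derive1 F x} ->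
  (\int[mu]_(x in `[a, c]) (u x)%:E = (F c - F a)%:E)%E.
Proof.
move=> ac K0 lip mu_ uF.
have [f [fint fE fF]] := abs_continuous_FTC ac (lipschitz_abs_continuous K0 lip).
have fac : mu.-integrable `[a, c] (EFin \o f) by exact: integrableS fint.
rewrite fE ?lexx ?ltW// /Rintegral fineK; last exact: integrable_fin_num.
apply: ae_eq_integral => //.
- by apply/measurable_EFinP.
- by case/integrableP: fac.
have := ae_filter2 (ae_lebesgue_neq a) (ae_lebesgue_neq c) (fun x h1 h2 => conj h1 h2).
move=> nac; apply: (ae_filter2 nac (ae_filter2 uF fF (fun x h1 h2 => conj h1 h2))).
move=> x [xa xc] [h1 h2]; rewrite /= in_itv/= => /andP[ax xc'].
have axc : a < x < c by rewrite !lt_neqAle ax xc' xc eq_sym xa.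
by have [dF <-] := h2 axc; rewrite h1.
Qed.

Lemma lipschitz_ae_derivable (F : R -> R) (a c K : R) : a < c -> 0 <= K ->
  (forall x y, a <= x -> x <= y -> y <= c -> `|F y - F x| <= K * (y - x)) ->
  {ae mu, forall x, a < x < c -> derivable F x 1}.
Proof.
move=> ac K0 lip.
have [f [_ _ fF]] := abs_continuous_FTC ac (lipschitz_abs_continuous K0 lip).
by apply: ae_imply1 fF _ => x h /h[].
Qed.

End LipschitzFTC.

Section PotentialVelocity.
Context {R : realType}.
Local Notation mu := (@lebesgue_measure R).
Variable b : R -> R.
Hypothesis bP : regular_boundary b.
Local Notation W := (potential b).

(** For x >= delta a near-optimal departure time cannot be too close to t, as
    the quotient x^2 / (t - s) would exceed the cost of leaving at t - 1.  This
    bounds the slope of the parabolas whose infimum is the potential. *)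
Lemma potential_lipschitz t delta y : 0 < delta -> exists K : R, 0 <= K /\
  forall x z, delta <= x -> x <= z -> z <= y -> `|W t z - W t x| <= K * (z - x).
Proof.
move=> d0; pose y' := Num.max y 0.
have [yy' y'0] : y <= y' /\ 0 <= y' by rewrite !le_max !lexx orbT.
pose K1 := gain b t - gain b (t - 1) + y' ^+ 2 / 2 + 1.
have K10 : 0 < K1.
  have := @gain_nd R b bP (t - 1) t; have := sqr_ge0 y'; rewrite /K1; lra.
pose K := (2 * y') * K1 / delta ^+ 2.
have d20 : 0 < delta ^+ 2 by rewrite exprn_gt0.
exists K; split; first by rewrite divr_ge0 ?(ltW d20)// !mulr_ge0// ltW.
move=> x z dx xz zy; have x0 : 0 < x by exact: lt_le_trans dx.
rewrite ger0_norm; last by rewrite subr_ge0 potential_nd// ltW.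
rewrite lerBlDl; apply/ler_addgt0Pr => e e0; pose e' := Num.min 1 e.
have e'0 : 0 < e' by rewrite lt_min ltr01.
have [e'1 e'e] : e' <= 1 /\ e' <= e by rewrite !ge_min !lexx orbT.
have [s st hs] := potential_adherent bP t x e'0.
have hz := potential_le bP z st.
have t1 : t - 1 < t by lra.
have xy' : x ^+ 2 <= y' ^+ 2 by rewrite ler_pXn2r// ?nnegrE; lra.
have : past_cost b t x (t - 1) <= K1 - 1.
  rewrite /past_cost /K1; have -> : 2 * (t - (t - 1)) = 2 :> R by lra.
  lra.
move=> h1; have h2 := potential_le bP x t1.
have gs : gain b s <= gain b t by rewrite gain_nd// ltW.
have q1 : x ^+ 2 / (2 * (t - s)) <= K1 by move: hs; rewrite /past_cost; lra.
have ts0 : 0 < 2 * (t - s) by rewrite mulr_gt0// subr_gt0.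
have q2 : (2 * (t - s))^-1 <= K1 / delta ^+ 2.
  rewrite ler_pdivlMr//; apply: le_trans q1; rewrite mulrC ler_wpM2r//.
    by rewrite invr_ge0 ltW.
  by rewrite ler_pXn2r// nnegrE; lra.
have k0 : 0 <= K1 / delta ^+ 2 by rewrite divr_ge0 ?ltW.
have zx0 : 0 <= z - x by rewrite subr_ge0.
have q3 : z ^+ 2 / (2 * (t - s)) - x ^+ 2 / (2 * (t - s)) <= K * (z - x).
  rewrite -mulrBl subr_sqr.
  have -> : K * (z - x) = (z - x) * (2 * y') * (K1 / delta ^+ 2).
    by rewrite /K -[2 * y' * K1 / _]mulrA; move: (K1 / _) => k; lra.
  apply: (@le_trans _ _ ((z - x) * (z + x) * (K1 / delta ^+ 2))).
    by rewrite ler_wpM2l// mulr_ge0//; lra.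
  by rewrite ler_wpM2r// ler_wpM2l//; lra.
move: hs hz; rewrite /past_cost; lra.
Qed.

Definition difference_quotient t (n : nat) x : R :=
  (W t (Num.max x 0 + n.+1%:R^-1) - W t (Num.max x 0)) * n.+1%:R.

(** A Borel version of the spatial derivative of the potential.  The upper limit
    is taken in the extended reals so that measurability is automatic; negative
    arguments are sent to 0, since only the half-line matters. *)
Definition velocity t x : R :=
  fine (limn_esup (fun n => (difference_quotient t n x)%:E)).

Lemma difference_quotient_ge0 t n x : 0 <= difference_quotient t n x.
Proof.
rewrite mulr_ge0// subr_ge0 potential_nd// ?le_max ?lexx ?orbT//.
by rewrite lerDl invr_ge0.
Qed.

Lemma velocity_ge0 t x : 0 <= velocity t x.
Proof.
apply: fine_ge0; rewrite /limn_esup limf_esupE.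
apply: le_ereal_inf_tmp => _ [V [N _ NV] <-].
apply: (@le_trans _ _ (difference_quotient t N x)%:E).
  by rewrite lee_fin difference_quotient_ge0.
by apply: ereal_sup_ubound; exists N => //; apply: NV => /=.
Qed.

Lemma measurable_velocity t : measurable_fun setT (velocity t).
Proof.
apply: measurableT_comp; first exact: fine_measurable.
apply: measurable_fun_limn_esup => n; apply/measurable_EFinP.
have nd (h : R) : 0 <= h -> measurable_fun setT (fun x : R => W t (Num.max x 0 + h)).
  move=> h0; apply: nondecreasing_measurable => // x y xy.
  apply: potential_nd => //; first by rewrite addr_ge0// le_max lexx orbT.
  by rewrite lerD2r ge_max !le_max xy lexx orbT.
apply: measurable_funM => //; apply: measurable_funB; first by apply: nd; rewrite invr_ge0.
by under eq_fun do rewrite -[Num.max _ _]addr0; exact: nd.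
Qed.

Lemma velocity_derive t x : 0 < x -> derivable (W t) x 1 -> velocity t x = derive1 (W t) x.
Proof.
move=> x0 dW.
have /cvgr_dnbhsP := dW => /(_ (fun n => n.+1%:R^-1)).
have h0 : (forall n : nat, n.+1%:R^-1 != 0 :> R) /\ (n.+1%:R^-1 : R) @[n --> \oo] --> (0 : R).
  by split; [move=> n; rewrite invr_eq0 pnatr_eq0|exact: cvg_harmonic].
move=> /(_ h0); rewrite -/(derive _ _ _) => cv.
have {}cv : (difference_quotient t n x)%:E @[n --> \oo] --> (derive1 (W t) x)%:E.
  rewrite derive1E; apply: cvg_EFin; first exact: nearW.
  apply: cvg_trans cv; apply: near_eq_cvg; near=> n => /=.
  rewrite /difference_quotient max_l ?(ltW x0)// invrK mulrC.
  by rewrite [_%:A]mulr1 [x + _]addrC.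
have [_ e] := cvg_limn_einf_sup cv.
by rewrite /velocity e.
Unshelve. all: by end_near. Qed.

(** The half-line is exhausted by the intervals from 1 / (n + 1) to n + 2, on each
    of which the potential is Lipschitz. *)
Lemma potential_ae_derivable t : {ae mu, forall x, 0 < x -> derivable (W t) x 1}.
Proof.
have : {ae mu, forall x (n : nat), n.+1%:R^-1 < x < n.+2%:R -> derivable (W t) x 1}.
  apply: ae_foralln => n.
  have n0 : 0 < n.+1%:R^-1 :> R by rewrite invr_gt0.
  have [K [K0 lip]] := potential_lipschitz t n.+2%:R n0.
  apply: lipschitz_ae_derivable K0 lip.
  rewrite -[X in _ < X]mul1r -ltr_pdivrMr// -invfM invf_lt1// ?mulr_gt0//.
  by rewrite -natrM ltr1n.
move/ae_imply1; apply => x h x0.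
pose n := Num.truncn (Num.max x x^-1).
have nx : Num.max x x^-1 < n.+1%:R by exact: Num.Theory.truncnS_gt.
apply: (h n); move: nx; rewrite gt_max => /andP[h1 h2]; apply/andP; split.
  by rewrite -[X in _ < X]invrK ltf_pV2 ?posrE ?invr_gt0.
by apply: (lt_trans h1); rewrite ltr_nat.
Qed.

Lemma velocity_rc_derivative t : {ae mu, forall x, 0 <= x -> rc_derivative (W t) x = velocity t x}.
Proof.
apply: (ae_filter2 (potential_ae_derivable t) (ae_lebesgue_neq 0)) => x dW x0 xge0.
have xgt0 : 0 < x by rewrite lt_def x0.
by rewrite rc_derivative_derivable ?velocity_derive//; exact: dW.
Qed.

Lemma integral_velocity_pos t delta y : 0 < delta -> delta < y ->
  (\int[mu]_(x in `[delta, y]) (velocity t x)%:E = (W t y - W t delta)%:E)%E.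
Proof.
move=> d0 dy; have [K [K0 lip]] := potential_lipschitz t y d0.
apply: integral_ae_derivative K0 lip _ _ => //.
- exact: measurable_funTS (measurable_velocity t).
- apply: aeW => x /andP[dx _] dW; apply: velocity_derive => //; exact: lt_trans dx.
Qed.

Lemma potential_cvg0 t (h : nat -> R) : (forall n, 0 < h n) -> h n @[n --> \oo] --> 0 ->
  W t (h n) @[n --> \oo] --> 0.
Proof.
move=> h0 hc; have [L [L0 LP]] := potential_near0 bP t.
apply: (@squeeze_cvgr _ _ _ _ (fun=> 0) (fun n => L * h n)).
- have := hc => /cvgr_le /(_ _ ltr01); apply: filterS => n hn.
  by rewrite potential_ge0// LP// h0.
- exact: cvg_cst.
- by rewrite -(mulr0 L); apply: cvgMr.
Qed.

(** The potential may have infinite slope in the limit at 0, so the integral is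
    obtained from [delta, y] by monotone convergence, using that the velocity is
    nonnegative and that the potential is continuous at 0. *)
Lemma integral_velocity t y : 0 <= y ->
  (\int[mu]_(x in `[0%R, y]) (velocity t x)%:E = (W t y)%:E)%E.
Proof.
rewrite le_eqVlt => /predU1P[<-|y0].
  by rewrite set_itv1 integral_set1 potential0.
have mv (D : set R) : measurable_fun D (fun x => (velocity t x)%:E).
  by apply: measurable_funTS; apply/measurable_EFinP; exact: measurable_velocity.
rewrite -integral_itv_obnd_cbnd//.
pose h n : R := y / n.+2%:R.
have h0 n : 0 < h n by rewrite divr_gt0.
have hy n : h n < y by rewrite /h ltr_pdivrMr// ltr_pMr// ltr1n.
have hcvg : h n @[n --> \oo] --> 0.
  rewrite -(mulr0 y); apply: cvgMr.
  by have := @cvg_harmonic R; rewrite -cvg_shiftS.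
pose F n := `[h n, y]%classic : set R.
have FE : \bigcup_n F n = `]0, y]%classic.
  apply/seteqP; split => x /=.
    by move=> [n _]; rewrite /F/= !in_itv/= => /andP[hx ->]; rewrite (lt_le_trans (h0 n)).
  rewrite in_itv/= => /andP[x0 xy].
  have : \forall n \near \oo, h n <= x by apply: (cvgr_le (0:R)).
  move=> [n _ nP]; exists n => //; rewrite /F/= in_itv/= xy andbT.
  by apply: nP => /=.
have c1 : (W t y - W t (h n))%:E @[n --> \oo] --> (W t y)%:E.
  apply: cvg_EFin; first exact: nearW.
  by rewrite -[X in _ --> X]subr0; apply: cvgB; [exact: cvg_cst|exact: potential_cvg0].
have cv : (\int[mu]_(x in F i) (velocity t x)%:E)%E @[i --> \oo] -->
    (\int[mu]_(x in `]0%R, y]) (velocity t x)%:E)%E.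
  rewrite -FE; apply: ge0_nondecreasing_set_cvg_integral => //.
  - move=> m n mn; rewrite subsetEset; apply: subset_itvr; rewrite bnd_simp.
    by rewrite /h ler_wpM2l ?(ltW y0)// lef_pV2 ?posrE// ler_nat.
  - by move=> i; exact: measurable_itv.
  - by move=> i; exact: mv.
  - by move=> *; rewrite lee_fin velocity_ge0.
have e : (fun i => (\int[mu]_(x in F i) (velocity t x)%:E)%E) =
    (fun n => (W t y - W t (h n))%:E).
  by apply/funext => n; rewrite /F integral_velocity_pos.
rewrite e in cv; by move/cvg_lim : cv => <- //; move/cvg_lim : c1 => ->.
Qed.

Lemma primitive_velocity t y : 0 <= y -> primitive (velocity t) y = W t y.
Proof. by move=> y0; rewrite /primitive /Rintegral integral_velocity. Qed.

Lemma velocity_L1loc t : L1loc (velocity t).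
Proof.
move=> y y0; apply/integrableP; split.
  by apply: measurable_funTS; apply/measurable_EFinP; exact: measurable_velocity.
apply: (@le_lt_trans _ _ (W t y)%:E); last exact: ltry.
rewrite -(integral_velocity t y0); rewrite le_eqVlt; apply/orP; left; apply/eqP.
by apply: eq_integral => x _; rewrite /= ger0_norm// velocity_ge0.
Qed.

End PotentialVelocity.

(** * Translation of the boundary value and measurability of the gain *)

Section MeasurePreserving.
Local Open Scope ereal_scope.
Context d (T : measurableType d) (R : realType) (m : {measure set T -> \bar R}).

Lemma ge0_integral_preserved (phi : T -> T) (f : T -> \bar R) :
  measurable_fun setT phi ->
  (forall A, measurable A -> m (phi @^-1` A) = m A) ->
  measurable_fun setT f -> (forall x, 0 <= f x) ->
  \int[m]_x f (phi x) = \int[m]_x f x.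
Proof.
move=> mphi mP mf f0.
have -> : \int[m]_x f (phi x) = \int[pushforward m phi]_x f x.
  by rewrite ge0_integral_pushforward// preimage_setT.
by apply: eq_measure_integral => A mA _; exact: mP.
Qed.

End MeasurePreserving.

Section Translation.
Context {R : realType}.
Local Notation mu := (@lebesgue_measure R).

Lemma measurable_translation (t : R) :
  measurable_fun setT (fun r : measurableTypeR R => (r + t : measurableTypeR R)).
Proof. exact: measurable_funD. Qed.

Lemma lebesgue_measure_translation (t : R) (A : set (measurableTypeR R)) :
  measurable A -> mu ((fun r : measurableTypeR R => r + t) @^-1` A) = mu A.
Proof.
pose phi : {mfun measurableTypeR R >-> measurableTypeR R} :=
  HB.pack (fun r : measurableTypeR R => (r + t : measurableTypeR R))
    (isMeasurableFun.Build _ _ _ _ _ (measurable_translation t)).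
move=> mA; apply/esym.
apply: (@lebesgue_measure_unique R (pushforward mu phi)) => // X /ocitvP[->|[[x y] /= xy ->]].
  by rewrite !measure0.
have -> : pushforward mu phi `]x, y]%classic = mu `]x - t, y - t]%classic.
  congr (mu _); apply/seteqP; split => r /=; rewrite !in_itv/= => /andP[h1 h2];
    apply/andP; split; lra.
rewrite !lebesgue_measure_itv/= !lte_fin ltrD2r xy -!EFinB; congr EFin; lra.
Qed.

Variable b : R -> R.
Hypothesis bP : regular_boundary b.

Lemma regular_boundary_shift t : regular_boundary (fun r => b (r + t)).
Proof.
split.
  apply: (@measurableT_comp _ _ _ _ _ _ b) => //; first by case: bP.
  exact: measurable_translation.
move=> s r; have [M Mb] := bP.2 (s + t) (r + t); exists M => z /andP[sz zr].
by apply: Mb; rewrite !lerD2r sz.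
Qed.

Lemma int_pos_sq_shift t x y :
  \int[mu]_(r in `[x, y]) pos_sq (fun s => b (s + t)) r =
  \int[mu]_(r in `[x + t, y + t]) pos_sq b r.
Proof.
rewrite /Rintegral; congr fine.
rewrite [LHS]integral_mkcond [RHS]integral_mkcond.
pose f := (fun r => (pos_sq b r)%:E) \_ (`[x + t, y + t]%classic : set R).
have -> : (\int[mu]_r ((fun r => (pos_sq (fun s => b (s + t)) r)%:E) \_ `[x, y]) r =
  \int[mu]_r (f (r + t)%R))%E.
  apply: eq_integral => r _; rewrite /f /patch.
  have -> : (r + t \in (`[x + t, y + t]%classic : set R)) = (r \in (`[x, y]%classic : set R)).
    by apply/idP/idP; rewrite !inE/= !in_itv/= !lerD2r.
  by [].
apply: (@ge0_integral_preserved _ _ _ mu (fun r : measurableTypeR R => (r + t : measurableTypeR R)) f).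
- exact: measurable_translation.
- exact: lebesgue_measure_translation.
- apply/(measurable_restrictT _ _).1; first exact: measurable_itv.
  apply/measurable_EFinP.
  by apply: measurable_funTS; exact: measurable_pos_sq.
- by move=> r; apply: erestrict_ge0 => z _; rewrite lee_fin pos_sq_ge0.
Qed.

(** The gain is a cocycle over the translations of the boundary value. *)
Lemma gain_shift t s : gain (fun r => b (r + t)) s = gain b (s + t) - gain b t.
Proof.
have cP := regular_boundary_shift t.
have g0 := gain0 (fun r => b (r + t)).
have [s0|/ltW s0] := leP 0 s.
  have := gainB cP s0; rewrite int_pos_sq_shift add0r g0.
  rewrite gainB//; first lra.
  lra.
have := gainB cP s0; rewrite int_pos_sq_shift add0r g0.
rewrite gainB//; first lra.
lra.
Qed.

End Translation.

Section MeasurableGain.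
Context {R : realType} {d : measure_display} {Omega : measurableType d}.
Local Notation mu := (@lebesgue_measure R).
Variable theta : R -> Omega -> Omega.
Variable phi : Omega -> R.
Hypothesis boundary_meas : measurable_boundary theta phi.
Hypothesis boundary_bnd : locally_bounded_boundary theta phi.

Lemma boundary_regular w : regular_boundary (boundary theta phi w).
Proof.
split; last exact: boundary_bnd.
have := measurableT_comp boundary_meas (pair2_measurable (T1 := measurableTypeR R) w).
by [].
Qed.

(** Tonelli's theorem, from the joint measurability of the boundary value. *)
Lemma measurable_int_boundary x y :
  measurable_fun setT (fun w => (\int[mu]_(r in `[x, y]) (pos_sq (boundary theta phi w) r)%:E)%E).
Proof.
pose f (z : measurableTypeR R * Omega) : \bar R :=
  ((fun r => (pos_sq (boundary theta phi z.2) r)%:E) \_ (`[x, y]%classic : set R)) z.1.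
have mf : measurable_fun setT f.
  rewrite (_ : f = (fun z => (pos_sq (boundary theta phi z.2) z.1)%:E) \_
      ((`[x, y]%classic : set (measurableTypeR R)) `*` setT)); last first.
    apply/funext => z; rewrite /f /patch; congr (if _ then _ else _).
    by apply/idP/idP; rewrite !inE/=; [move=> h; split|case].
  apply/(measurable_restrictT _ _).1.
    by apply: measurableX => //; exact: measurable_itv.
  apply: measurable_funTS; apply/measurable_EFinP.
  by apply: measurable_funX; apply: measurable_maxr.
have f0 z : (0 <= f z)%E by apply: erestrict_ge0 => r _; rewrite lee_fin pos_sq_ge0.
have := @measurable_fun_fubini_tonelli_G _ _ _ _ _ mu f mf f0.
apply: eq_measurable_fun => w _.
by rewrite /fubini_G /f [RHS]integral_mkcond.
Qed.

Lemma measurable_gain s : measurable_fun setT (fun w => gain (boundary theta phi w) s).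
Proof.
have mR x y : measurable_fun setT (fun w => \int[mu]_(r in `[x, y]) pos_sq (boundary theta phi w) r).
  by apply: (measurableT_comp (fine_measurable _)) => //; exact: measurable_int_boundary.
by apply: measurable_funM => //; apply: measurable_funB.
Qed.

End MeasurableGain.

(** * The maximal ergodic theorem *)

Section MaximalErgodic.
Context {d : measure_display} {T : measurableType d} {R : realType}.
Variable P : probability T R.
Variable tau : T -> T.
Hypothesis mtau : measurable_fun setT tau.
Hypothesis tauP : forall A, measurable A -> P (tau @^-1` A) = P A.
Variable g : T -> R.
Hypothesis gint : P.-integrable setT (EFin \o g).

(** The maximum of the first n Birkhoff sums of g over tau, the empty one
    included; the recursion holds because the sums after the first step are g
    plus the sums along the shifted orbit. *)
Fixpoint max_sum (n : nat) (w : T) : R :=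
  if n is k.+1 then Num.max 0 (g w + max_sum k (tau w)) else 0.

Let mg : measurable_fun setT g.
Proof. by apply/measurable_EFinP; case/integrableP: gint. Qed.

Lemma max_sum_ge0 n w : 0 <= max_sum n w.
Proof. by case: n => //= n; rewrite le_max lexx. Qed.

Lemma max_sum_nd n w : max_sum n w <= max_sum n.+1 w.
Proof.
elim: n w => [|n ih] w; first exact: max_sum_ge0.
by rewrite /= ge_max le_max lexx/= le_max; apply/orP; right; rewrite lerD2l; exact: ih.
Qed.

Lemma measurable_max_sum n : measurable_fun setT (max_sum n).
Proof.
elim: n => [|n ih] /=; first exact: measurable_cst.
apply: measurable_maxr => //; apply: measurable_funD => //.
exact: (measurableT_comp ih).
Qed.

Lemma integrable_comp_preserved (f : T -> R) : P.-integrable setT (EFin \o f) ->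
  P.-integrable setT (EFin \o (f \o tau)).
Proof.
move=> /integrableP[mf fi]; apply/integrableP; split.
  by apply/measurable_EFinP; apply: measurableT_comp => //; apply/measurable_EFinP.
have := @ge0_integral_preserved _ T R P tau (fun x => `|(f x)%:E|%E) mtau tauP.
by move=> -> //; exact: measurableT_comp.
Qed.

Lemma integrable_max_sum n : P.-integrable setT (EFin \o max_sum n).
Proof.
elim: n => [|n ih]; first by apply: eq_integrable (integrable0 _ _) => // x _.
have h : P.-integrable setT (EFin \o (fun w => g w + max_sum n (tau w))).
  apply: eq_integrable (integrableD measurableT gint (integrable_comp_preserved ih)) => //.
apply: le_integrable (integrable_abse h) => //.
  by apply/measurable_EFinP; exact: measurable_max_sum.
move=> x _ /=; rewrite lee_fin normr_id; set z := _ + _.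
rewrite ger0_norm ?le_max ?lexx// ge_max normr_ge0/=; exact: ler_norm.
Qed.

(** Garsia's argument: where the maximum M = max_sum (n + 1) is positive it equals
    g + max_sum n o tau, so g >= M - M o tau there, and elsewhere
    0 >= M - M o tau; the difference M - M o tau has integral zero. *)
Lemma max_sum_positive_integral n :
  (0 <= \int[P]_(w in [set w | (0 < max_sum n.+1 w)%R]) (g w)%:E)%E.
Proof.
pose A := [set w | 0 < max_sum n.+1 w].
have mA : measurable A.
  rewrite -[A]setTI; have := measurable_max_sum n.+1 => /(_ measurableT `]0, +oo[%classic).
  move=> /(_ (measurable_itv _)); congr (measurable (_ `&` _)).
  by apply/seteqP; split => x /=; rewrite in_itv/= andbT.
rewrite integral_mkcond.
pose M := max_sum n.+1.
have Mint : P.-integrable setT (EFin \o M) := integrable_max_sum n.+1.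
have Mtint : P.-integrable setT (EFin \o (M \o tau)) := integrable_comp_preserved Mint.
apply: (@le_trans _ _ (\int[P]_w ((EFin \o M) w - (EFin \o (M \o tau)) w))%E).
  rewrite integralB// -(@ge0_integral_preserved _ T R P tau (EFin \o M))//.
  - rewrite subee//; exact: integrable_fin_num.
  - by case/integrableP: Mint.
  - by move=> x; rewrite lee_fin max_sum_ge0.
apply: le_integral => //.
- exact: integrableB.
- by apply/(integrable_mkcond _ mA).1; exact: integrableS gint.
move=> w _; rewrite /patch; case: ifPn => [/set_mem Aw|/negP wA].
  have -> : (EFin \o M) w = (g w + max_sum n (tau w))%:E.
    move: Aw; rewrite /A/= /M/= => Aw; congr EFin; apply: max_r.
    rewrite leNgt; apply/negP => h; move: Aw; rewrite max_l ?ltxx//; exact: ltW.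
  rewrite /= -EFinB lee_fin lerBlDr lerD2l; exact: max_sum_nd.
have -> : (EFin \o M) w = 0%E.
  congr EFin; apply/eqP; rewrite eq_le max_sum_ge0 andbT leNgt.
  by apply/negP => h; apply: wA; rewrite inE.
by rewrite sub0e leeNl oppe0 lee_fin max_sum_ge0.
Qed.

(** Hopf's maximal ergodic theorem: the sets where one of the first n Birkhoff
    sums is positive exhaust the space, so the integral of g is the limit of the
    nonnegative integrals over them. *)
Theorem maximal_ergodic (S : nat -> T -> R) :
  (forall w, S 0 w = 0) -> (forall k w, S k.+1 w = g w + S k (tau w)) ->
  {ae P, forall w, exists k, 0 < S k w} -> (0 <= \int[P]_w (g w)%:E)%E.
Proof.
move=> S0 SS Spos.
have S_le k w n : (k <= n)%N -> S k w <= max_sum n w.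
  elim: k w n => [|k ih] w [|n]//; rewrite ?S0 ?max_sum_ge0// => kn.
  by rewrite SS /= le_max; apply/orP; right; rewrite lerD2l ih.
have max_le n m w : (n <= m)%N -> max_sum n w <= max_sum m w.
  by move=> nm; apply: (homo_leq (@lexx _ _) (@le_trans _ _) (fun k => max_sum_nd k w)).
pose A n := [set w | 0 < max_sum n.+1 w].
pose f_ n := (EFin \o g) \_ (A n).
have mA n : measurable (A n).
  rewrite -[A n]setTI; have := measurable_max_sum n.+1 => /(_ measurableT `]0, +oo[%classic).
  move=> /(_ (measurable_itv _)); congr (measurable (_ `&` _)).
  by apply/seteqP; split => x /=; rewrite in_itv/= andbT.
have [|||||_ _ cv] := @dominated_convergence _ T R P setT measurableT f_ (EFin \o g)
    (abse \o (EFin \o g)).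
- move=> n; apply/(measurable_restrictT _ _).1 => //.
  by apply: measurable_funTS; case/integrableP: gint.
- by case/integrableP: gint.
- have F := ae_filter_ringOfSetsType P.
  apply: filterS Spos => w [k Sk] _; apply: cvg_near_cst.
  near=> n; rewrite /f_ /patch mem_set//; apply: (lt_le_trans Sk).
  apply: S_le; rewrite ltnW// ltnS; near: n; exact: nbhs_infty_ge.
- exact: integrable_abse.
- by apply: aeW => w n _; rewrite /f_ /patch; case: ifPn => _; rewrite ?abse0 ?lexx ?abse_ge0.
move/cvg_lim : (cv) => <- //.
apply: lime_ge; first by apply/cvg_ex; eexists; exact: cv.
by near=> n; rewrite /= /f_ -integral_mkcond; exact: max_sum_positive_integral.
Unshelve. all: by end_near. Qed.

End MaximalErgodic.

(** * The mean gain *)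

Section ErgodicTheorem.
Context {R : realType} {d : measure_display} {Omega : measurableType d}.
Local Notation mu := (@lebesgue_measure R).
Variable P : probability Omega R.
Variable theta : R -> Omega -> Omega.
Hypothesis theta_ergodic : ergodic_flow P theta.

(** Invariance in one direction for all times is invariance, since the flow is
    invertible. *)
Lemma flow_zero_one (A : set Omega) : measurable A ->
  (forall t w, A (theta t w) -> A w) -> P A = 0%E \/ P A = 1%E.
Proof.
have [[th0 thD] _ _ erg] := theta_ergodic.
move=> mA Ainv; apply: erg => // t; apply/seteqP; split => w /=; first exact: Ainv.
by move=> Aw; apply: (Ainv (- t)); rewrite -thD addNr th0.
Qed.

(** The event that Z k > k / (j + 1) infinitely often for some j is invariant
    under the flow; if it had full probability, [maximal_ergodic] would contradict
    the negative mean of g.  The last hypothesis, that shifting the orbit by t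
    changes Z k by a bounded shift of the index and a constant, yields invariance
    under all times: ergodicity of the flow says nothing about sets that are
    invariant under the single map theta (-1). *)
Lemma ergodic_upper (g : Omega -> R) (Z : nat -> Omega -> R) :
  P.-integrable setT (EFin \o g) -> (\int[P]_w (g w)%:E < 0)%E ->
  (forall k, measurable_fun setT (Z k)) ->
  (forall w, Z 0 w = 0) -> (forall k w, Z k.+1 w = g w + Z k (theta (-1) w)) ->
  (forall t w, exists (K : R) (m : nat), forall k, (m <= k)%N ->
     exists k', [/\ (k - m <= k')%N, (k' <= k + m)%N & Z k (theta t w) <= Z k' w + K]) ->
  {ae P, forall w, forall j : nat, exists N, forall k, (N <= k)%N -> Z k w <= k%:R / j.+1%:R}.
Proof.
move=> gint g_lt0 mZ Z0 ZS Zq; have [[th0 thD] mth thP _] := theta_ergodic.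
pose A := [set w | exists j : nat, forall N, exists2 k, (N <= k)%N & k%:R / j.+1%:R < Z k w].
have mA : measurable A.
  have -> : A = \bigcup_j \bigcap_N \bigcup_(k in [set k | (N <= k)%N])
      [set w | k%:R / j.+1%:R < Z k w].
    apply/seteqP; split => w.
      by move=> [j h]; exists j => // N _; have [k Nk Zk] := h N; exists k.
    by move=> [j _ h]; exists j => N; have [k Nk Zk] := h N Logic.I; exists k.
  apply: bigcupT_measurable => j; apply: bigcapT_measurable => N.
  apply: bigcup_measurable => k _.
  rewrite -[X in measurable X]setTI.
  have := mZ k => /(_ measurableT `]k%:R / j.+1%:R, +oo[%classic (measurable_itv _)).
  congr (measurable (_ `&` _)).
  by apply/seteqP; split => x /=; rewrite in_itv/= andbT.
have [PA|PA] : P A = 0%E \/ P A = 1%E.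
  apply: flow_zero_one => // t w [j h]; have [K [m Km]] := Zq t w.
  (* halving the rate leaves room for the shift m and the constant K *)
  exists (2 * j).+1 => N.
  pose c : R := j.+1%:R.
  have c0 : 0 < c by rewrite ltr0n.
  pose M := Num.truncn (m%:R + 2 * c * `|K|).
  have [k Mk Zk] := h (maxn (N + m) M.+1).
  have mk : (m <= k)%N by move: Mk; rewrite geq_max => /andP[+ _]; apply: leq_trans; exact: leq_addl.
  have [k' [k1 k2 Zk']] := Km k mk.
  exists k'.
    move: Mk; rewrite geq_max => /andP[+ _] => h1.
    by apply: leq_trans k1; rewrite leq_subRL// addnC.
  have kM : m%:R + 2 * c * `|K| < k%:R.
    apply: (lt_le_trans (Num.Theory.truncnS_gt _)); rewrite ler_nat.
    by move: Mk; rewrite geq_max => /andP[].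
  have kk' : k'%:R <= k%:R + m%:R :> R by rewrite -natrD ler_nat.
  have cE : (2 * j).+2%:R = 2 * c by rewrite /c -natrM mulnS.
  rewrite cE; have := lt_le_trans Zk Zk'; rewrite -/c.
  have KK : K <= `|K| by exact: ler_norm.
  rewrite ltr_pdivrMr// ltr_pdivrMr ?mulr_gt0// => hZ.
  nra.
  exists A; split => // w /= /existsNP[j /forallNP h]; exists j => N.
  apply: contrapT => hk; apply: (h N) => k Nk; rewrite leNgt; apply/negP => Zk.
  by apply: hk; exists k.
have := @maximal_ergodic _ _ _ P (theta (-1)) (mth _) (thP (-1)) g gint Z Z0 ZS.
have Apos : {ae P, forall w, exists k, 0 < Z k w}.
  exists (~` A); split; first exact: measurableC.
    by rewrite probability_setC// PA subee.
  move=> w /= hw Aw; apply: hw; have [j /(_ 0%N)[k _ Zk]] := Aw.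
  by exists k; apply: le_lt_trans Zk; rewrite divr_ge0.
by move=> /(_ Apos); rewrite leNgt g_lt0.
Qed.

Variable phi : Omega -> R.
Hypothesis phi_meas : measurable_fun setT phi.
Hypothesis boundary_meas : measurable_boundary theta phi.
Hypothesis boundary_bnd : locally_bounded_boundary theta phi.
Variable q : R.
Hypothesis q_def : ('E_P[fun w => (Num.max (phi w) 0 ^+ 2)%R] = (q ^+ 2)%:E)%E.

Local Notation bd w := (boundary theta phi w).
Let bP w : regular_boundary (bd w).
Proof. exact: boundary_regular. Qed.

Lemma boundary_flow t w : bd (theta t w) = (fun r => bd w (r + t)).
Proof.
have [[_ thD] _ _ _] := theta_ergodic.
by apply/funext => r; rewrite /boundary thD.
Qed.

Lemma gain_flow t w s : gain (bd (theta t w)) s = gain (bd w) (s + t) - gain (bd w) t.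
Proof. by rewrite boundary_flow gain_shift. Qed.

(** The integral of the squared positive part of the boundary value over
    [- k, 0]; as a function of k it is the Birkhoff sum of [past_gain 1] over
    theta (-1). *)
Definition past_gain (k : nat) (w : Omega) : R := - (2 * gain (bd w) (- k%:R)).

Lemma past_gain_flow k t w :
  past_gain k (theta t w) = 2 * gain (bd w) t - 2 * gain (bd w) (t - k%:R).
Proof. by rewrite /past_gain gain_flow [- _ + t]addrC; lra. Qed.

Lemma past_gainS k w : past_gain k.+1 w = past_gain 1 w + past_gain k (theta (-1) w).
Proof.
rewrite past_gain_flow /past_gain -[k.+1]add1n natrD opprD; lra.
Qed.

Lemma past_gain0 w : past_gain 0 w = 0.
Proof. by rewrite /past_gain oppr0 gain0 mulr0 oppr0. Qed.

Lemma measurable_past_gain k : measurable_fun setT (past_gain k).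
Proof.
apply: measurableT_comp => //; apply: measurable_funM => //.
exact: measurable_gain.
Qed.

Lemma past_gain1E w : (past_gain 1 w)%:E =
  (\int[mu]_(r in `[(-1)%R, 0%R]) (pos_sq (bd w) r)%:E)%E.
Proof.
have -> : past_gain 1 w = \int[mu]_(r in `[-1, 0]) pos_sq (bd w) r.
  by rewrite gainB// ?gain0 /past_gain; lra.
rewrite /Rintegral fineK//; apply: integrable_fin_num => //.
exact: pos_sq_integrable.
Qed.

(** Tonelli's theorem and the invariance of the probability under the flow. *)
Lemma expectation_past_gain1 : (\int[P]_w (past_gain 1 w)%:E = (q ^+ 2)%:E)%E.
Proof.
under eq_integral do rewrite past_gain1E.
pose I : set (measurableTypeR R) := `[-1, 0]%classic.
pose f (z : measurableTypeR R * Omega) : \bar R :=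
  ((fun r => (pos_sq (bd z.2) r)%:E) \_ I) z.1.
have mI : measurable I by exact: measurable_itv.
have mf : measurable_fun setT f.
  rewrite (_ : f = (fun z => (pos_sq (bd z.2) z.1)%:E) \_ (I `*` setT)); last first.
    apply/funext => z; rewrite /f /patch; congr (if _ then _ else _).
    by apply/idP/idP; rewrite !inE/=; [move=> h; split|case].
  apply/(measurable_restrictT _ _).1; first exact: measurableX.
  apply: measurable_funTS; apply/measurable_EFinP.
  by apply: measurable_funX; apply: measurable_maxr.
have f0 z : (0 <= f z)%E by apply: erestrict_ge0 => r _; rewrite lee_fin pos_sq_ge0.
have := @fubini_tonelli _ _ _ _ _ mu P f mf f0.
have -> : (\int[P]_y \int[mu]_x f (x, y) =
  \int[P]_w \int[mu]_(r in `[(-1)%R, 0%R]) (pos_sq (bd w) r)%:E)%E.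
  by apply: eq_integral => w _; rewrite [RHS]integral_mkcond.
move=> <-.
have [_ mth thP _] := theta_ergodic.
have mX : measurable_fun setT (fun w => ((Num.max (phi w) 0 ^+ 2)%R)%:E).
  by apply/measurable_EFinP; apply: measurable_funX; apply: measurable_maxr.
have inner (r : measurableTypeR R) : (\int[P]_y f (r, y) = (cst (q ^+ 2)%:E \_ I) r)%E.
  rewrite /f /patch /=; case: ifPn => rI; last by rewrite integral0.
  rewrite -q_def unlock.
  have := @ge0_integral_preserved _ Omega R P (theta r) (fun w => ((Num.max (phi w) 0 ^+ 2)%R)%:E)
    (mth r) (thP r) mX.
  by move=> <- // w; rewrite lee_fin sqr_ge0.
under eq_integral do rewrite inner.
rewrite -integral_mkcond integral_cst//= /I lebesgue_measure_itv/= lte_fin ltrN10.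
by rewrite -EFinB -EFinM; congr EFin; lra.
Qed.

Lemma past_gain1_ge0 w : 0 <= past_gain 1 w.
Proof.
have := @gain_nd R _ (bP w) (- 1%:R) 0; rewrite gain0 /past_gain.
by rewrite lerNl oppr0 ler01; lra.
Qed.

Lemma integrable_past_gain1 : P.-integrable setT (EFin \o past_gain 1).
Proof.
apply/integrableP; split; first by apply/measurable_EFinP; exact: measurable_past_gain.
have -> : (\int[P]_w `|(EFin \o past_gain 1) w| = \int[P]_w (past_gain 1 w)%:E)%E.
  by apply: eq_integral => w _; rewrite /= ger0_norm// past_gain1_ge0.
by rewrite expectation_past_gain1 ltry.
Qed.

(** The quasi-invariance required by [ergodic_upper] comes from monotonicity of the
    gain: the window of length k ending at time t is contained in the window of
    length k + m ending at 0, up to a bounded piece, once |t| <= m. *)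
Lemma past_gain_upper (c : R) : q ^+ 2 < c ->
  {ae P, forall w, forall j : nat, exists N, forall k, (N <= k)%N ->
     past_gain k w - c * k%:R <= k%:R / j.+1%:R}.
Proof.
move=> qc; apply: (@ergodic_upper (fun w => past_gain 1 w - c)
  (fun k w => past_gain k w - c * k%:R)).
- by apply: eq_integrable (integrableB measurableT integrable_past_gain1
    (finite_measure_integrable_cst P c measurableT)) => // w _.
- under eq_integral do rewrite EFinB.
  rewrite integralB//; [|exact: integrable_past_gain1|exact: finite_measure_integrable_cst].
  rewrite expectation_past_gain1 integral_cst//= probability_setT mule1 -EFinB lte_fin.
  by rewrite subr_lt0.
- move=> k; apply: measurable_funB => //; exact: measurable_past_gain.
- by move=> w; rewrite past_gain0 mulr0 subr0.
- by move=> k w; rewrite past_gainS -natr1; lra.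
- move=> t w; pose m := (Num.truncn `|t|).+1.
  have tm : `|t| <= m%:R by rewrite ltW// Num.Theory.truncnS_gt.
  exists (2 * gain (bd w) t + `|c| * m%:R), m => k mk; exists (k + m)%N; split => //.
    by rewrite leq_subLR addnCA leq_addr.
  rewrite past_gain_flow /past_gain natrD.
  have := @gain_nd R _ (bP w) (- (k%:R + m%:R)) (t - k%:R).
  have : - (k%:R + m%:R) <= t - k%:R by move: tm; rewrite ler_norml => /andP[]; lra.
  have : c * m%:R <= `|c| * m%:R by rewrite ler_wpM2r// ler_norm.
  by move=> h1 h2 /(_ h2); lra.
Qed.

(** As for [past_gain_upper], with the window of length k - m ending at 0, which
    is contained in the shifted one up to a bounded piece. *)
Lemma past_gain_lower (c : R) : c < q ^+ 2 ->
  {ae P, forall w, forall j : nat, exists N, forall k, (N <= k)%N ->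
     c * k%:R - past_gain k w <= k%:R / j.+1%:R}.
Proof.
move=> qc; apply: (@ergodic_upper (fun w => c - past_gain 1 w)
  (fun k w => c * k%:R - past_gain k w)).
- by apply: eq_integrable (integrableB measurableT
    (finite_measure_integrable_cst P c measurableT) integrable_past_gain1) => // w _.
- under eq_integral do rewrite EFinB.
  rewrite integralB//; [|exact: finite_measure_integrable_cst|exact: integrable_past_gain1].
  rewrite expectation_past_gain1 integral_cst//= probability_setT mule1 -EFinB lte_fin.
  by rewrite subr_lt0.
- move=> k; apply: measurable_funB => //; exact: measurable_past_gain.
- by move=> w; rewrite past_gain0 mulr0 subr0.
- by move=> k w; rewrite past_gainS -natr1; lra.
- move=> t w; pose m := (Num.truncn `|t|).+1.
  have tm : `|t| <= m%:R by rewrite ltW// Num.Theory.truncnS_gt.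
  exists (- (2 * gain (bd w) t) + `|c| * m%:R), m => k mk; exists (k - m)%N; split => //.
    by rewrite (leq_trans (leq_subr _ _))// leq_addr.
  rewrite past_gain_flow /past_gain natrB//.
  have := @gain_nd R _ (bP w) (t - k%:R) (- (k%:R - m%:R)).
  have : t - k%:R <= - (k%:R - m%:R) by move: tm; rewrite ler_norml => /andP[]; lra.
  have : c * m%:R <= `|c| * m%:R by rewrite ler_wpM2r// ler_norm.
  by move=> h1 h2 /(_ h2); lra.
Qed.

(** Bounds at integer times, for countably many rates around q^2, are extended to
    all negative times by monotonicity of the gain. *)
Theorem mean_gain_ae : {ae P, forall w, mean_gain (bd w) q}.
Proof.
have F := ae_filter_ringOfSetsType P.
have up i : {ae P, forall w, forall j : nat, exists N, forall k, (N <= k)%N ->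
     past_gain k w - (q ^+ 2 + i.+1%:R^-1) * k%:R <= k%:R / j.+1%:R}.
  by apply: past_gain_upper; rewrite ltrDl invr_gt0.
have lo i : {ae P, forall w, forall j : nat, exists N, forall k, (N <= k)%N ->
     (q ^+ 2 - i.+1%:R^-1) * k%:R - past_gain k w <= k%:R / j.+1%:R}.
  by apply: past_gain_lower; rewrite ltrBlDr ltrDl invr_gt0.
apply: filterS2 (ae_foralln up) (ae_foralln lo) => w hu hl delta delta0.
pose i := Num.truncn delta^-1.
have id : i.+1%:R^-1 <= delta.
  rewrite -[leRHS]invrK lef_pV2 ?posrE ?invr_gt0//.
  exact/ltW/Num.Theory.truncnS_gt.
have [N1 h1] := hu i i; have [N2 h2] := hl i i.
have i0 : 0 < i.+1%:R^-1 :> R by rewrite invr_gt0.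
move: (i.+1%:R^-1 : R) id h1 h2 i0 => iota id h1 h2 i0.
pose N := maxn N1 N2; pose G := gain (bd w).
have Gnd : {homo G : x y / x <= y} by move=> x y; exact: gain_nd.
have G0 : G 0 = 0 by exact: gain0.
have GN : G (- N%:R) <= 0 by rewrite -G0 Gnd// oppr_le0.
have q0 := sqr_ge0 q.
exists (q ^+ 2 + delta - G (- N%:R) + q ^+ 2 * N%:R); split.
  by have := mulr_ge0 q0 (ler0n R N); lra.
move=> s s0; rewrite -/(G s); pose k := Num.truncn (- s).
have /andP[ks sk] : k%:R <= - s < k.+1%:R by apply: Num.Theory.truncn_itv; rewrite oppr_ge0.
have Gs0 : G s <= 0 by rewrite -G0 Gnd.
have NR : 0 <= N%:R :> R by rewrite ler0n.
have dN := mulr_ge0 (ltW delta0) (_ : 0 <= - s); rewrite oppr_ge0 in dN.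
have {}dN := dN s0.
have qN := mulr_ge0 q0 NR.
have [Nk|kN] := leqP N k.
  have [] : (N1 <= k)%N /\ (N2 <= k)%N.
    by move: Nk; rewrite geq_max => /andP.
  move=> n1 n2; have := h1 k.+1 (leqW n1); have := h2 k n2.
  have e1 : past_gain k w = - (2 * G (- k%:R)) by [].
  have e2 : past_gain k.+1 w = - (2 * G (- k.+1%:R)) by [].
  rewrite e1 e2 => l2 l1.
  have g1 : G s <= G (- k%:R) by apply: Gnd; lra.
  have g2 : G (- k.+1%:R) <= G s by apply: Gnd; lra.
  have kS : k.+1%:R = k%:R + 1 :> R by rewrite natr1.
  rewrite kS in l1 g2 sk; have := ler0n R k.
  move: (k%:R : R) ks sk l1 l2 g1 g2 => x ks sk l1 l2 g1 g2 x0.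
  have x1 : q ^+ 2 * (- s - 1) <= q ^+ 2 * x by rewrite ler_wpM2l//; lra.
  have x2 : q ^+ 2 * x <= q ^+ 2 * - s by rewrite ler_wpM2l.
  have x3 : iota * x <= delta * - s by apply: ler_pM => //; lra.
  rewrite ler_norml; apply/andP; split; nra.
have sN : - s <= N%:R by rewrite (le_trans (ltW sk))// ler_nat.
have g1 : G (- N%:R) <= G s by apply: Gnd; lra.
have x1 : q ^+ 2 * - s <= q ^+ 2 * N%:R by rewrite ler_wpM2l.
have x2 : 0 <= q ^+ 2 * - s by rewrite mulr_ge0// oppr_ge0.
rewrite ler_norml; apply/andP; split; lra.
Qed.

End ErgodicTheorem.

(** * The spaces UU, locality of the solution operator and the distance *)

Section FunctionSpaceFacts.
Context {R : realType}.
Local Notation mu := (@lebesgue_measure R).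
Implicit Types u v : R -> R.

Lemma UU_ninfty_of_nonneg u : L1loc u -> (forall y, 0 <= y -> 0 <= primitive u y) -> UU -oo%E u.
Proof.
move=> uL u0; split => //; apply: (@lt_le_trans _ _ 0%E); first exact: ltNy0.
rewrite limf_einfE; apply: (@le_trans _ _ (ereal_inf
   ((fun x : R => (x^-1 * primitive u x)%:E) @` [set x | 0 < x]))).
  apply: le_ereal_inf_tmp => _ [x /= x0 <-].
  by rewrite lee_fin mulr_ge0 ?invr_ge0 ?u0// ltW.
apply: ereal_sup_ubound; exists [set x | 0 < x] => //.
exact: nbhs_pinfty_gt.
Qed.

Lemma UU_L1loc p u : UU p u -> L1loc u. Proof. by case. Qed.

Lemma primitive_lower_local u r : L1loc u -> 0 <= r ->
  exists C, 0 <= C /\ forall y, 0 <= y <= r -> - C <= primitive u y.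
Proof.
move=> uL r0; have uint := uL r r0.
have aint : mu.-integrable `[0, r] (EFin \o (fun x => `|u x|)).
  exact: eq_integrable (integrable_abse uint).
exists (\int[mu]_(x in `[0, r]) `|u x|); split; first exact: Rintegral_ge0.
move=> y /andP[y0 yr].
have sub : `[0, y]%classic `<=` (`[0, r]%classic : set R).
  by apply: subset_itvl; rewrite bnd_simp.
have ayint : mu.-integrable `[0, y] (EFin \o (fun x => `|u x|)).
  exact: integrableS aint.
have : `|\int[mu]_(t in `[0, y]) u t| <= \int[mu]_(t in `[0, y]) `|u t|.
  by apply: le_normr_Rintegral => //; exact: uL.
rewrite ler_norml => /andP[h _]; apply: le_trans h; rewrite lerN2.
rewrite /Rintegral; apply: fine_le.
- exact: integrable_fin_num ayint.
- exact: integrable_fin_num aint.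
- apply: ge0_subset_integral => //.
  by case/integrableP: aint.
Qed.

(** A lower limit of the means above p gives a linear lower bound for the primitive
    with slope a > p; the constant absorbs a bounded interval. *)
Lemma UU_lower (p : R) u : UU p%:E u ->
  exists a C, [/\ p < a, 0 <= C & forall y, 0 <= y -> a * y - C <= primitive u y].
Proof.
move=> [uL]; rewrite limf_einfE => /ereal_sup_gt[_ [V Voo <-] pV].
have [a pa aV] : exists2 a : R, p < a & (a%:E <= ereal_inf
    ((fun x : R => (x^-1 * primitive u x)%:E) @` V))%E.
  move: pV; set I := ereal_inf _; case: I => [z| |].
  - by rewrite lte_fin => pz; exists z.
  - by move=> _; exists (p + 1); [rewrite ltrDl|exact: leey].
  - by rewrite ltNge leNye.
have [X [_ VX]] : nbhs +oo V := Voo.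
pose X' := Num.max X 0 + 1.
have [XX' X'0] : X < X' /\ 0 < X'.
  have : X <= Num.max X 0 by rewrite le_max lexx.
  have : 0 <= Num.max X 0 by rewrite le_max lexx orbT.
  by rewrite /X'; split; lra.
have [C [C0 Cu]] := primitive_lower_local uL (ltW X'0).
exists a, (C + `|a| * X'); split => //; first by rewrite addr_ge0// mulr_ge0// ltW.
move=> y y0; have [yX|Xy] := leP y X'.
  have := Cu y; rewrite y0 yX => /(_ isT).
  have : a * y <= `|a| * X'.
    by apply: (le_trans (ler_norm _)); rewrite normrM ler_wpM2l// ger0_norm.
  lra.
have y0' : 0 < y := lt_trans X'0 Xy.
have : (a%:E <= (y^-1 * primitive u y)%:E)%E.
  apply: (le_trans aV); apply: ereal_inf_lbound; exists y => //.
  by apply: VX; exact: lt_trans Xy.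
rewrite lee_fin mulrC ler_pdivlMr// => h.
have : 0 <= `|a| * X' by rewrite mulr_ge0// ltW.
lra.
Qed.

Lemma eq_primitive u v : L1loc u -> L1loc v -> eqU u v -> primitive u = primitive v.
Proof.
move=> uL vL uv; apply/funext => y; rewrite /primitive.
have [y0|y0] := leP 0 y; last first.
  by rewrite set_itv_ge ?Rintegral_set0// bnd_simp -ltNge.
rewrite /Rintegral; congr fine; apply: ae_eq_integral => //.
- by case/integrableP: (uL y y0).
- by case/integrableP: (vL y y0).
- apply: (ae_imply1 uv) => x h; rewrite /= in_itv/= => /andP[x0 _].
  by rewrite h.
Qed.

(** The action sees the initial condition only through its primitive, so Phi is
    defined on classes of almost everywhere equal functions. *)
Lemma Phi_primitive (b : R -> R) t0 t1 u v : primitive u = primitive v ->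
  Phi b t0 t1 u = Phi b t0 t1 v.
Proof. by move=> uv; rewrite /Phi /value /action uv. Qed.

(** Adding a constant to the value function on [0, r] does not change the solution
    there; the two endpoints are discarded as a null set. *)
Lemma coincide_of_shift (V W w : R -> R) m r :
  {ae mu, forall x, 0 <= x -> rc_derivative W x = w x} ->
  (forall x, 0 <= x <= r -> V x = W x + m) ->
  {ae mu, forall x, 0 <= x <= r -> rc_derivative V x = w x}.
Proof.
move=> Ww VW.
have nac := ae_filter2 (ae_lebesgue_neq 0) (ae_lebesgue_neq r) (fun x h1 h2 => conj h1 h2).
apply: (ae_filter2 nac Ww) => x [xn0 xnr] Wx /andP[x0 xr].
apply: (etrans _ (Wx x0)); apply: (@rc_derivative_shift _ _ _ m).
have xin : x \in `]0, r[ by rewrite in_itv/= !lt_neqAle x0 xr xnr eq_sym xn0.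
near=> y; apply: VW.
have : y \in `]0, r[ by near: y; apply: near_in_itvoo.
by rewrite in_itv/= => /andP[/ltW -> /ltW ->].
Unshelve. all: by end_near. Qed.

(** The solution is the derivative of a Lipschitz value function, so its primitive
    is the increment bounded in [free_value_increment]. *)
Lemma primitive_le_without_gain (b u0 u1 : R -> R) (t0 C r : R) :
  regular_boundary b -> t0 < 0 -> (forall s, s <= 0 -> gain b s = 0) ->
  (forall y, 0 <= y -> - C <= primitive u0 y) -> L1loc u1 ->
  eqU (Phi b t0 0 u0) u1 -> 0 < r -> primitive u1 r <= r ^+ 2 / (2 * - t0).
Proof.
move=> bP t0_lt0 gain_b UC uL Pu r0.
pose V := free_value u0 t0 0.
have [K [K0 lip]] := free_value_lipschitz t0_lt0 UC (ltW r0).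
have intE : (\int[mu]_(x in `[0%R, r]) (u1 x)%:E = (V r - V 0)%:E)%E.
  apply: (@integral_ae_derivative _ V 0 r K) => //.
  - move=> x y x0 xy yr; rewrite -(ger0_norm (_ : 0 <= y - x)) ?subr_ge0//.
    by apply: lip; rewrite ?(le_trans x0 xy)// x0 (le_trans xy).
  - by apply/measurable_EFinP; case/integrableP: (uL r (ltW r0)).
  - apply: (ae_imply1 Pu) => x hx /andP[x0 xr] dV.
    rewrite -(hx (ltW x0)) -(rc_derivative_derivable dV).
    apply: (@rc_derivative_shift _ _ _ 0).
    near=> y; rewrite addr0; apply: (value_free bP t0_lt0 UC gain_b); apply: ltW.
    by near: y; exact: lt_nbhsr.
rewrite /primitive /Rintegral intE/=.
by have := free_value_increment t0_lt0 UC (ltW r0); rewrite sub0r.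
Unshelve. all: by end_near. Qed.

(** Continuity of the primitive reduces a linear lower bound to countably many
    conditions, which makes such bounds measurable events. *)
Lemma le_primitive_of_rational (f : R -> R) (c0 c1 : R) : L1loc f ->
  (forall r : rat, 0 <= ratr r :> R -> c1 * ratr r + c0 <= primitive f (ratr r)) ->
  forall y, 0 <= y -> c1 * y + c0 <= primitive f y.
Proof.
move=> fL hr y y0.
have y1 : y < y + 1 by rewrite ltrDl.
have fint : mu.-integrable `[0, y + 1] (EFin \o f) by apply: fL; lra.
have y01 : 0 < y + 1 by lra.
have := parameterized_integral_continuous (ltW y01) fint.
move=> /(continuous_within_itvP _ y01)[cin c0r _].
pose F x := primitive f x - c1 * x.
have Fc : F x @[x --> y^'+] --> F y.
  apply: cvgB; last first.
    apply: cvgMr; exact: cvg_at_right_filter cvg_id.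
  move: y0; rewrite le_eqVlt => /predU1P[<-|y0]; first exact: c0r.
  by apply: cvg_at_right_filter; apply: cin; rewrite in_itv/= y0.
suff : c0 <= F y by rewrite /F; lra.
rewrite leNgt; apply/negP => Fy.
have : \forall x \near y^'+, F x < c0 by exact: (cvgr_lt _ Fc).
move=> [e /= e0 eP].
have ye : y < y + e by rewrite ltrDl.
have [r] := rat_in_itvoo ye; rewrite in_itv/= => /andP[yr rye].
have := eP (ratr r); rewrite /= ltr0_norm ?subr_lt0// opprB => /(_ _ yr).
have : ratr r - y < e by lra.
move=> /[swap]/[apply]; have := hr r (le_trans y0 (ltW yr)); rewrite /F; lra.
Qed.

Lemma coincide_everywhere (f g : R -> R) :
  (forall n : nat, {ae mu, forall x, 0 <= x <= n%:R -> f x = g x}) -> eqU f g.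
Proof.
move=> h; have F := ae_filter_ringOfSetsType mu.
apply: filterS (ae_foralln h) => x hx x0.
apply: (hx (Num.truncn x).+1); rewrite x0 ltW//.
exact: Num.Theory.truncnS_gt.
Qed.

Lemma distU_ge0 u v : 0 <= distU u v.
Proof. by rewrite fine_ge0// expeR_ge0. Qed.

Lemma distU_le u v r : 0 <= r -> {ae mu, forall x, 0 <= x <= r -> u x = v x} ->
  distU u v <= expR (- r).
Proof.
move=> r0 uv; have rho : (r%:E <= coincidence_radius u v)%E.
  by apply: ereal_sup_ubound; exists r.
have le : (expeR (- coincidence_radius u v) <= (expR (- r))%:E)%E.
  have -> : (expR (- r))%:E = expeR (- r%:E)%E by [].
  by rewrite ler_expeR leeN2.
rewrite /distU -lee_fin fineK//.
rewrite ge0_fin_numE ?expeR_ge0//; apply: (le_lt_trans le); exact: ltry.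
Qed.

End FunctionSpaceFacts.

(** * The stationary solution and its attraction property *)

Section StationarySolution.
Context {R : realType} {d : measure_display} {Omega : measurableType d}.
Local Notation mu := (@lebesgue_measure R).
Variable P : probability Omega R.
Variable theta : R -> Omega -> Omega.
Hypothesis theta_ergodic : ergodic_flow P theta.
Variable phi : Omega -> R.
Hypothesis boundary_meas : measurable_boundary theta phi.
Hypothesis boundary_bnd : locally_bounded_boundary theta phi.

Local Notation bd w := (boundary theta phi w).
Let bP w : regular_boundary (bd w).
Proof. exact: boundary_regular. Qed.

(** The gain is nondecreasing and the parabola continuous in s, so a departure
    time can be moved slightly to the right, to a rational time, at a cost that
    exceeds the original one by as little as desired. *)
Lemma past_cost_rational (w : Omega) t y c :
  (forall r : rat, ratr r < t -> c <= past_cost (bd w) t y (ratr r)) ->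
  c <= potential (bd w) t y.
Proof.
move=> h; apply: le_potential => // s st.
rewrite leNgt; apply/negP => lt_c.
have st' : 0 < t - s by rewrite subr_gt0.
pose A := gain (bd w) t - gain (bd w) s.
pose D := c - A.
have D_gt : y ^+ 2 / (2 * (t - s)) < D by move: lt_c; rewrite /past_cost /D /A; lra.
have D0 : 0 < D.
  by apply: le_lt_trans D_gt; rewrite divr_ge0 ?sqr_ge0// mulr_ge0// ltW.
(* before time z the kinetic part of the cost is below D *)
pose z := t - y ^+ 2 / (2 * D).
have yD : y ^+ 2 < D * (2 * (t - s)) by rewrite -ltr_pdivrMr// mulr_gt0.
have sz : s < Num.min t z.
  rewrite lt_min st /z ltrBrDl -ltrBrDr ltr_pdivrMr ?mulr_gt0//; lra.
have [r] := rat_in_itvoo sz; rewrite in_itv/= lt_min => /and3P[sr rt rz].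
have := h r rt; apply/negP; rewrite -ltNge /past_cost.
have := gain_nd (bP w) (ltW sr).
have rt' : 0 < 2 * (t - ratr r) by rewrite mulr_gt0// subr_gt0.
have : y ^+ 2 / (2 * (t - ratr r)) < D.
  have h1 : y ^+ 2 / (2 * D) < t - ratr r by rewrite /z in rz; lra.
  rewrite ltr_pdivrMr//; move: h1; rewrite ltr_pdivrMr ?mulr_gt0//; lra.
rewrite /D /A; lra.
Qed.

Lemma measurable_potential t y : measurable_fun setT (fun w => potential (bd w) t y).
Proof.
apply: (measurability (@RGenCInfty.G R)); first exact: RGenCInfty.measurableE.
move=> _ [_ [c ->] <-]; rewrite setTI.
have -> : (fun w => potential (bd w) t y) @^-1` `[c, +oo[%classic =
    \bigcap_(r in [set r : rat | ratr r < t]) [set w | c <= past_cost (bd w) t y (ratr r)].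
  apply/seteqP; split => w /=.
    by rewrite in_itv/= andbT => cW r rt; apply: (le_trans cW); exact: potential_le.
  by move=> h; rewrite in_itv/= andbT; exact: past_cost_rational.
rewrite bigcap_mkcond -[X in measurable X]setCK; apply: measurableC.
rewrite setC_bigcap; apply: bigcupT_measurable_rat => r; apply: measurableC.
case: ifP => _; last exact: measurableT.
rewrite -[X in measurable X]setTI.
have mc : measurable_fun setT (fun w => past_cost (bd w) t y (ratr r)).
  apply: measurable_funD => //; apply: measurable_funB; exact: measurable_gain.
have := mc measurableT `[c, +oo[%classic (measurable_itv _).
congr (measurable (_ `&` _)).
by apply/seteqP; split => x /=; rewrite in_itv/= andbT.
Qed.

Lemma potential_flow t w s : potential (bd (theta t w)) s = potential (bd w) (s + t).
Proof.
apply/funext => x; rewrite /potential; congr inf.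
have cost r : past_cost (bd (theta t w)) s x r = past_cost (bd w) (s + t) x (r + t).
  rewrite /past_cost !(gain_flow theta_ergodic)//.
  have -> : s + t - (r + t) = s - r by lra.
  lra.
apply/seteqP; split => _ [r + <-] /=; rewrite ?in_itv/= => rs.
  by exists (r + t); rewrite ?cost//= ?in_itv/= ltrD2r.
by exists (r - t); rewrite ?cost ?subrK//= ?in_itv/= ltrBlDr.
Qed.

Lemma velocity_flow t w s : velocity (bd (theta t w)) s = velocity (bd w) (s + t).
Proof. by apply/funext => x; rewrite /velocity /difference_quotient potential_flow. Qed.

(** Evaluated at time 0 along the orbit so that stationarity holds by definition;
    [stationary_solutionE] gives the description at a fixed sample. *)
Definition stationary_solution (w : Omega) (t : R) : R -> R := velocity (bd (theta t w)) 0.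

Lemma stationary_solutionE w t : stationary_solution w t = velocity (bd w) t.
Proof. by rewrite /stationary_solution velocity_flow add0r. Qed.

Lemma stationary_solution_UU w t : UU -oo%E (stationary_solution w t).
Proof.
rewrite stationary_solutionE; apply: UU_ninfty_of_nonneg.
  exact: velocity_L1loc.
by move=> y y0; rewrite primitive_velocity// potential_ge0.
Qed.

Lemma stationary_solution_stationary : stationary theta stationary_solution.
Proof.
move=> w t; rewrite /stationary_solution.
have [[th0 _] _ _ _] := theta_ergodic.
by rewrite th0; apply: aeW.
Qed.

Lemma stationary_solution_evolution w t0 t1 : t0 < t1 ->
  eqU (Phi (bd w) t0 t1 (stationary_solution w t0)) (stationary_solution w t1).
Proof.
move=> t01; rewrite !stationary_solutionE.
have vE x : 0 <= x -> value (bd w) (velocity (bd w) t0) t0 t1 x =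
    potential (bd w) t1 x + - (gain (bd w) t1 - gain (bd w) t0).
  move=> x0; apply: value_potential => // y y0; exact: primitive_velocity.
have := velocity_rc_derivative (bP w) t1; have := @ae_lebesgue_neq R 0.
move=> h1 h2; apply: (ae_filter2 h1 h2) => x xn0 + x0 => /(_ x0) <-.
apply: (@rc_derivative_shift _ _ _ (- (gain (bd w) t1 - gain (bd w) t0))).
have xgt0 : 0 < x by rewrite lt_def xn0.
by near=> y; apply: vE; apply: ltW; near: y; exact: lt_nbhsr.
Unshelve. all: by end_near. Qed.

Lemma stationary_solution_global : global_solution P theta phi stationary_solution.
Proof.
split; last by apply: aeW => w t0 t1; exact: stationary_solution_evolution.
split; first exact: stationary_solution_UU.
move=> t y y0; under eq_fun do rewrite stationary_solutionE primitive_velocity//.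
exact: measurable_potential.
Qed.

Theorem attraction_ae (q : R) (w : Omega) : mean_gain (bd w) q ->
  forall a C r, 0 <= a -> a < q -> 0 <= C -> 0 <= r ->
  exists T : R, 0 < T /\ forall t0 u0, t0 < - T ->
    (forall y, 0 <= y -> - a * y - C <= primitive u0 y) ->
    {ae mu, forall x, 0 <= x <= r -> Phi (bd w) t0 0 u0 x = stationary_solution w 0 x}.
Proof.
move=> mg a C r a0 aq C0 r0; have [T [T0 TP]] := attraction (bP w) mg a0 aq C0 r0.
exists T; split => // t0 u0 t0T UC; have [m mP] := TP t0 u0 t0T UC.
rewrite stationary_solutionE.
by apply: (@coincide_of_shift _ _ (potential (bd w) 0) _ m) => //;
  exact: velocity_rc_derivative.
Qed.

End StationarySolution.

(** * Recurrence, uniqueness and convergence *)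

Section AlmostSure.
Context {R : realType} {d : measure_display} {Omega : measurableType d}.
Variable P : probability Omega R.

Lemma ae_preserved (tau : Omega -> Omega) (Q : Omega -> Prop) :
  measurable_fun setT tau -> (forall A, measurable A -> P (tau @^-1` A) = P A) ->
  {ae P, forall w, Q w} -> {ae P, forall w, Q (tau w)}.
Proof.
move=> mtau tauP [N [mN PN QN]]; exists (tau @^-1` N); split.
- by rewrite -[X in measurable X]setTI; exact: mtau.
- by rewrite tauP.
- by move=> w /= h; apply: QN.
Qed.

(** The reverse Fatou inequality for events. *)
Lemma prob_infinitely_often (A : nat -> set Omega) (c : \bar R) :
  (forall k, measurable (A k)) -> (forall k, (c <= P (A k))%E) ->
  (c <= P [set w | forall n, exists2 k, (n <= k)%N & A k w])%E.
Proof.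
move=> mA cA; pose F n := \bigcup_(k in [set k | (n <= k)%N]) A k.
have mF n : measurable (F n) by apply: bigcup_measurable => k _.
have -> : [set w | forall n, exists2 k, (n <= k)%N & A k w] = \bigcap_n F n.
  apply/seteqP; split => w h n; first by move=> _; have [k nk Ak] := h n; exists k.
  by have [k nk Ak] := h n Logic.I; exists k.
have cv : (P \o F) n @[n --> \oo] --> P (\bigcap_n F n).
  apply: nonincreasing_cvg_mu => //.
  - by rewrite (le_lt_trans (probability_le1 _ _))// ltry.
  - exact: bigcapT_measurable.
  - move=> n m nm; apply/subsetPset => w [k mk Ak]; exists k => //.
    exact: leq_trans mk.
move/cvg_lim : (cv) => <- //.
apply: lime_ge; first by apply/cvg_ex; eexists; exact: cv.
near=> n; apply: (le_trans (cA n)); apply: le_measure; rewrite ?inE//.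
by move=> w An; exists n => /=.
Unshelve. all: by end_near. Qed.

Lemma measurable_infinitely_often (A : nat -> set Omega) :
  (forall k, measurable (A k)) ->
  measurable [set w | forall n, exists2 k, (n <= k)%N & A k w].
Proof.
move=> mA.
have -> : [set w | forall n, exists2 k, (n <= k)%N & A k w] =
    \bigcap_n \bigcup_(k in [set k | (n <= k)%N]) A k.
  apply/seteqP; split => w h n; first by move=> _; have [k nk Ak] := h n; exists k.
  by have [k nk Ak] := h n Logic.I; exists k.
by apply: bigcapT_measurable => n; apply: bigcup_measurable => k _.
Qed.

(** Poincare recurrence for an increasing sequence of events that exhausts the
    space.  The probability of visiting E n infinitely often is at least P (E n),
    whatever the measure-preserving maps tau k are, and P (E n) tends to 1. *)
Lemma ae_recurrence (tau : nat -> Omega -> Omega) (E : nat -> set Omega) :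
  (forall k, measurable_fun setT (tau k)) ->
  (forall k A, measurable A -> P (tau k @^-1` A) = P A) ->
  (forall n, measurable (E n)) -> {homo E : n m / (n <= m)%N >-> n `<=` m} ->
  {ae P, forall w, exists n, E n w} ->
  {ae P, forall w, exists n, forall N, exists2 k, (N <= k)%N & E n (tau k w)}.
Proof.
move=> mtau tauP mE ndE Efull.
pose D n := [set w | forall N, exists2 k, (N <= k)%N & E n (tau k w)].
have mtE n k : measurable (tau k @^-1` E n).
  by rewrite -[X in measurable X]setTI; exact: mtau.
have mD n : measurable (D n) by exact: (measurable_infinitely_often (mtE n)).
have mU : measurable (\bigcup_n D n) by exact: bigcupT_measurable.
have ED n : (P (E n) <= P (D n))%E.
  by apply: (prob_infinitely_often (mtE n)) => k; rewrite tauP.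
have PU : P (\bigcup_n D n) = 1%E.
  apply/eqP; rewrite eq_le probability_le1//=.
  have mUE : measurable (\bigcup_n E n) by exact: bigcupT_measurable.
  have PE : P (\bigcup_n E n) = 1%E.
    have [N [mN PN NE]] := Efull.
    apply/eqP; rewrite eq_le probability_le1//= -(probability_setT P).
    rewrite -(setvU (\bigcup_n E n)) (le_trans (measureU2 _ _ _))//; last 1 first.
      rewrite [X in (X + _ <= _)%E](_ : _ = 0%E) ?add0e//.
      apply/eqP; rewrite eq_le measure_ge0 andbT -PN.
      apply: le_measure; rewrite ?inE//; first exact: measurableC.
      by move=> w /= h; apply: NE => -[n En]; apply: h; exists n.
    exact: measurableC.
  have cv : (P \o E) n @[n --> \oo] --> P (\bigcup_n E n).
    by apply: nondecreasing_cvg_mu => // n m nm; apply/subsetPset; exact: ndE.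
  rewrite -PE; move/cvg_lim : (cv) => <- //.
  apply: lime_le; first by apply/cvg_ex; eexists; exact: cv.
  near=> n; apply: (le_trans (ED n)); apply: le_measure; rewrite ?inE//.
  exact: bigcup_sup.
exists (~` \bigcup_n D n); split; first exact: measurableC.
  by rewrite probability_setC// PU subee.
by move=> w h [n _ Dn]; apply: h; exists n.
Unshelve. all: by end_near. Qed.

End AlmostSure.

Section Uniqueness.
Context {R : realType} {d : measure_display} {Omega : measurableType d}.
Local Notation mu := (@lebesgue_measure R).
Variable P : probability Omega R.
Variable theta : R -> Omega -> Omega.
Hypothesis theta_ergodic : ergodic_flow P theta.
Variable phi : Omega -> R.
Hypothesis phi_meas : measurable_fun setT phi.
Hypothesis boundary_meas : measurable_boundary theta phi.
Hypothesis boundary_bnd : locally_bounded_boundary theta phi.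
Variable q : R.
Hypothesis q_ge0 : 0 <= q.
Hypothesis q_def : ('E_P[fun w => (Num.max (phi w) 0 ^+ 2)%R] = (q ^+ 2)%:E)%E.

Local Notation bd w := (boundary theta phi w).
Local Notation u := (stationary_solution theta phi).
Let bP w : regular_boundary (bd w).
Proof. exact: boundary_regular. Qed.

Section Candidate.
Variable u' : Omega -> R -> R -> R.
Hypothesis u'_global : global_solution P theta phi u'.
Hypothesis u'_stationary : stationary theta u'.
Hypothesis u'_UU : {ae P, forall w, forall t, UU (- q)%:E (u' w t)}.

Let u'L w t : L1loc (u' w t).
Proof. by have [[h _] _] := u'_global; exact: UU_L1loc (h w t). Qed.

Lemma primitive_stationary w t : primitive (u' w t) = primitive (u' (theta t w) 0).
Proof. exact: eq_primitive. Qed.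

(* [E n] increases to a full event because UU (- q) asks for a slope strictly
   above - q, while each single slope - slope n is a uniform bound *)
Let slope (n : nat) : R := q - n.+1%:R^-1.
Let E (n : nat) : set Omega :=
  [set w | forall y, 0 <= y -> - slope n * y - n%:R <= primitive (u' w 0) y].

Lemma measurable_lower_bound n : measurable (E n).
Proof.
have -> : E n = \bigcap_(r in [set r : rat | 0 <= (ratr r : R)])
    [set w | - slope n * ratr r - n%:R <= primitive (u' w 0) (ratr r)].
  apply/seteqP; split => w /=; first by move=> h r r0; exact: h.
  move=> h y y0; apply: le_primitive_of_rational y y0; first exact: u'L.
  by move=> r r0; exact: h.
rewrite bigcap_mkcond -[X in measurable X]setCK; apply: measurableC.
rewrite setC_bigcap; apply: bigcupT_measurable_rat => r; apply: measurableC.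
case: ifPn => [/set_mem/= r0|_]; last exact: measurableT.
have [[_ mp] _] := u'_global.
rewrite -[X in measurable X]setTI.
have := mp 0 (ratr r) r0 measurableT `[- slope n * ratr r - n%:R, +oo[%classic (measurable_itv _).
congr (measurable (_ `&` _)).
by apply/seteqP; split => x /=; rewrite in_itv/= andbT.
Qed.

Lemma lower_bound_nd : {homo E : n m / (n <= m)%N >-> n `<=` m}.
Proof.
move=> n m nm w h y y0; apply: le_trans (h y y0).
have nm' : n%:R <= m%:R :> R by rewrite ler_nat.
have : slope n <= slope m by rewrite lerD2l lerN2 lef_pV2 ?posrE// ler_nat ltnS.
nra.
Qed.

(** UU (- q) provides a slope above - q, and both the slope and the constant fit
    into E n for large n. *)
Lemma lower_bound_full : {ae P, forall w, exists n, E n w}.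
Proof.
have F := ae_filter_ringOfSetsType P.
apply: filterS u'_UU => w /(_ 0) /UU_lower[a [C [qa C0 hC]]].
have qa0 : 0 < a + q by lra.
pose n := (Num.truncn (Num.max (a + q)^-1 C)).+1; exists n => y y0.
have : Num.max (a + q)^-1 C < n%:R by exact: Num.Theory.truncnS_gt.
rewrite gt_max => /andP[n1 n2]; apply: le_trans (hC y y0).
have : n.+1%:R^-1 <= a + q.
  rewrite -[leRHS]invrK lef_pV2 ?posrE ?invr_gt0// (le_trans (ltW n1))//.
  by rewrite ler_nat.
rewrite /slope; move: (n.+1%:R^-1) => e he; nra.
Qed.

(** Recurrence gives times - k beyond the threshold of [attraction_ae] at which the
    competitor satisfies one and the same lower bound. *)
Lemma unique_at_zero : 0 < q -> {ae P, forall w, eqU (u' w 0) (u w 0)}.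
Proof.
move=> q0; have [_ mth thP _] := theta_ergodic; have [_ glob] := u'_global.
have F := ae_filter_ringOfSetsType P.
have rec := @ae_recurrence _ _ _ P (fun k => theta (- k%:R)) E
  (fun k => mth _) (fun k => thP _) measurable_lower_bound lower_bound_nd lower_bound_full.
have mg := mean_gain_ae theta_ergodic phi_meas boundary_meas boundary_bnd q_def.
apply: filterS3 rec mg glob => w [n wn] mgw globw.
apply: coincide_everywhere => r.
pose a := Num.max (slope n) 0.
have [a0 sa] : 0 <= a /\ slope n <= a by rewrite !le_max !lexx orbT.
have aq : a < q.
  have : 0 < n.+1%:R^-1 :> R by rewrite invr_gt0.
  by rewrite gt_max q0 andbT /slope ltrBlDr ltrDl.
have [T [T0 TP]] := attraction_ae theta_ergodic boundary_meas boundary_bnd mgw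
  a0 aq (ler0n R n) (ler0n R r).
have [k Tk wk] := wn (Num.truncn T).+1.
have kT : - k%:R < - T.
  rewrite ltrN2; apply: (lt_le_trans (Num.Theory.truncnS_gt T)); by rewrite ler_nat.
have low y : 0 <= y -> - a * y - n%:R <= primitive (u' w (- k%:R)) y.
  move=> y0; rewrite primitive_stationary; apply: le_trans (wk y y0).
  by rewrite lerD2r ler_wpM2r// lerN2.
have k0 : - k%:R < 0 :> R by apply: lt_trans kT _; rewrite oppr_lt0.
apply: (ae_filter2 (globw _ _ k0) (TP _ _ kT low)) => x h1 h2 /andP[x0 xr].
by rewrite -h1// h2// x0.
Qed.

(** The conclusion holds for want of competitors: started at time - k, a
    solution has at time 0 a primitive of at most r^2 / (2 k) at r, for every k,
    hence a nonpositive one, against membership in UU 0. *)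
Lemma unique_at_zero_without_gain : q = 0 -> {ae P, forall w, eqU (u' w 0) (u w 0)}.
Proof.
move=> q0; have [_ mth thP _] := theta_ergodic; have [_ glob] := u'_global.
have F := ae_filter_ringOfSetsType P.
have mp k := measurable_past_gain boundary_meas k.
have pg1 : {ae P, forall w, past_gain theta phi 1 w = 0}.
  have := expectation_past_gain1 theta_ergodic phi_meas boundary_meas boundary_bnd q_def.
  rewrite q0 expr0n/= => int0.
  have m1 : measurable_fun setT (fun w => (past_gain theta phi 1 w)%:E).
    by apply/measurable_EFinP; exact: mp.
  have ge0 w : (0 <= (past_gain theta phi 1 w)%:E)%E by rewrite lee_fin past_gain1_ge0.
  have := (@ae_eq_integral_abs _ _ _ P setT measurableT _ m1).1.
  under eq_integral do rewrite gee0_abs//.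
  by move=> /(_ int0); apply: filterS => w /(_ Logic.I)[].
have pg k : {ae P, forall w, past_gain theta phi k w = 0}.
  elim: k => [|k ih]; first by apply: aeW => w; exact: past_gain0.
  apply: filterS2 pg1 (ae_preserved (mth (-1)) (thP (-1)) ih) => w h1 h2.
  by rewrite (past_gainS theta_ergodic)// h1 h2 addr0.
apply: filterS3 (ae_foralln pg) u'_UU glob => w pgw UUw globw; exfalso.
have gain_w s : s <= 0 -> gain (bd w) s = 0.
  move=> s0; pose k := (Num.truncn (- s)).+1.
  have ks : - k%:R <= s by rewrite lerNl ltW// Num.Theory.truncnS_gt.
  have := pgw k; rewrite /past_gain => h.
  have := gain_nd (bP w) ks; have := gain_nd (bP w) s0; rewrite gain0; lra.
rewrite q0 oppr0 in UUw.
have upper r (k : nat) : 0 < r -> primitive (u' w 0) r <= r ^+ 2 / (2 * k.+1%:R).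
  move=> r0; have [a [C [a0 C0 hC]]] := UU_lower (UUw (- k.+1%:R)).
  have k0 : - k.+1%:R < 0 :> R by rewrite oppr_lt0.
  have UC y : 0 <= y -> - C <= primitive (u' w (- k.+1%:R)) y.
    move=> y0; apply: le_trans (hC y y0).
    by have := mulr_ge0 (ltW a0) y0; lra.
  have := primitive_le_without_gain (bP w) k0 gain_w UC (u'L w 0) (globw _ _ k0) r0.
  by rewrite opprK.
have nonpos r : 0 < r -> primitive (u' w 0) r <= 0.
  move=> r0; apply/ler_addgt0Pr => e e0; rewrite add0r.
  pose k := Num.truncn (r ^+ 2 / (2 * e)).
  apply: (le_trans (upper r k r0)).
  have : r ^+ 2 / (2 * e) < k.+1%:R by exact: Num.Theory.truncnS_gt.
  rewrite ltr_pdivrMr ?mulr_gt0// ler_pdivrMr ?mulr_gt0// => h; apply: ltW.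
  by apply: (lt_le_trans h); rewrite mulrCA (mulrC _ e) mulrCA.
have [a [C [a0 C0 hC]]] := UU_lower (UUw 0).
(* the lower bound a y - C is positive here *)
pose y := (C + 1) / a.
have y0 : 0 < y by rewrite divr_gt0//; lra.
have := hC y (ltW y0); have := nonpos y y0.
have -> : a * y = C + 1 by rewrite /y mulrC divfK// gt_eqF.
lra.
Qed.

(** Stationarity moves the equality from time 0 to the times - n, and any time is
    reached from one of them by the common evolution. *)
Lemma uniqueness : {ae P, forall w, forall t, eqU (u' w t) (u w t)}.
Proof.
have [_ mth thP _] := theta_ergodic; have [_ glob] := u'_global.
have F := ae_filter_ringOfSetsType P.
have Fmu := ae_filter_ringOfSetsType mu.
have zero : {ae P, forall w, eqU (u' w 0) (u w 0)}.
  move: (q_ge0); rewrite le_eqVlt => /predU1P[/esym|].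
    exact: unique_at_zero_without_gain.
  exact: unique_at_zero.
have past (n : nat) : {ae P, forall w, eqU (u' w (- n%:R)) (u w (- n%:R))}.
  apply: filterS (ae_preserved (mth (- n%:R)) (thP (- n%:R)) zero) => w h.
  have s1 := u'_stationary w (- n%:R).
  have s2 := stationary_solution_stationary theta_ergodic phi w (- n%:R).
  apply: filterS3 s1 s2 h => x h1 h2 h3 x0.
  exact: (etrans (h1 x0) (etrans (h3 x0) (esym (h2 x0)))).
apply: filterS2 (ae_foralln past) glob => w pastw globw t.
pose n := (Num.truncn (- t)).+1.
have nt : - n%:R < t.
  by rewrite ltrNl; exact: Num.Theory.truncnS_gt.
have L : L1loc (u w (- n%:R)).
  apply: (@UU_L1loc _ -oo%E).
  exact: (stationary_solution_UU theta_ergodic boundary_meas boundary_bnd).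
have e1 := globw _ _ nt.
have e2 := stationary_solution_evolution theta_ergodic boundary_meas boundary_bnd w nt.
rewrite (Phi_primitive _ _ _ (eq_primitive (u'L w _) L (pastw n))) in e1.
apply: filterS2 e1 e2 => x h1 h2 x0.
exact: (etrans (esym (h1 x0)) (h2 x0)).
Qed.

End Candidate.

(** Coincidence on [0, r] for all times before some threshold is convergence for
    the distance, as exp (- r) is arbitrarily small. *)
Lemma attraction_distU (v : R -> R) : 0 < q -> UU (- q)%:E v ->
  {ae P, forall w, distU (Phi (bd w) t 0 v) (u w 0) @[t --> -oo] --> (0 : R)}.
Proof.
move=> q0 /UU_lower[a' [C [qa C0 hC]]].
have F := ae_filter_ringOfSetsType P.
apply: filterS (mean_gain_ae theta_ergodic phi_meas boundary_meas boundary_bnd q_def) => w mg.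
pose a := Num.max (- a') 0.
have [a0 sa] : 0 <= a /\ - a' <= a by rewrite !le_max !lexx orbT.
have aq : a < q by rewrite gt_max q0 andbT; lra.
have low y : 0 <= y -> - a * y - C <= primitive v y.
  move=> y0; apply: le_trans (hC y y0); rewrite lerD2r ler_wpM2r//; lra.
apply/cvgrPdist_le => e e0.
pose r := Num.max 0 (- ln e).
have r0 : 0 <= r by rewrite le_max lexx.
have re : expR (- r) <= e.
  rewrite -[leRHS]lnK ?posrE// ler_expR lerNl /r le_max lexx orbT//.
have [T [T0 TP]] := attraction_ae theta_ergodic boundary_meas boundary_bnd mg a0 aq C0 r0.
near=> t; rewrite sub0r normrN ger0_norm ?distU_ge0//.
apply: le_trans re; apply: distU_le => //; apply: TP => //; near: t.
by apply: nbhs_ninfty_lt; exact: num_real.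
Unshelve. all: by end_near. Qed.

End Uniqueness.

Unset Implicit Arguments.
Set Strict Implicit.
Set Printing Implicit Defensive.

(* The attraction property is stated for 0 < q: it fails for q = 0, e.g. when
   phi = 0 and v = 1, where the solution at time 0 started at time t < 0 is
   x / |t| for x < |t|. *)
Theorem theorem4p2 (R : realType) (d : measure_display)
    (Omega : measurableType d) (P : probability Omega R)
    (theta : R -> Omega -> Omega) (phi : Omega -> R) (q : R)
    (theta_ergodic : ergodic_flow P theta)
    (phi_meas : measurable_fun setT phi)
    (boundary_meas : measurable_boundary theta phi)
    (boundary_bnd : locally_bounded_boundary theta phi)
    (q_ge0 : 0 <= q)
    (q_def : ('E_P[fun w => (Num.max (phi w) 0 ^+ 2)%R] = (q ^+ 2)%:E)%E) :
  exists u : Omega -> R -> R -> R,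
    [/\ global_solution P theta phi u /\ stationary theta u,
        forall u' : Omega -> R -> R -> R,
          global_solution P theta phi u' -> stationary theta u' ->
          {ae P, forall w, forall t, UU (- q)%:E (u' w t)} ->
          {ae P, forall w, forall t, eqU (u' w t) (u w t)}
      & 0 < q -> forall v : R -> R, UU (- q)%:E v ->
          {ae P, forall w,
             distU (Phi (boundary theta phi w) t 0 v) (u w 0)
               @[t --> -oo] --> (0 : R)}].
Proof.
exists (stationary_solution theta phi); split.
- split; first exact: (stationary_solution_global theta_ergodic boundary_meas boundary_bnd).
  exact: (stationary_solution_stationary theta_ergodic phi).
- move=> u' u'_global u'_stationary u'_UU.
  exact: (uniqueness theta_ergodic phi_meas boundary_meas boundary_bnd q_ge0 q_def
    u'_global u'_stationary u'_UU).
- move=> q0 v.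
  exact: (attraction_distU theta_ergodic phi_meas boundary_meas boundary_bnd q_def q0).
Qed.
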